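(* Let $\ell\in\mathbb{N}=\{1,2,\dots\}$. Then the RBF Landau level $\mathbf{H}^\ell(\mathbb{C})$ and the true polyanalytic RBF space $\mathcal{H}^{(\ell)}_T(\mathbb{C})$ coincide: $$\mathbf{H}^\ell(\mathbb{C})=\mathcal{H}^{(\ell)}_T(\mathbb{C}).$$
   Context: Write $z=x+iy$, let $d\lambda=dx\,dy$, and let $\frac{d}{dz}=\frac12(\partial_x-i\partial_y)$, $\frac{d}{d\overline{z}}=\frac12(\partial_x+i\partial_y)$. $L^2\big(\mathbb{C},e^{\frac{(z-\overline{z})^2}{4}}\big)$ is the space of measurable $f$ with $\int_{\mathbb{C}}|f(z)|^2e^{\frac{(z-\overline z)^2}{4}}d\lambda(z)<\infty$ (functions are identified up to null sets). The Landau-type operator is $$\widetilde{\Box}=-\frac{d^2}{dz\,d\overline{z}}-\frac{z}{2}\frac{d}{d\overline{z}}+\frac{\overline{z}}{2}\frac{d}{d\overline{z}},$$ and the RBF Landau level is $$\mathbf{H}^\ell(\mathbb{C}):=\left\{f\in L^2\big(\mathbb{C},e^{\frac{(z-\overline{z})^2}{4}}\big)\ :\ \widetilde{\Box}f=\frac{\ell-1}{2}f\right\},$$ where the differential equation is understood in the sense of distributions. The true polyanalytic RBF space $\mathcal{H}_T^{(\ell)}(\mathbb{C})$ consists of the functions $f\in L^2\big(\mathbb{C},e^{\frac{(z-\overline{z})^2}{4}}\big)$ for which there exists an entire function $h$ with $$f(z)=\frac{2^{\ell-1}}{\sqrt{(\ell-1)!}}\,e^{\frac{|z|^2}{2}-\frac{z^2}{4}}\,\frac{\partial^{\ell-1}}{\partial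 z^{\ell-1}}\left(h(z)e^{-\frac{|z|^2}{2}}\right),\quad z\in\mathbb{C}.$$ *)

(* Defs.v *)
From HB Require Import structures.
From mathcomp Require Import all_boot all_order all_algebra.
From mathcomp Require Import complex ring.
From mathcomp Require Import all_classical all_reals all_analysis.

Set Implicit Arguments.
Unset Strict Implicit.
Unset Printing Implicit Defensive.

Import Order.TTheory GRing.Theory Num.Theory.
Import numFieldNormedType.Exports.

Local Open Scope classical_set_scope.
Local Open Scope ring_scope.
Local Open Scope complex_scope.

Section RBFLandau.
Variable R : realType.
Local Notation C := R[i].

Implicit Types (f g h phi m : C -> C) (z : C) (l : nat).

(** Lebesgue measure on the plane; the complex plane is parametrised by
    [R * R] through [ofxy]. *)

Definition ofxy (p : R * R) : C := p.1 +i* p.2.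

Definition leb2 := (@lebesgue_measure R \x @lebesgue_measure R)%E.

Definition cmeasurable f :=
  measurable_fun [set: measurableTypeR R * measurableTypeR R] (fun p => complex.Re (f (ofxy p))) /\
  measurable_fun [set: measurableTypeR R * measurableTypeR R] (fun p => complex.Im (f (ofxy p))).

Definition cintegral f : C :=
  (\int[leb2]_p complex.Re (f (ofxy p)))%R +i*
  (\int[leb2]_p complex.Im (f (ofxy p)))%R.

Definition ae_eqC f g := {ae leb2, forall p, f (ofxy p) = g (ofxy p)}.

Definition cexp z : C :=
  (expR (complex.Re z))%:C * (cos (complex.Im z) +i* sin (complex.Im z)).

(** The weight of the L2 space is real-valued, see [weightE]. *)
Definition weight z : R := complex.Re (cexp ((z - z^*) ^+ 2 / 4%:R)).

Lemma weightE z : cexp ((z - z^*) ^+ 2 / 4%:R) = (expR (- complex.Im z ^+ 2))%:C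
  /\ weight z = expR (- complex.Im z ^+ 2).
Proof.
have E : (z - z^*) ^+ 2 / 4%:R = (- complex.Im z ^+ 2)%:C.
  have -> : z - z^* = 2%:R * ((complex.Im z)%:C * 'i).
    case: z => a b; simpc; apply/eqP.
    by rewrite eq_complex /=; apply/andP; split; apply/eqP; ring.
  rewrite !exprMn sqr_i rmorphN rmorphXn /=.
  rewrite -natrX mulrAC divff ?pnatr_eq0// mul1r; ring.
suff H : cexp ((z - z^*) ^+ 2 / 4%:R) = (expR (- complex.Im z ^+ 2))%:C.
  by split => //; rewrite /weight H.
by rewrite E /cexp /= cos0 sin0 mulr1.
Qed.

(** Functions, not classes: the sets of functions below are closed under
    almost everywhere equality of measurable functions. *)
Definition L2w : set (C -> C) := [set f | cmeasurable f /\
  (\int[leb2]_p (ComplexField.Normc.normc (f (ofxy p)) ^+ 2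
                 * weight (ofxy p))%:E < +oo)%E].

(** [ddir v f z] is the derivative of
    [t |-> f (z + t v)] at [t = 0], [t] real.  [dz] and [dzbar] are thus the
    Wirtinger operators, and [smooth] is meant in the real sense. *)

Definition ddir (v : C) f : C -> C := fun z =>
  derive1 (fun t : R => complex.Re (f (z + t%:C * v))) 0 +i*
  derive1 (fun t : R => complex.Im (f (z + t%:C * v))) 0.

Definition has_ddir (v : C) f := forall z,
  derivable (fun t : R => complex.Re (f (z + t%:C * v))) 0 1 /\
  derivable (fun t : R => complex.Im (f (z + t%:C * v))) 0 1.

Definition dx f : C -> C := ddir 1 f.
Definition dy f : C -> C := ddir 'i f.
Definition dz f : C -> C := fun z => 2%:R^-1 * (dx f z - 'i * dy f z).
Definition dzbar f : C -> C := fun z => 2%:R^-1 * (dx f z + 'i * dy f z).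

Fixpoint Ck (k : nat) f : Prop :=
  continuous (f : C^o -> C^o) /\
  if k is k'.+1 then [/\ has_ddir 1 f, has_ddir 'i f, Ck k' (dx f) & Ck k' (dy f)]
  else True.

Definition smooth f := forall k, Ck k f.

Definition test_function : set (C -> C) := [set phi |
  smooth phi /\ compact (closure ([set z | phi z != 0] : set C^o))].

Definition entire h := forall z, derivable (h : C^o -> C^o) z 1.

(** Distributions, as functionals on functions of which only the values on
    test functions matter. *)

Definition functional := (C -> C) -> C.
Implicit Type T : functional.

Definition dist_of f : functional := fun phi => cintegral (fun z => f z * phi z).
Definition dist_dz T : functional := fun phi => - T (dz phi).
Definition dist_dzbar T : functional := fun phi => - T (dzbar phi).
Definition dist_mul m T : functional := fun phi => T (fun z => m z * phi z).
Definition dist_eq T1 T2 := forall phi, test_function phi -> T1 phi = T2 phi.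

Definition Box T : functional := fun phi =>
  - dist_dz (dist_dzbar T) phi
  - dist_mul (fun z => z / 2%:R) (dist_dzbar T) phi
  + dist_mul (fun z => z^* / 2%:R) (dist_dzbar T) phi.

(** [Box (dist_of f)] is [Box f] in the sense of distributions; [f] in [L2w] is
    locally integrable, the weight being locally bounded below. *)
Definition landau_level l : set (C -> C) := [set f | L2w f /\
  dist_eq (Box (dist_of f))
          (dist_mul (fun=> (l%:R - 1) / 2%:R) (dist_of f))].

Definition true_polyRBF l : set (C -> C) := [set f | L2w f /\
  exists2 h, entire h & ae_eqC f (fun z =>
    (2%:R ^+ l.-1 / Num.sqrt (l.-1)`!%:R)%:C
    * cexp (`|z| ^+ 2 / 2%:R - z ^+ 2 / 4%:R)
    * iter l.-1 dz (fun w => h w * cexp (- (`|w| ^+ 2 / 2%:R))) z)].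

End RBFLandau.

Arguments landau_level R l : clear implicits.
Arguments true_polyRBF R l : clear implicits.

(* Main.v *)
Require Import Defs.
From mathcomp Require Import all_boot all_order all_algebra.
From mathcomp Require Import complex ring lra.
From mathcomp Require Import all_classical all_reals all_analysis.
From mathcomp Require Import measurable_realfun.

(** With n = l - 1 and u = f e^(z^2/4 - |z|^2/2), the equation tested against e^(z^2/4 -
    |z|^2/2) g reads: the integral of u L g vanishes, where L = d_zbar d_z - (z/2) d_z + n/2; a
    cut-off extends this from test functions to every g of subgaussian growth. Conversely d_z^n
    (h e^(-|z|^2/2)) solves this equation by integration by parts.

    Fix w and t and put X = t (w - z), E_k(s) = X^k e^(zbar w/2 + s X). Since 2 L E_k = (n - k)
    E_k - s E_{k+1}, the moments Phi_k(s) of u against E_k(s) satisfy Phi_k' = Phi_{k+1} and (n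
    - k) Phi_k = s Phi_{k+1}. Hence Phi_{n+1} = 0, so Phi_n is constant and n! Phi_0(1) =
    Phi_n(1) = Phi_n(0): the integral of u e^(zbar w/2 + t (w - z)) is t^n h(w)/n!, with h
    entire. Integrations by parts and the mean value property show that d_z^n (h e^(-|z|^2/2))
    has the same integrals up to a constant factor. For w = 2 tbar the exponential e^(zbar w/2 -
    t z) runs through all the characters of the plane, so the two functions are proportional. *)

Set Implicit Arguments.
Unset Strict Implicit.
Unset Printing Implicit Defensive.
Import Order.TTheory GRing.Theory Num.Theory.
Import numFieldNormedType.Exports.
Local Open Scope classical_set_scope.
Local Open Scope ring_scope.
Local Open Scope complex_scope.

(** * Wirtinger calculus *)

Section RBF.
Variable R : realType.
Local Notation C := R[i].
Local Notation nm := (@ComplexField.Normc.normc R).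
Local Notation Re := (@complex.Re R).
Local Notation Im := (@complex.Im R).
Implicit Types (f g h : C -> C) (z w : C) (v : C).

(** The passage to u turns |f|^2 e^(-y^2) into |u|^2 e^(|z|^2/2), a radial weight: u can be
    integrated against anything of size e^(a|z|^2) with a < 1/4.

    The equation is only known weakly, and no regularity of u is established: all derivatives stay
    on the test side, and u is compared with d_z^n (h e^(-|z|^2/2)) through integrals alone.

    On e^(zbar w/2) F(z) with F holomorphic, 2 L acts as (w - z) F' + n F, an Euler operator centred
    at w whose eigenvectors are the powers of w - z. This is the origin of E_k; the parameter s
    joins the pure power at s = 0 to the exponential at s = 1.

    For h e^(-|w|^2/2) to be integrable, h must grow more slowly than e^(|w|^2/2). Splitting
    |z||w|/2 into a|z|^2 + |w|^2/(16a), this asks for a > 1/8, which is compatible with a < 1/4.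

    [entire] only says complex differentiable, while d_z^n needs all derivatives; hence Goursat's
    theorem and a mean value property for weighted averages over the plane, which yields both the
    smoothness of entire functions and the Gaussian moments. *)

Lemma normC_nm z : `|z| = (nm z)%:C.
Proof. by rewrite normc_def; case: z. Qed.

Lemma nm_ge0 z : 0 <= nm z.
Proof. by case: z => a b; exact: sqrtr_ge0. Qed.

Lemma nmM z w : nm (z * w) = nm z * nm w.
Proof. exact: ComplexField.Normc.normcM. Qed.

Lemma nmD z w : nm (z + w) <= nm z + nm w.
Proof. exact: (le_normcD (z : Rcomplex R) w). Qed.

Lemma nmN z : nm (- z) = nm z.
Proof. exact: (normcN (z : Rcomplex R)). Qed.

Lemma nmB z w : nm (z - w) <= nm z + nm w.
Proof. by rewrite -(nmN w); exact: nmD. Qed.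

Lemma nm_sub z w : nm (z - w) = nm (w - z).
Proof. by rewrite -nmN opprB. Qed.

Lemma nm_real (a : R) : nm a%:C = `|a|.
Proof. by rewrite /= expr0n addr0 sqrtr_sqr. Qed.

Lemma nm_nat n : nm n%:R = n%:R.
Proof. by rewrite -(rmorph_nat (real_complex R)) nm_real normr_nat. Qed.

Lemma inv2C : (2%:R : C)^-1 = (2^-1 : R)%:C.
Proof. by rewrite fmorphV rmorph_nat. Qed.

Lemma nm_sqr z : nm z ^+ 2 = Re z ^+ 2 + Im z ^+ 2.
Proof. by case: z => a b /=; rewrite sqr_sqrtr// addr_ge0// sqr_ge0. Qed.

Lemma nm_Re z : `|Re z| <= nm z.
Proof.
by case: z => a b /=; rewrite -sqrtr_sqr ler_sqrt ?lerDl ?addr_ge0 ?sqr_ge0.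
Qed.

Lemma nm_Im z : `|Im z| <= nm z.
Proof.
by case: z => a b /=; rewrite -sqrtr_sqr ler_sqrt ?lerDr ?addr_ge0 ?sqr_ge0.
Qed.

Lemma nm0 : nm 0 = 0.
Proof. exact: ComplexField.Normc.normc0. Qed.

Lemma nm_i : nm ('i : C) = 1.
Proof. by rewrite /= expr0n expr1n add0r sqrtr1. Qed.

Lemma neq_i0 : ('i : C) != 0.
Proof. by apply/eqP => /(congr1 nm)/eqP; rewrite nm_i nm0 oner_eq0. Qed.

Lemma nm_ReIm z : nm z <= `|Re z| + `|Im z|.
Proof.
have -> : z = (Re z)%:C + 'i * (Im z)%:C by case: z => a b; simpc.
by rewrite (le_trans (nmD _ _))// nmM nm_i mul1r !nm_real; simpc.
Qed.

Lemma nmX z n : nm (z ^+ n) = nm z ^+ n.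
Proof.
elim: n => [|n IH]; first by rewrite !expr0 ComplexField.Normc.normc1.
by rewrite !exprS nmM IH.
Qed.

Lemma nm_conj z : nm z^* = nm z.
Proof. by case: z => a b /=; rewrite sqrrN. Qed.

Lemma nm_eq0 z : nm z = 0 -> z = 0.
Proof. exact: ComplexField.Normc.eq0_normc. Qed.

Lemma complexP z w : Re z = Re w -> Im z = Im w -> z = w.
Proof. by case: z => a b; case: w => c d /= -> ->. Qed.

Lemma cReD z w : Re (z + w) = Re z + Re w. Proof. by case: z; case: w. Qed.
Lemma cImD z w : Im (z + w) = Im z + Im w. Proof. by case: z; case: w. Qed.
Lemma cReN z : Re (- z) = - Re z. Proof. by case: z. Qed.
Lemma cImN z : Im (- z) = - Im z. Proof. by case: z. Qed.
Lemma cReM z w : Re (z * w) = Re z * Re w - Im z * Im w.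
Proof. by case: z; case: w. Qed.
Lemma cImM z w : Im (z * w) = Re z * Im w + Im z * Re w.
Proof. by case: z; case: w. Qed.

Definition ReImE := (cReD, cImD, cReN, cImN, cReM, cImM).

(** * Continuity in terms of the modulus *)

Definition ccont f := forall z (e : R), 0 < e ->
  exists2 d : R, 0 < d & forall w, nm (w - z) < d -> nm (f w - f z) < e.

Lemma ltcC (z : C) (e : R) : (`|z| < e%:C) = (nm z < e).
Proof. by rewrite normC_nm ltcR. Qed.

Lemma gtC0 (e : C) : 0 < e -> e = (Re e)%:C /\ 0 < Re e.
Proof.
by case: e => a b; rewrite ltcE /= => /andP[/eqP b0 a0]; split; rewrite ?b0.
Qed.

Lemma ccontP f : continuous (f : C^o -> C^o) <-> ccont f.
Proof.
split.
  move=> cf z e e0; have /cvgrPdist_lt /(_ e%:C) := cf z.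
  rewrite ltcR => /(_ e0) [d /= d0 H].
  have [dr d0'] := gtC0 d0.
  exists (Re d) => // w wz.
  have := H w; rewrite /= dr !ltcC (nm_sub z) => /(_ wz).
  by rewrite nm_sub.
move=> cf z; apply/(@cvgrPdist_lt _ C^o C^o (nbhs (z : C^o)) _ f) => e e0.
have [er e0'] := gtC0 e0.
have [d d0 H] := cf z _ e0'.
exists d%:C => /=; first by rewrite ltcR.
by move=> w /=; rewrite ltcC er ltcC nm_sub => /H; rewrite nm_sub.
Qed.

(** * Derivatives of complex functions of a real variable *)

(** Componentwise, as [ddir] is, so that the complex rules are assembled from those for real
    derivatives. *)
Definition cder (p : R -> C) (t : R) (l : C) :=
  is_derive t 1 (fun s => Re (p s)) (Re l) /\
  is_derive t 1 (fun s => Im (p s)) (Im l).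

Lemma cder_eq p t l l' : cder p t l -> l = l' -> cder p t l'.
Proof. by move=> h <-. Qed.

Lemma cder_ext p q t l : p =1 q -> cder p t l -> cder q t l.
Proof. by move=> /funext ->. Qed.

Lemma cder_cst c t : cder (fun=> c) t 0.
Proof. by split; exact: is_derive_cst. Qed.

Lemma cderD p q t l m : cder p t l -> cder q t m ->
  cder (fun s => p s + q s) t (l + m).
Proof.
move=> [pr pi] [qr qi]; split.
  rewrite cReD (_ : (fun s => _) = (Re \o p) + (Re \o q)).
    by apply: is_deriveD.
  by apply/funext => s; rewrite cReD.
rewrite cImD (_ : (fun s => _) = (Im \o p) + (Im \o q)).
  by apply: is_deriveD.
by apply/funext => s; rewrite cImD.
Qed.

Lemma cderM p q t l m : cder p t l -> cder q t m ->
  cder (fun s => p s * q s) t (l * q t + p t * m).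
Proof.
move=> [pr pi] [qr qi]; split.
  rewrite (_ : (fun s => _) =
    (Re \o p) * (Re \o q) - (Im \o p) * (Im \o q)); last first.
    by apply/funext => s; rewrite cReM.
  apply: (is_derive_eq (is_deriveB (is_deriveM pr qr) (is_deriveM pi qi))).
  rewrite !ReImE/= /GRing.scale /=; ring.
rewrite (_ : (fun s => _) =
    (Re \o p) * (Im \o q) + (Im \o p) * (Re \o q)); last first.
  by apply/funext => s; rewrite cImM.
apply: (is_derive_eq (is_deriveD (is_deriveM pr qi) (is_deriveM pi qr))).
rewrite !ReImE/= /GRing.scale /=; ring.
Qed.

Lemma cder_real (r : R -> R) (t d : R) : is_derive t 1 r d ->
  cder (fun s => (r s)%:C) t d%:C.
Proof. by move=> H; split => //=; exact: is_derive_cst. Qed.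

Lemma cder_id t : cder (fun s => s%:C) t 1.
Proof. by apply: cder_real; exact: is_derive_id. Qed.

Lemma cder_conj p t l : cder p t l -> cder (fun s => (p s)^*) t l^*.
Proof.
move=> [pr pi]; split; first by case: (l) pr pi => a b /= pr pi;
  rewrite (_ : (fun s => _) = (fun s => Re (p s))) //; apply/funext => s; case: (p s).
rewrite (_ : (fun s => _) = - (fun s => Im (p s))).
  by case: (l) pi => a b /= pi; apply: is_deriveN.
by apply/funext => s; rewrite fctE; case: (p s).
Qed.

Lemma cexpE z : cexp z =
  (expR (Re z) * cos (Im z)) +i* (expR (Re z) * sin (Im z)).
Proof. by rewrite /cexp; simpc. Qed.

Lemma cder_exp p t l : cder p t l ->
  cder (fun s => cexp (p s)) t (l * cexp (p t)).
Proof.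
move=> [pr pi].
have er : is_derive t 1 (expR \o (Re \o p)) (expR (Re (p t)) * Re l).
  by apply: is_derive1_comp.
have ci : is_derive t 1 (cos \o (Im \o p)) (- sin (Im (p t)) * Im l).
  by apply: is_derive1_comp.
have si : is_derive t 1 (sin \o (Im \o p)) (cos (Im (p t)) * Im l).
  by apply: is_derive1_comp.
split.
  rewrite (_ : (fun s => _) = (expR \o (Re \o p)) * (cos \o (Im \o p))).
    apply: (is_derive_eq (is_deriveM er ci)); rewrite cexpE !ReImE/= /GRing.scale /=; ring.
  by apply/funext => s; rewrite cexpE.
rewrite (_ : (fun s => _) = (expR \o (Re \o p)) * (sin \o (Im \o p))).
  apply: (is_derive_eq (is_deriveM er si)); rewrite cexpE !ReImE/= /GRing.scale /=; ring.
by apply/funext => s; rewrite cexpE.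
Qed.

Lemma cder_affine a b t : cder (fun s => a + s%:C * b) t b.
Proof.
have := cderD (cder_cst a t) (cderM (cder_id t) (cder_cst b t)).
by move/cder_eq; apply; rewrite mul1r mulr0 addr0 add0r.
Qed.

(** * Directional and Wirtinger derivatives *)

Definition dd v f f' := forall z, cder (fun t => f (z + t%:C * v)) 0 (f' z).

Lemma dd_ddir v f f' : dd v f f' -> ddir v f = f'.
Proof.
move=> H; apply/funext => z; have [hr hi] := H z.
by rewrite /ddir !derive1E (@derive_val _ _ _ _ _ _ _ hr)
  (@derive_val _ _ _ _ _ _ _ hi); case: (f' z).
Qed.

Lemma dd_has v f f' : dd v f f' -> has_ddir v f.
Proof. by move=> H z; have [[hr _] [hi _]] := H z; split. Qed.

Lemma has_dd v f : has_ddir v f -> dd v f (ddir v f).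
Proof.
move=> H z; have [hr hi] := H z.
by split; rewrite /ddir /= derive1E; exact: DeriveDef.
Qed.

Lemma cder_shift p t l : cder (fun s => p (t + s)) 0 l -> cder p t l.
Proof.
have sh (F : R -> R) d : is_derive (0:R) 1 (fun s => F (t + s)) d ->
    is_derive t 1 F d.
  move=> H.
  have d1 : is_derive t 1 (fun s : R => s - t) 1.
    by apply: (is_derive_eq (is_deriveB (is_derive_id _ _)
      (is_derive_cst _ _ _))); rewrite subr0.
  rewrite (_ : F = (fun s => F (t + s)) \o (fun s => s - t)); last first.
    by apply/funext => s /=; rewrite addrC subrK.
  apply: (is_derive_eq (is_derive1_comp _ d1)); last by rewrite mulr1.
  by rewrite subrr.
by move=> [hr hi]; split; exact: sh.
Qed.

Lemma dd_line v f f' z t : dd v f f' ->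
  cder (fun s => f (z + s%:C * v)) t (f' (z + t%:C * v)).
Proof.
move=> H; apply: cder_shift.
apply: cder_ext (H _) => s /=.
by rewrite rmorphD/= mulrDl addrA.
Qed.

(* [fz] and [fzb] are the Wirtinger derivatives of [f]. *)
Definition W f fz fzb := dd 1 f (fun z => fz z + fzb z) /\
  dd 'i f (fun z => 'i * (fz z - fzb z)).

Lemma Wdz f a b : W f a b -> dz f = a.
Proof.
move=> [hx hy]; apply/funext => z.
rewrite /dz /dx /dy (dd_ddir hx) (dd_ddir hy) mulrA -expr2 sqr_i mulN1r opprK.
by rewrite addrACA subrr addr0 -mulr2n -[X in _ * X]mulr_natl mulKf// pnatr_eq0.
Qed.

Lemma Wdzbar f a b : W f a b -> dzbar f = b.
Proof.
move=> [hx hy]; apply/funext => z.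
rewrite /dzbar /dx /dy (dd_ddir hx) (dd_ddir hy) mulrA -expr2 sqr_i mulN1r.
rewrite opprB [b z - a z]addrC addrACA subrr add0r -mulr2n.
by rewrite -[X in _ * X]mulr_natl mulKf// pnatr_eq0.
Qed.

Lemma has_W f : has_ddir 1 f -> has_ddir 'i f -> W f (dz f) (dzbar f).
Proof.
move=> /has_dd hx /has_dd hy; split.
  move=> z; apply: cder_eq (hx z) _.
  by rewrite /dz /dzbar /dx /dy; field.
move=> z; apply: cder_eq (hy z) _.
rewrite /dz /dzbar /dx /dy; transitivity (- ('i ^+ 2) * ddir 'i f z).
  by rewrite sqr_i opprK mul1r.
by field.
Qed.

Lemma W_has f a b : W f a b -> has_ddir 1 f /\ has_ddir 'i f.
Proof. by move=> [hx hy]; split; [exact: dd_has hx|exact: dd_has hy]. Qed.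

Lemma W_dx f a b : W f a b -> dx f = (fun z => a z + b z).
Proof. by move=> [hx hy]; exact: dd_ddir. Qed.

Lemma W_dy f a b : W f a b -> dy f = (fun z => 'i * (a z - b z)).
Proof. by move=> [hx hy]; exact: dd_ddir. Qed.

Lemma W_eq f a b a' b' : W f a b -> a =1 a' -> b =1 b' -> W f a' b'.
Proof. by move=> h /funext <- /funext <-. Qed.

Lemma W_cst c : W (fun=> c) (fun=> 0) (fun=> 0).
Proof.
by split=> z; apply: cder_eq (cder_cst _ _) _; rewrite ?subr0 ?mulr0 ?addr0.
Qed.

Lemma W_id : W (fun z => z) (fun=> 1) (fun=> 0).
Proof.
split=> z; apply: cder_eq (cder_affine _ _ _) _; first by rewrite addr0.
by rewrite subr0 mulr1.
Qed.

Lemma W_conj : W (fun z => z^*) (fun=> 0) (fun=> 1).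
Proof.
split=> z; apply: cder_eq (cder_conj (cder_affine _ _ _)) _.
  by rewrite add0r; apply: complexP => //=; rewrite oppr0.
by rewrite sub0r mulrN1; apply: complexP => //=; rewrite oppr0.
Qed.

Lemma WD f g a b a' b' : W f a b -> W g a' b' ->
  W (fun z => f z + g z) (fun z => a z + a' z) (fun z => b z + b' z).
Proof.
move=> [fx fy] [gx gy]; split=> z.
  by apply: cder_eq (cderD (fx z) (gx z)) _; ring.
by apply: cder_eq (cderD (fy z) (gy z)) _; ring.
Qed.

Lemma WM f g a b a' b' : W f a b -> W g a' b' ->
  W (fun z => f z * g z) (fun z => a z * g z + f z * a' z)
    (fun z => b z * g z + f z * b' z).
Proof.
move=> [fx fy] [gx gy]; split=> z.
  by apply: cder_eq (cderM (fx z) (gx z)) _; rewrite rmorph0 mul0r addr0; ring.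
by apply: cder_eq (cderM (fy z) (gy z)) _; rewrite rmorph0 mul0r addr0; ring.
Qed.

Lemma WZ c f a b : W f a b ->
  W (fun z => c * f z) (fun z => c * a z) (fun z => c * b z).
Proof.
move=> hf; apply: W_eq (WM (W_cst c) hf) _ _ => z /=; by rewrite mul0r add0r.
Qed.

Lemma W_exp f a b : W f a b ->
  W (fun z => cexp (f z)) (fun z => a z * cexp (f z)) (fun z => b z * cexp (f z)).
Proof.
move=> [fx fy]; split=> z.
  by apply: cder_eq (cder_exp (fx z)) _; rewrite rmorph0 mul0r addr0; ring.
by apply: cder_eq (cder_exp (fy z)) _; rewrite rmorph0 mul0r addr0; ring.
Qed.

(** A real-valued [f] has real derivatives along every real line, so the chain rule multiplies both
    Wirtinger derivatives by the same real factor. *)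
Lemma W_real (r r' : R -> R) f a b : (forall x : R, is_derive x 1 r (r' x)) ->
  (forall z, Im (f z) = 0) -> W f a b ->
  W (fun z => (r (Re (f z)))%:C) (fun z => (r' (Re (f z)))%:C * a z)
    (fun z => (r' (Re (f z)))%:C * b z).
Proof.
move=> hr fr [fx fy].
have key v f' z : dd v f f' ->
    cder (fun t => (r (Re (f (z + t%:C * v))))%:C) 0
      ((r' (Re (f z)))%:C * f' z).
  move=> /(_ z) [dr [di1 di2]].
  have hd : is_derive (0:R) 1 (r \o (fun t => Re (f (z + t%:C * v))))
     (r' (Re (f z)) * Re (f' z)).
    by apply: is_derive1_comp => //; rewrite rmorph0 mul0r addr0.
  apply: cder_eq (cder_real hd) _.
  apply: complexP; rewrite ReImE /= ?mul0r ?addr0 ?subr0//.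
  suff -> : Im (f' z) = 0 by rewrite mulr0.
  rewrite -di2 (_ : (fun s => _) = cst 0) ?derive_cst//.
  by apply/funext => s; rewrite fr.
split=> z.
  by apply: cder_eq (key _ _ z fx) _; rewrite mulrDr.
by apply: cder_eq (key _ _ z fy) _; ring.
Qed.

(** * Continuity through real and imaginary parts *)

Definition rc f := continuous (fun p : R * R => Re (f (ofxy p))) /\
  continuous (fun p : R * R => Im (f (ofxy p))).

Lemma ofxyK z : ofxy (Re z, Im z) = z.
Proof. by case: z. Qed.

(** The modulus serves the estimates; the product topology of [R * R] serves compactness and
    measurability. *)
Lemma ccont_rc f : ccont f <-> rc f.
Proof.
split.
  move=> cf; suff H (q : C -> R) : (forall z w, `|q z - q w| <= nm (z - w)) ->
      continuous (fun p : R * R => q (f (ofxy p))).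
    split; apply: H => z w; first by rewrite -cReN -cReD nm_Re.
    by rewrite -cImN -cImD nm_Im.
  move=> Hq p; apply/cvgrPdist_lt => e e0.
  have [d d0 Hd] := cf (ofxy p) e e0.
  have d20 : 0 < d / 2 by rewrite divr_gt0.
  exists (ball p.1 (d / 2), ball p.2 (d / 2)) => /=.
    by split; apply: nbhsx_ballx.
  move=> [x y] /= [xp yp]; rewrite (le_lt_trans (Hq _ _))// nm_sub.
  apply: Hd; apply: (le_lt_trans (nm_ReIm _)).
  rewrite cReD cReN cImD cImN /= (splitr d) ltrD//.
    by rewrite distrC.
  by rewrite distrC.
move=> [cr ci] z e e0.
have e20 : 0 < e / 2 by rewrite divr_gt0.
have /cvgrPdist_lt /(_ _ e20) [[A1 B1] /= [/nbhs_ballP[d1 d10 h1]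
  /nbhs_ballP[d2 d20 h2]] H1] := cr (Re z, Im z).
have /cvgrPdist_lt /(_ _ e20) [[A2 B2] /= [/nbhs_ballP[d3 d30 h3]
  /nbhs_ballP[d4 d40 h4]] H2] := ci (Re z, Im z).
exists (Num.min (Num.min d1 d2) (Num.min d3 d4)).
  by rewrite !lt_min; apply/andP; split; apply/andP.
move=> w; rewrite !lt_min => /andP[/andP[w1 w2] /andP[w3 w4]].
have hr : `|Re z - Re w| <= nm (w - z) by rewrite distrC -cReN -cReD nm_Re.
have hi : `|Im z - Im w| <= nm (w - z) by rewrite distrC -cImN -cImD nm_Im.
apply: (le_lt_trans (nm_ReIm _)); rewrite (splitr e) ltrD//.
  have := H1 (Re w, Im w); rewrite !ofxyK cReD cReN distrC; apply.
  split; [apply: h1|apply: h2]; rewrite /ball /=; exact: le_lt_trans w1 || exact: le_lt_trans w2.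
have := H2 (Re w, Im w); rewrite !ofxyK cImD cImN distrC; apply.
split; [apply: h3|apply: h4]; rewrite /ball /=; exact: le_lt_trans w3 || exact: le_lt_trans w4.
Qed.

Lemma ccont_cst c : ccont (fun=> c).
Proof. by apply/ccont_rc; split => p; exact: cvg_cst. Qed.

Lemma ccont_id : ccont (fun z => z).
Proof. by move=> z e e0; exists e. Qed.

Lemma ccont_conj : ccont (fun z => z^*).
Proof.
move=> z e e0; exists e => // w wz.
by rewrite -rmorphB /= nm_conj.
Qed.

Lemma ccontD f g : ccont f -> ccont g -> ccont (fun z => f z + g z).
Proof.
move=> /ccont_rc[fr fi] /ccont_rc[gr gi]; apply/ccont_rc; split.
  rewrite (_ : (fun p => _) = (fun p => Re (f (ofxy p))) \+ (fun p => Re (g (ofxy p)))).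
    by move=> p; apply: cvgD; [exact: fr|exact: gr].
  by apply/funext => p; rewrite cReD.
rewrite (_ : (fun p => _) = (fun p => Im (f (ofxy p))) \+ (fun p => Im (g (ofxy p)))).
  by move=> p; apply: cvgD; [exact: fi|exact: gi].
by apply/funext => p; rewrite cImD.
Qed.

Lemma ccontM f g : ccont f -> ccont g -> ccont (fun z => f z * g z).
Proof.
move=> /ccont_rc[fr fi] /ccont_rc[gr gi]; apply/ccont_rc; split => p.
  rewrite (_ : (fun p => _) = (fun p => Re (f (ofxy p)) * Re (g (ofxy p))
     - Im (f (ofxy p)) * Im (g (ofxy p)))); last by apply/funext => q; rewrite cReM.
  by apply: cvgB; apply: cvgM; [exact: fr|exact: gr|exact: fi|exact: gi].
rewrite (_ : (fun p => _) = (fun p => Re (f (ofxy p)) * Im (g (ofxy p))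
   + Im (f (ofxy p)) * Re (g (ofxy p)))); last by apply/funext => q; rewrite cImM.
by apply: cvgD; apply: cvgM; [exact: fr|exact: gi|exact: fi|exact: gr].
Qed.

Lemma ccont_exp f : ccont f -> ccont (fun z => cexp (f z)).
Proof.
move=> /ccont_rc[fr fi]; apply/ccont_rc; split => p.
  rewrite (_ : (fun p => _) = (fun p => expR (Re (f (ofxy p))) * cos (Im (f (ofxy p)))));
    last by apply/funext => q; rewrite cexpE.
  apply: cvgM; (apply: continuous_comp; first by [exact: fr|exact: fi]).
    exact: continuous_expR.
  exact: continuous_cos.
rewrite (_ : (fun p => _) = (fun p => expR (Re (f (ofxy p))) * sin (Im (f (ofxy p)))));
  last by apply/funext => q; rewrite cexpE.
apply: cvgM; (apply: continuous_comp; first by [exact: fr|exact: fi]).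
  exact: continuous_expR.
exact: continuous_sin.
Qed.

Lemma ccont_real (r : R -> R) f : continuous r -> ccont f ->
  ccont (fun z => (r (Re (f z)))%:C).
Proof.
move=> cr /ccont_rc[fr fi]; apply/ccont_rc; split => p; last exact: cvg_cst.
by apply: continuous_comp; [exact: fr|exact: cr].
Qed.

Lemma ccontZ c f : ccont f -> ccont (fun z => c * f z).
Proof. exact: ccontM (ccont_cst c). Qed.

Lemma ccontX f n : ccont f -> ccont (fun z => f z ^+ n).
Proof.
move=> cf; elim: n => [|n IH]; first exact: (ccont_cst 1).
by under eq_fun do rewrite exprS; exact: ccontM.
Qed.

Lemma ccont_bounded f : ccont f -> forall M : R, exists2 K : R, 0 <= K &
  forall z, nm z <= M -> nm (f z) <= K.
Proof.
move=> /ccont_rc[fr fi] M.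
have cK : compact (`[-M, M]%classic `*` `[-M, M]%classic : set (R * R)).
  by apply: compact_setX; exact: segment_compact.
have H (q : R * R -> R) : continuous q -> exists2 K : R, 0 <= K &
    forall z, nm z <= M -> `|q (Re z, Im z)| <= K.
  move=> cq.
  have /compact_bounded[N [Nr HN]] : compact (q @` (`[-M, M]%classic `*` `[-M, M]%classic)).
    apply: continuous_compact => //; apply: continuous_subspaceT => p; exact: cq.
  exists (`|N| + 1); first by rewrite addr_ge0.
  move=> z zM; apply: (HN (`|N| + 1)).
    by rewrite (le_lt_trans (ler_norm N))// ltrDl.
  exists (Re z, Im z) => //; split; rewrite /= in_itv /= -ler_norml.
    exact: le_trans (nm_Re z) zM.
  exact: le_trans (nm_Im z) zM.
have [K1 K10 H1] := H _ fr; have [K2 K20 H2] := H _ fi.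
exists (K1 + K2); first by rewrite addr_ge0.
move=> z zM; apply: (le_trans (nm_ReIm _)); apply: lerD.
  by have := H1 z zM; rewrite ofxyK.
by have := H2 z zM; rewrite ofxyK.
Qed.

(** * Growth of a function and of its derivatives *)

Definition bnd (a : R) f := exists K : R, forall z, nm (f z) <= K * expR (a * nm z ^+ 2).

(** [P] is imposed on [f] and on all its Wirtinger derivatives up to order [k]. Taking [bnd c],
    [suppP M] or the trivial predicate for [P], one induction per operation covers growth, support
    and plain smoothness. *)
Fixpoint GW (P : (C -> C) -> Prop) (k : nat) f : Prop :=
  [/\ ccont f, P f & if k is k'.+1 then
    [/\ W f (dz f) (dzbar f), GW P k' (dz f) & GW P k' (dzbar f)] else True].

Lemma GW_cont P k f : GW P k f -> ccont f. Proof. by case: k => [|k] []. Qed.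
Lemma GW_P P k f : GW P k f -> P f. Proof. by case: k => [|k] []. Qed.

Lemma GW_S P k f a b : ccont f -> P f -> W f a b -> GW P k a -> GW P k b ->
  GW P k.+1 f.
Proof. by move=> cf Pf w ? ?; split=> //; rewrite (Wdz w) (Wdzbar w). Qed.

Lemma GWW P k f : GW P k.+1 f -> W f (dz f) (dzbar f).
Proof. by case=> _ _ []. Qed.

Lemma GW_impl (P Q : (C -> C) -> Prop) k f : (forall g, P g -> Q g) ->
  GW P k f -> GW Q k f.
Proof.
move=> PQ; elim: k f => [|k IH] f /=; first by case=> ? /PQ.
by move=> [? /PQ ? [? /IH ? /IH ?]].
Qed.

Lemma GW_le P k f : GW P k.+1 f -> GW P k f.
Proof.
elim: k f => [|k IH] f; first by case.
by move=> [cf pf [w ha hb]]; split=> //; split => //; exact: IH.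
Qed.

Lemma GWD (P : (C -> C) -> Prop) k f g : (forall f g, P f -> P g -> P (fun z => f z + g z)) ->
  GW P k f -> GW P k g -> GW P k (fun z => f z + g z).
Proof.
move=> PD; elim: k f g => [|k IH] f g.
  by move=> [? ? _] [? ? _]; split; [exact: ccontD|exact: PD|].
move=> [? ? [wf ? ?]] [? ? [wg ? ?]].
apply: (GW_S _ _ (WD wf wg)); [exact: ccontD|exact: PD|exact: IH|exact: IH].
Qed.

Lemma GWM (P1 P2 P : (C -> C) -> Prop) k f g :
  (forall f g, P f -> P g -> P (fun z => f z + g z)) ->
  (forall f g, P1 f -> P2 g -> P (fun z => f z * g z)) ->
  GW P1 k f -> GW P2 k g -> GW P k (fun z => f z * g z).
Proof.
move=> PD PM; elim: k f g => [|k IH] f g.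
  by move=> [? ? _] [? ? _]; split; [exact: ccontM|exact: PM|].
move=> Hf Hg; have f' := GW_le Hf; have g' := GW_le Hg.
move: Hf Hg => [? ? [wf ? ?]] [? ? [wg ? ?]].
apply: (GW_S _ _ (WM wf wg)); [exact: ccontM|exact: PM| |];
  apply: GWD => //; exact: IH.
Qed.

Lemma GW_cst (P : (C -> C) -> Prop) k c : (forall c, P (fun=> c)) -> GW P k (fun=> c).
Proof.
move=> Pc; elim: k c => [|k IH] c; first by split => //; exact: ccont_cst.
by apply: (GW_S _ _ (W_cst c)) => //; exact: ccont_cst.
Qed.

Lemma expR_sq_ge1 (a : R) z : 0 <= a -> 1 <= expR (a * nm z ^+ 2).
Proof. by move=> a0; rewrite -expR0 ler_expR mulr_ge0// sqr_ge0. Qed.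

Lemma bndK a f : bnd a f -> exists2 K : R, 0 <= K & forall z, nm (f z) <= K * expR (a * nm z ^+ 2).
Proof.
move=> [K HK]; exists `|K| => // z; rewrite (le_trans (HK z))//.
by rewrite ler_wpM2r ?expR_ge0// ler_norm.
Qed.

Lemma bndD a f g : bnd a f -> bnd a g -> bnd a (fun z => f z + g z).
Proof.
move=> [K HK] [L HL]; exists (K + L) => z.
by rewrite mulrDl (le_trans (nmD _ _))// lerD.
Qed.

Lemma bndM a b f g : bnd a f -> bnd b g -> bnd (a + b) (fun z => f z * g z).
Proof.
move=> /bndK[K K0 HK] /bndK[L L0 HL]; exists (K * L) => z.
by rewrite mulrDl expRD mulrACA nmM ler_pM ?nm_ge0.
Qed.

Lemma bnd_le a b f : a <= b -> bnd a f -> bnd b f.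
Proof.
move=> ab /bndK[K K0 HK]; exists K => z; rewrite (le_trans (HK z))//.
by rewrite ler_wpM2l// ler_expR ler_wpM2r// sqr_ge0.
Qed.

Lemma bnd_cst a c : 0 <= a -> bnd a (fun=> c).
Proof.
move=> a0; exists (nm c) => z; rewrite ler_peMr ?nm_ge0//.
exact: expR_sq_ge1.
Qed.

Lemma bnd_id a : 0 < a -> bnd a (fun z => z).
Proof.
move=> a0; exists (1 + a^-1) => z.
have n0 := nm_ge0 z.
have h : 1 + a * nm z ^+ 2 <= expR (a * nm z ^+ 2) by exact: expR_ge1Dx.
apply: (@le_trans _ _ ((1 + a^-1) * (1 + a * nm z ^+ 2))); last first.
  by rewrite ler_wpM2l// addr_ge0// invr_ge0 ltW.
have : nm z <= 1 + nm z ^+ 2.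
  by have := sqr_ge0 (nm z - 1); nra.
move=> /le_trans; apply.
rewrite mulrDl mul1r mulrDr mulKf ?gt_eqF// mulr1.
have : 0 <= a^-1 by rewrite invr_ge0 ltW.
have : 0 <= a * nm z ^+ 2 by rewrite mulr_ge0 ?(ltW a0)// sqr_ge0.
lra.
Qed.

(* [f] and all its derivatives are O(e^(c|z|^2)) for every c > a. *)
Definition ord (a : R) f := forall c, a < c -> forall k, GW (bnd c) k f.

Lemma ord_le a b f : a <= b -> ord a f -> ord b f.
Proof. by move=> ab H c bc k; apply: H; exact: le_lt_trans bc. Qed.

Lemma ordD a f g : ord a f -> ord a g -> ord a (fun z => f z + g z).
Proof. by move=> hf hg c ac k; apply: GWD; [exact: bndD|exact: hf|exact: hg]. Qed.

Lemma ordM a b f g : ord a f -> ord b g -> ord (a + b) (fun z => f z * g z).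
Proof.
move=> hf hg c ac k.
have e0 : 0 < (c - (a + b)) / 2 by rewrite divr_gt0// subr_gt0.
apply: (@GWM (bnd (a + (c - (a + b)) / 2)) (bnd (b + (c - (a + b)) / 2))).
- exact: bndD.
- move=> f' g' hf' hg'; have := bndM hf' hg'; rewrite (_ : _ + _ = c)//.
  by field.
- by apply: hf; rewrite ltrDl.
- by apply: hg; rewrite ltrDl.
Qed.

Lemma ord_cst c : ord 0 (fun=> c).
Proof. by move=> d d0 k; apply: GW_cst => e; apply: bnd_cst; exact: ltW. Qed.

Lemma ord_id : ord 0 (fun z => z).
Proof.
move=> d d0 [|k]; first by split=> //; [exact: ccont_id|exact: bnd_id].
apply: (GW_S _ _ W_id); [exact: ccont_id|exact: bnd_id| |]; exact: ord_cst.
Qed.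

Lemma bnd_conj a f : bnd a f -> bnd a (fun z => (f z)^*).
Proof. by move=> [K HK]; exists K => z; rewrite nm_conj. Qed.

Lemma ord_conj : ord 0 (fun z => z^*).
Proof.
move=> d d0 [|k].
  by split=> //; [exact: ccont_conj|apply: bnd_conj; exact: bnd_id].
apply: (GW_S _ _ W_conj); [exact: ccont_conj| | |].
  by apply: bnd_conj; exact: bnd_id.
all: exact: ord_cst.
Qed.

Lemma ordW a f : ord a f -> W f (dz f) (dzbar f).
Proof. by move=> /(_ (a + 1)); rewrite ltrDl ltr01 => /(_ isT 1%N) /GWW. Qed.

Lemma ord_cont a f : ord a f -> ccont f.
Proof. by move=> /(_ (a + 1)); rewrite ltrDl ltr01 => /(_ isT 0%N) /GW_cont. Qed.

Lemma ord_bnd a c f : ord a f -> a < c -> bnd c f.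
Proof. by move=> H /H /(_ 0%N) /GW_P. Qed.

Lemma ord_dz a f : ord a f -> ord a (dz f).
Proof. by move=> H c /H /(_ _.+1) Hk k; have [_ _ []] := Hk k. Qed.

Lemma ord_dzbar a f : ord a f -> ord a (dzbar f).
Proof. by move=> H c /H /(_ _.+1) Hk k; have [_ _ []] := Hk k. Qed.

Lemma ordZ a c f : ord a f -> ord a (fun z => c * f z).
Proof. by move=> H; rewrite -[a]add0r; exact: ordM (ord_cst c) H. Qed.

Lemma ordM0 a f g : ord 0 f -> ord a g -> ord a (fun z => f z * g z).
Proof. by move=> hf hg; rewrite -[a]add0r; exact: ordM. Qed.

Lemma ordX f n : ord 0 f -> ord 0 (fun z => f z ^+ n).
Proof.
move=> hf; elim: n => [|n IH]; first exact: (ord_cst 1).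
by under eq_fun do rewrite exprS; exact: ordM0.
Qed.

(** When the derivatives of [E] are multiples of [E] by factors of order 0, a bound on [E] alone
    suffices: each differentiation spends half of the remaining slack [c - a] on the factor. *)
Lemma ord_eigen a E p q : ccont E -> (forall c, a < c -> bnd c E) ->
  W E (fun z => p z * E z) (fun z => q z * E z) -> ord 0 p -> ord 0 q -> ord a E.
Proof.
move=> cE bE wE op oq c ac k; elim: k c ac => [|k IH] c ac.
  by split => //; exact: bE.
have e0 : 0 < (c - a) / 2 by rewrite divr_gt0// subr_gt0.
have PM f g : bnd ((c - a) / 2) f -> bnd (a + (c - a) / 2) g ->
    bnd c (fun z => f z * g z).
  by move=> hf hg; have := bndM hf hg; rewrite (_ : _ + _ = c)//; field.
apply: (GW_S cE (bE _ ac) wE).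
  apply: (GWM (@bndD c) PM); first exact: op.
  by apply: IH; rewrite ltrDl.
apply: (GWM (@bndD c) PM); first exact: oq.
by apply: IH; rewrite ltrDl.
Qed.

(** * Compact supports and test functions *)

Definition suppP (M : R) f := forall z, M < nm z -> f z = 0.

Lemma suppD M f g : suppP M f -> suppP M g -> suppP M (fun z => f z + g z).
Proof. by move=> hf hg z hz; rewrite hf// hg// addr0. Qed.

Lemma nm_le_dist z w : nm z <= nm w + nm (z - w).
Proof. by rewrite -{1}(subrK w z) addrC nmD. Qed.

Lemma dd_supp M v f f' : dd v f f' -> suppP M f -> suppP M f'.
Proof.
move=> hd hs z hz.
have zz : z + (0:R)%:C * v = z by rewrite rmorph0 mul0r addr0.
(* For |t| below this radius the point z + t v stays outside the disc; the [+ 1] allows [v = 0]. *)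
have e0 : 0 < (nm z - M) / (nm v + 1).
  by rewrite divr_gt0 ?subr_gt0// ltr_wpDl// nm_ge0.
have H0 : \forall t \near (0:R), f (z + t%:C * v) = 0.
  exists ((nm z - M) / (nm v + 1)) => //= t.
  rewrite /= sub0r normrN => ht; apply: hs.
  have := nm_le_dist z (z + t%:C * v).
  rewrite opprD addNKr nmN nmM nm_real.
  suff : `|t| * nm v < nm z - M by lra.
  apply: (@le_lt_trans _ _ (`|t| * (nm v + 1))).
    by rewrite ler_wpM2l// lerDl.
  by rewrite -ltr_pdivlMr// ltr_wpDl// nm_ge0.
have [hr hi] := hd z.
apply: complexP.
  rewrite -(@derive_val _ _ _ _ _ _ _ hr) -[RHS](derive_cst (Re 0) (0:R) 1).
  by apply: near_eq_derive; apply: filterS H0 => t ->.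
rewrite -(@derive_val _ _ _ _ _ _ _ hi) -[RHS](derive_cst (Im 0) (0:R) 1).
by apply: near_eq_derive; apply: filterS H0 => t ->.
Qed.

Lemma add_sub_eq0 z w : z + w = 0 -> z - w = 0 -> z = 0 /\ w = 0.
Proof.
move=> h1 h2; have two : (2%:R : C) != 0 by rewrite pnatr_eq0.
split; apply: (mulfI two); rewrite mulr0.
  by transitivity ((z + w) + (z - w)); [ring|rewrite h1 h2 addr0].
by transitivity ((z + w) - (z - w)); [ring|rewrite h1 h2 subr0].
Qed.

Lemma W_supp M f a b : W f a b -> suppP M f -> suppP M a /\ suppP M b.
Proof.
move=> w hs; have [hx hy] := w; have sx := dd_supp hx hs; have sy := dd_supp hy hs.
have h z : M < nm z -> a z + b z = 0 /\ a z - b z = 0.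
  by move=> hz; split; [exact: sx|have /eqP := sy z hz;
    rewrite mulf_eq0 (negbTE neq_i0) /= => /eqP].
by split=> z /h[h1 h2]; have [] := add_sub_eq0 h1 h2.
Qed.

Lemma GW_supp M k f : suppP M f -> GW (fun=> True) k f -> GW (suppP M) k f.
Proof.
elim: k f => [|k IH] f hs; first by case.
move=> [cf _ [w ha hb]]; have [sa sb] := W_supp w hs.
by split=> //; split=> //; exact: IH.
Qed.

(** Negative [c] is included: on the disc the exponential is at least e^(-|c| M^2), and outside it
    [f] vanishes. *)
Lemma supp_bnd M c f : suppP M f -> ccont f -> bnd c f.
Proof.
move=> hs /ccont_bounded /(_ M)[K K0 HK].
exists (K * expR (`|c| * M ^+ 2)) => z.
case: (lerP (nm z) M) => zM; last first.
  by rewrite hs// nm0 !mulr_ge0 ?expR_ge0.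
rewrite (le_trans (HK z zM))// -mulrA -expRD ler_peMr//.
rewrite -expR0 ler_expR.
have h1 : nm z ^+ 2 <= M ^+ 2.
  by rewrite ler_sqr ?nnegrE ?nm_ge0// (le_trans (nm_ge0 z)).
have h2 := sqr_ge0 (nm z).
have : - c * nm z ^+ 2 <= `|c| * nm z ^+ 2.
  by rewrite ler_wpM2r// -normrN ler_norm.
have : `|c| * nm z ^+ 2 <= `|c| * M ^+ 2 by rewrite ler_wpM2l.
lra.
Qed.

Definition smoothW f := forall k, GW (fun=> True) k f.

Lemma Ck_GW k f : Ck k f -> GW (fun=> True) k f.
Proof.
elim: k f => [|k IH] f; first by move=> [/ccontP].
move=> [/ccontP cf [hx hy cx cy]].
have cst c : GW (fun=> True) k (fun=> c) by exact: GW_cst.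
have D f' g' := @GWD (fun=> True) k f' g' (fun _ _ _ _ => I).
have M f' g' := @GWM (fun=> True) (fun=> True) (fun=> True) k f' g'
  (fun _ _ _ _ => I) (fun _ _ _ _ => I).
split=> //; split; first exact: has_W.
  rewrite (_ : dz f = fun z => 2%:R^-1 * (dx f z + (- 'i) * dy f z)).
    by apply: (M _ _ (cst _)); apply: D; [exact: IH|apply: (M _ _ (cst _)); exact: IH].
  by apply/funext => z; rewrite mulNr.
apply: (M _ _ (cst _)); apply: D; [exact: IH|apply: (M _ _ (cst _)); exact: IH].
Qed.

Lemma GW_Ck k f : GW (fun=> True) k f -> Ck k f.
Proof.
elim: k f => [|k IH] f; first by move=> [/ccontP].
move=> [/ccontP cf _ [w ha hb]].
have cst c : GW (fun=> True) k (fun=> c) by exact: GW_cst.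
have D f' g' := @GWD (fun=> True) k f' g' (fun _ _ _ _ => I).
have M f' g' := @GWM (fun=> True) (fun=> True) (fun=> True) k f' g'
  (fun _ _ _ _ => I) (fun _ _ _ _ => I).
have [hx hy] := W_has w.
split=> //; split=> //; apply: IH.
  by rewrite (W_dx w); exact: D.
rewrite (W_dy w); apply: (M _ _ (cst _)).
rewrite (_ : (fun z => _) = fun z => dz f z + (-1) * dzbar f z).
  by apply: D => //; apply: (M _ _ (cst _)).
by apply/funext => z; rewrite mulN1r.
Qed.

Lemma smoothWP f : smooth f <-> smoothW f.
Proof. by split=> H k; [exact: Ck_GW|exact: GW_Ck]. Qed.

Lemma smoothWM f g : smoothW f -> smoothW g -> smoothW (fun z => f z * g z).
Proof. by move=> hf hg k; exact: GWM (hf k) (hg k). Qed.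

Lemma ord_smooth a f : ord a f -> smoothW f.
Proof.
by move=> H k; apply: GW_impl (H (a + 1) _ k) => //; rewrite ltrDl.
Qed.

Lemma supp_ord M c f : suppP M f -> smoothW f -> ord c f.
Proof.
move=> hs hf d _ k.
have := GW_supp hs (hf k); elim: k f {hs hf} => [|k IH] f.
  by move=> [cf sf _]; split=> //; exact: supp_bnd sf cf.
move=> [cf sf [w ha hb]]; split=> //; first exact: supp_bnd sf cf.
by split=> //; exact: IH.
Qed.

(** Compactness in [C] is imported from squares of [R * R] through the continuous map [ofxy]; the
    image of a square is closed because the space is Hausdorff. *)
Lemma testP f : test_function f <-> smoothW f /\ exists M, suppP M f.
Proof.
have cn : continuous (fun z : C^o => nm z : R).
  move=> z; apply/(@cvgrPdist_lt _ R^o C^o (nbhs (z : C^o)) _ nm) => e e0.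
  exists e%:C => /=; first by rewrite ltcR.
  move=> w /=; rewrite ltcC => H; apply: le_lt_trans H.
  rewrite ler_norml; have := nm_le_dist z w; have := nm_le_dist w z.
  by rewrite (nm_sub w); lra.
have co : continuous (fun p : R * R => (ofxy p : C^o)).
  move=> p; apply/(@cvgrPdist_lt _ C^o) => e /gtC0[-> e0].
  have e20 : 0 < Re e / 2 by rewrite divr_gt0.
  exists (ball p.1 (Re e / 2), ball p.2 (Re e / 2)) => /=.
    by split; apply: nbhsx_ballx.
  move=> [x y] /= [xp yp]; rewrite ltcC (le_lt_trans (nm_ReIm _))//.
  by rewrite cReD cReN cImD cImN /= [ltRHS]splitr ltrD.
split.
  move=> [/smoothWP sf cK]; split=> //.
  have /compact_bounded[N [Nr HN]] :
      compact ((fun z : C^o => nm z : R) @` closure ([set z | f z != 0] : set C^o)).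
    by apply: continuous_compact => //; apply: continuous_subspaceT.
  exists (`|N| + 1) => z hz; apply/eqP; apply: contraTT hz => fz.
  rewrite -leNgt; apply: le_trans (ler_norm _) _.
  apply: (HN (`|N| + 1)); first by rewrite (le_lt_trans (ler_norm N))// ltrDl.
  by exists z => //; exact: subset_closure.
move=> [sf [M hs]]; split; first exact/smoothWP.
have cB : compact ((fun p : R * R => (ofxy p : C^o)) @`
    (`[-M, M]%classic `*` `[-M, M]%classic)).
  apply: continuous_compact; first exact: continuous_subspaceT.
  by apply: compact_setX; exact: segment_compact.
apply: (subclosed_compact _ cB); first exact: closed_closure.
have clB := compact_closed (@norm_hausdorff _ C^o) cB.
rewrite [X in _ `<=` X](closure_id _).1//; apply: closure_subset => z /= fz.
have zM : nm z <= M by rewrite leNgt; apply: contra_neqN fz; exact: hs.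
exists (Re z, Im z); last exact: ofxyK.
split; rewrite /= in_itv /= -ler_norml.
  exact: le_trans (nm_Re z) zM.
exact: le_trans (nm_Im z) zM.
Qed.

(** * Mean value inequalities and complex differentiability *)

Lemma real_MVT_bound (F dF : R -> R) (K t : R) : (forall s : R, is_derive s 1 F (dF s)) ->
  (forall s, `|s| <= `|t| -> `|dF s| <= K) -> `|F t - F 0| <= K * `|t|.
Proof.
move=> dFs hK.
have cF : continuous F.
  by move=> x; apply/differentiable_continuous/derivable1_diffP; have [] := dFs x.
have [t0|t0|->] := ltgtP t 0.
- have [|c] := @MVT _ F dF _ _ t0 (fun x _ => dFs x); first exact: continuous_subspaceT.
  rewrite in_itv /= => /andP[tc c0].
  rewrite distrC => ->; rewrite sub0r normrM normrN ler_wpM2r// hK//.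
  by rewrite !ltr0_norm// lerN2 ltW.
- have [|c] := @MVT _ F dF _ _ t0 (fun x _ => dFs x); first exact: continuous_subspaceT.
  rewrite in_itv /= => /andP[tc c0].
  move=> ->; rewrite subr0 normrM ler_wpM2r// hK//.
  by rewrite !gtr0_norm// ltW.
- by rewrite subrr !normr0 mulr0.
Qed.

Lemma dd_MVT v f f' z (K t : R) : dd v f f' ->
  (forall s, `|s| <= `|t| -> nm (f' (z + s%:C * v)) <= K) ->
  nm (f (z + t%:C * v) - f z) <= 2 * K * `|t|.
Proof.
move=> hd hK.
have h (q : C -> R) (qL : forall z w, q (z - w) = q z - q w) :
    (forall s : R, is_derive s 1 (fun s : R => q (f (z + s%:C * v))) (q (f' (z + s%:C * v)))) ->
    (forall z, `|q z| <= nm z) -> `|q (f (z + t%:C * v) - f z)| <= K * `|t|.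
  move=> hq qn.
  have -> : q (f (z + t%:C * v) - f z) =
      (fun s => q (f (z + s%:C * v))) t - (fun s => q (f (z + s%:C * v))) 0.
    by rewrite /= rmorph0 mul0r addr0 qL.
  apply: (real_MVT_bound hq) => s hs; exact: le_trans (qn _) (hK _ hs).
apply: (le_trans (nm_ReIm _)); rewrite -mulrA mulr_natl mulr2n; apply: lerD.
  apply: h nm_Re => [*|s]; first by rewrite cReD cReN.
  by have [] := dd_line z s hd.
apply: h nm_Im => [*|s]; first by rewrite cImD cImN.
by have [] := dd_line z s hd.
Qed.

Lemma Re_Im z : z = (Re z)%:C * 1 + (Im z)%:C * 'i.
Proof. by case: z => a b; simpc. Qed.

(** The increment is a horizontal step followed by a vertical one. Each costs at most 2 (2K) |k|: a
    factor 2 for the real and imaginary parts, and 2K as a bound for a + b and a - b. Both steps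
    stay within 2|k| of z. *)
Lemma W_MVT f a b z k (K : R) : W f a b ->
  (forall w, nm (w - z) <= 2 * nm k -> nm (a w) <= K /\ nm (b w) <= K) ->
  nm (f (z + k) - f z) <= 8 * K * nm k.
Proof.
move=> [hx hy] hK.
have {1}-> := Re_Im k; set k1 := Re k; set k2 := Im k.
have k0 := nm_ge0 k.
have hk1 : `|k1| <= nm k by exact: nm_Re.
have hk2 : `|k2| <= nm k by exact: nm_Im.
have K0 : 0 <= K.
  apply: le_trans (nm_ge0 (a z)) _; apply: (hK z _).1.
  by rewrite subrr nm0 mulr_ge0.
rewrite addrA -(subrKA (f (z + k1%:C * 1))).
apply: (le_trans (nmD _ _)).
have A : nm (f (z + k1%:C * 1 + k2%:C * 'i) - f (z + k1%:C * 1)) <= 2 * (2 * K) * `|k2|.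
  apply: (dd_MVT hy) => s hs; rewrite nmM nm_i mul1r.
  have [|ha hb] := hK (z + k1%:C * 1 + s%:C * 'i).
    rewrite -(addrA z) (addrC z) addrK; apply: (le_trans (nmD _ _)).
    by rewrite mulr1 nmM !nm_real nm_i; lra.
  by apply: (le_trans (nmB _ _)); lra.
have B : nm (f (z + k1%:C * 1) - f z) <= 2 * (2 * K) * `|k1|.
  apply: (dd_MVT hx) => s hs.
  have [|ha hb] := hK (z + s%:C * 1).
    by rewrite (addrC z) addrK mulr1 nm_real; lra.
  by apply: (le_trans (nmD _ _)); lra.
nra.
Qed.

(** Locally bounded derivatives give continuity; this is how functions defined by integrals are
    shown to be continuous. *)
Lemma W_ccont f a b : W f a b ->
  (forall M, exists K : R, forall z, nm z <= M -> nm (a z) <= K /\ nm (b z) <= K) ->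
  ccont f.
Proof.
move=> w hK z e e0.
have [K HK] := hK (nm z + 2).
have K0 : 0 <= K.
  apply: le_trans (nm_ge0 (a z)) _; apply: (HK z _).1; by rewrite lerDl.
have K1 : 0 < 8 * K + 1 by rewrite ltr_wpDl// mulr_ge0.
exists (Num.min 1 (e / (8 * K + 1))); first by rewrite lt_min ltr01 divr_gt0.
move=> x; rewrite lt_min => /andP[x1 x2].
rewrite -[x](subrKC z); apply: (@le_lt_trans _ _ (8 * K * nm (x - z))).
  apply: (W_MVT w) => y hy; apply: HK; have := nm_le_dist y z; lra.
apply: (@le_lt_trans _ _ ((8 * K + 1) * nm (x - z))).
  by rewrite ler_wpM2r ?nm_ge0// lerDl.
by rewrite mulrC -ltr_pdivlMr.
Qed.

Definition cdiff f f' := forall z (e : R), 0 < e -> exists2 d : R, 0 < d &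
  forall k, nm k < d -> nm (f (z + k) - f z - k * f' z) <= e * nm k.

(** The Cauchy-Riemann equations with a continuous derivative. The linear part is subtracted: y ->
    f(y) - a(z) y has a derivative below e/8 near z, and the constant 8 of [W_MVT] restores e; the
    radius d/2 answers its region 2|k|. *)
Lemma W_cdiff f a : W f a (fun=> 0) -> ccont a -> cdiff f a.
Proof.
move=> w ca z e e0.
have e8 : 0 < e / 8 by rewrite divr_gt0.
have [d d0 Hd] := ca z _ e8.
exists (d / 2); first by rewrite divr_gt0.
move=> k kd.
have wg : W (fun y => f y + (- a z) * y) (fun y => a y + (- a z)) (fun=> 0).
  apply: W_eq (WD w (WZ _ W_id)) _ _ => y /=; first by rewrite mulr1.
  by rewrite mulr0 addr0.
have := @W_MVT _ _ _ z k (e / 8) wg.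
rewrite (_ : f (z + k) + - a z * (z + k) - (f z + - a z * z) =
  f (z + k) - f z - k * a z); last by ring.
rewrite (_ : 8 * (e / 8) = e); last by field.
apply=> y hy; split; last by rewrite nm0 ltW.
by apply/ltW/Hd/(le_lt_trans hy); lra.
Qed.

Lemma cdiff_ccont f f' : cdiff f f' -> ccont f.
Proof.
move=> hf z e e0; have [d d0 H] := hf z 1 ltr01.
have n0 := nm_ge0 (f' z).
exists (Num.min d (e / (nm (f' z) + 1))).
  by rewrite lt_min d0 divr_gt0// ltr_wpDl.
move=> w; rewrite lt_min => /andP[/H]; rewrite subrKC mul1r => h1.
rewrite ltr_pdivlMr ?ltr_wpDl// => h2.
rewrite -(subrK ((w - z) * f' z) (f w - f z)).
apply: (le_lt_trans (nmD _ _)); rewrite nmM; nra.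
Qed.

Lemma is_derive_at0 (F : R -> R) (l : R) :
  (forall e : R, 0 < e -> exists2 d : R, 0 < d & forall t, `|t| < d ->
    `|F t - F 0 - t * l| <= e * `|t|) -> is_derive (0:R) 1 F l.
Proof.
move=> H.
have cv : h^-1 *: ((F \o shift 0) (h *: (1:R)) - F 0) @[h --> (0:R)^'] --> l.
  apply/cvgrPdist_le => e e0; have [d d0 Hd] := H e e0.
  exists d => // t; rewrite /= sub0r normrN => td t0.
  have := Hd t td; rewrite (distrC l) /= addr0 [t *: 1]mulr1.
  rewrite (_ : t^-1 *: (F t - F 0) - l = (F t - F 0 - t * l) / t).
    by rewrite normrM normfV ler_pdivrMr// normr_gt0.
  by rewrite /GRing.scale /=; field.
apply: DeriveDef; first by apply/cvg_ex; exists l.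
exact/cvg_lim.
Qed.

Lemma cdiff_dd v f f' : cdiff f f' -> dd v f (fun z => v * f' z).
Proof.
move=> hf z.
have h (q : C -> R) (qL : forall z w, q (z - w) = q z - q w)
    (qZ : forall (t : R) z, q (t%:C * z) = t * q z) :
    (forall z, `|q z| <= nm z) -> is_derive (0:R) 1 (fun s : R => q (f (z + s%:C * v))) (q (v * f' z)).
  move=> qn; apply: is_derive_at0 => e e0.
  have v1 : 0 < nm v + 1 by rewrite ltr_wpDl// nm_ge0.
  have [d d0 H] := hf z (e / (nm v + 1)) (divr_gt0 e0 v1).
  exists (d / (nm v + 1)) => [|t td]; first by rewrite divr_gt0.
  rewrite rmorph0 mul0r addr0 -qZ -!qL (le_trans (qn _))// mulrA.
  have tv : nm (t%:C * v) <= `|t| * (nm v + 1).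
    by rewrite nmM nm_real ler_wpM2l// lerDl.
  apply: (le_trans (H _ _)).
    by apply: (le_lt_trans tv); rewrite -ltr_pdivlMr.
  rewrite mulrAC ler_pdivrMr// -mulrA ler_wpM2l//; exact: ltW.
split.
  by apply: h => [*|t y|]; [rewrite cReD cReN|rewrite cReM /= mul0r subr0|exact: nm_Re].
by apply: h => [*|t y|]; [rewrite cImD cImN|rewrite cImM /= mul0r addr0|exact: nm_Im].
Qed.

Lemma cdiff_W f f' : cdiff f f' -> W f f' (fun=> 0).
Proof.
move=> hf; split=> z.
  by apply: cder_eq (cdiff_dd 1 hf z) _; rewrite mul1r addr0.
by apply: cder_eq (cdiff_dd 'i hf z) _; rewrite subr0.
Qed.

Lemma entireP f : entire f <-> exists f', cdiff f f'.
Proof.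
split.
  move=> hf; exists (fun z => 'D_1 (f : C^o -> C^o) z) => z e e0.
  have /cvgrPdist_le /(_ e%:C) : h^-1 *: (((f : C^o -> C^o) \o shift z) (h *: (1:C^o)) - f z)
     @[h --> (0:C^o)^'] --> 'D_1 (f : C^o -> C^o) z by exact: hf z.
  rewrite ltcR => /(_ e0) [d /= /gtC0[-> d0] H].
  exists (Re d) => // k kd.
  have [->|k0] := eqVneq k 0.
    by rewrite addr0 subrr mul0r subr0 !nm0 mulr0.
  have := H k; rewrite /= sub0r normrN ltcC => /(_ kd k0).
  rewrite normC_nm lecR nm_sub [k *: 1]mulr1 [k + z]addrC => H1.
  rewrite (_ : f (z + k) - f z - k * _ =
    k * (k^-1 *: (f (z + k) - f z) - 'D_1 (f : C^o -> C^o) z)).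
    by rewrite nmM mulrC ler_wpM2r// nm_ge0.
  by rewrite /GRing.scale /=; field.
move=> [f' hf] z; apply/cvg_ex; exists (f' z).
apply/(@cvgrPdist_le _ C^o) => e /gtC0[-> e0].
have [d d0 H] := hf z _ e0; exists d%:C; first by rewrite /= ltcR.
move=> k; rewrite /= sub0r normrN ltcC => kd k0.
rewrite normC_nm lecR nm_sub [k *: 1]mulr1 [k + z]addrC.
have := H k kd; rewrite (_ : f (z + k) - f z - k * _ =
    k * (k^-1 *: (f (z + k) - f z) - f' z)); last first.
  by rewrite /GRing.scale /=; field.
rewrite nmM mulrC ler_pM2r//; rewrite lt_neqAle nm_ge0 andbT eq_sym.
by apply/eqP => /nm_eq0/eqP; apply/negP.
Qed.

(** * Measurability and integrals over the plane *)

Local Notation mu1 := (@lebesgue_measure R).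
Local Notation mu2 := (mu1 \x mu1)%E.
Local Notation M1 := (measurableTypeR R).
Local Notation M2 := (measurableTypeR R * measurableTypeR R)%type.

(** An open set is the union of the rational boxes that it contains; [pickle] enumerates them, and
    the indices that code no such box contribute the empty set. *)
Lemma open_measurable2 (U : set (R * R)) : open U -> measurable (U : set M2).
Proof.
move=> oU.
pose box (q : rat * rat * (rat * rat)) : set M2 :=
  (`]ratr q.1.1, ratr q.1.2[%classic `*` `]ratr q.2.1, ratr q.2.2[%classic).
pose F (k : nat) : set M2 := if unpickle k is Some q then
  (if `[< box q `<=` U >] then box q else set0) else set0.
rewrite (_ : (U : set M2) = \bigcup_k F k).
  apply: bigcupT_measurable => k; rewrite /F; case: unpickle => // q.
  case: ifP => // _; apply: measurableX; exact: measurable_itv.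
apply/seteqP; split; last first.
  move=> p [k _]; rewrite /F; case: unpickle => // q.
  by case: asboolP => // h /h.
move=> [x y] Uxy.
have /nbhs_ballP[e e0 he] : nbhs (x, y) U by exact: open_nbhs_nbhs.
have e1 : 0 < e by [].
have [a] := @rat_in_itvoo R (x - e) x ltac:(lra).
have [b] := @rat_in_itvoo R x (x + e) ltac:(lra).
have [c] := @rat_in_itvoo R (y - e) y ltac:(lra).
have [d] := @rat_in_itvoo R y (y + e) ltac:(lra).
rewrite !in_itv /= => /andP[d1 d2] /andP[c1 c2] /andP[b1 b2] /andP[a1 a2].
have hF q : box q `<=` U -> box q (x, y) -> exists k, F k (x, y).
  move=> qU qx; exists (pickle q); rewrite /F pickleK.
  by case: asboolP.
suff [k Fk] : exists k, F k (x, y) by exists k.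
apply: (hF (a, b, (c, d))); last first.
  by split; rewrite /= in_itv /= ?a2 ?b1 ?c2 ?d1.
case=> x' y' [] /=; rewrite !in_itv /= => /andP[h1 h2] /andP[h3 h4].
apply: he; split; rewrite /ball /= ltr_norml; lra.
Qed.

Lemma cont_measurable2 (q : R * R -> R) : continuous q ->
  measurable_fun [set: M2] (q : M2 -> R).
Proof.
move=> cq; apply: (measurability _ (RGenOpens.measurableE R)).
move=> /= _ [_ [a [b ->] <-]]; rewrite setTI.
apply: open_measurable2; apply: open_comp => //; exact: interval_open.
Qed.

Lemma ccont_meas f : ccont f -> cmeasurable f.
Proof.
by move=> /ccont_rc[fr fi]; split; exact: cont_measurable2.
Qed.

Lemma cmeasM f g : cmeasurable f -> cmeasurable g -> cmeasurable (fun z => f z * g z).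
Proof.
move=> [fr fi] [gr gi]; split.
  under eq_fun do rewrite cReM.
  by apply: measurable_funB; apply: measurable_funM.
under eq_fun do rewrite cImM.
by apply: measurable_funD; apply: measurable_funM.
Qed.

Definition rint (q : C -> R) := mu2.-integrable [set: M2] (fun p => (q (ofxy p))%:E).

Definition cint f := rint (Re \o f) /\ rint (Im \o f).

Lemma rint_le (q B : C -> R) : measurable_fun [set: M2] (fun p => q (ofxy p)) ->
  rint B -> (forall z, `|q z| <= B z) -> rint q.
Proof.
move=> mq iB hB; apply: (le_integrable _ _ _ iB) => //.
  exact/measurable_EFinP.
by move=> p _ /=; rewrite lee_fin (le_trans (hB _))// ler_norm.
Qed.

Lemma cint_dom f (B : C -> R) : cmeasurable f -> rint B ->
  (forall z, nm (f z) <= B z) -> cint f.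
Proof.
move=> [mr mi] iB hB; split; apply: rint_le iB _ => // z;
  apply: le_trans (hB z); [exact: nm_Re|exact: nm_Im].
Qed.

Lemma rintD (p q : C -> R) : rint p -> rint q -> rint (fun z => p z + q z).
Proof. by move=> hp hq; have := integrableD measurableT hp hq. Qed.

Lemma rintZ (c : R) (q : C -> R) : rint q -> rint (fun z => c * q z).
Proof. by move=> hq; have := integrableZl measurableT c hq. Qed.

Definition rI (q : C -> R) : R := (\int[mu2]_(p in [set: M2]) q (ofxy p)).

Lemma cintegralE f : cintegral f = rI (Re \o f) +i* rI (Im \o f).
Proof. by []. Qed.

Lemma rID (p q : C -> R) : rint p -> rint q -> rI (fun z => p z + q z) = rI p + rI q.
Proof. by move=> hp hq; rewrite /rI RintegralD. Qed.

Lemma rIZ (c : R) (q : C -> R) : rint q -> rI (fun z => c * q z) = c * rI q.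
Proof. by move=> hq; rewrite /rI RintegralZl. Qed.

Lemma rI_abs (q B : C -> R) : rint q -> rint B -> (forall z, `|q z| <= B z) -> `|rI q| <= rI B.
Proof.
move=> hq hB h; apply: (le_trans (le_normr_Rintegral _ hq)) => //.
apply: le_Rintegral => //; exact: (integrable_norm hq).
Qed.

Lemma cintD f g : cint f -> cint g -> cint (fun z => f z + g z).
Proof.
move=> [fr fi] [gr gi]; split.
  by have := rintD fr gr; congr rint; apply/funext => z /=; rewrite cReD.
by have := rintD fi gi; congr rint; apply/funext => z /=; rewrite cImD.
Qed.

Lemma cintegralD f g : cint f -> cint g ->
  cintegral (fun z => f z + g z) = cintegral f + cintegral g.
Proof.
move=> [fr fi] [gr gi]; rewrite !cintegralE; apply: complexP => /=.
  by rewrite -rID//; congr rI; apply/funext => z /=; rewrite cReD.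
by rewrite -rID//; congr rI; apply/funext => z /=; rewrite cImD.
Qed.

Lemma cintZ c f : cint f -> cint (fun z => c * f z).
Proof.
move=> [fr fi]; split.
  have := rintD (rintZ (Re c) fr) (rintZ (- Im c) fi); congr rint.
  by apply/funext => z /=; rewrite cReM mulNr.
have := rintD (rintZ (Re c) fi) (rintZ (Im c) fr); congr rint.
by apply/funext => z /=; rewrite cImM.
Qed.

Lemma cintegralZ c f : cint f -> cintegral (fun z => c * f z) = c * cintegral f.
Proof.
move=> [fr fi]; rewrite !cintegralE; apply: complexP; rewrite !(cReM, cImM) /=.
  rewrite -mulNr -!rIZ// -rID; [|exact: rintZ..]; congr rI.
  by apply/funext => z /=; rewrite cReM mulNr.
rewrite -!rIZ// -rID; [|exact: rintZ..]; congr rI.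
by apply/funext => z /=; rewrite cImM.
Qed.

Lemma cintegral_bound f (B : C -> R) : cint f -> rint B -> (forall z, nm (f z) <= B z) ->
  nm (cintegral f) <= 2 * rI B.
Proof.
move=> [fr fi] hB h; apply: (le_trans (nm_ReIm _)); rewrite mulr_natl mulr2n cintegralE /=.
apply: lerD; apply: rI_abs => // z; apply: le_trans (h z);
  [exact: nm_Re|exact: nm_Im].
Qed.

Lemma cintegral_ae f g : cmeasurable f -> cmeasurable g -> ae_eqC f g ->
  cintegral f = cintegral g.
Proof.
move=> [fr fi] [gr gi] fg; rewrite !cintegralE /rI /Rintegral.
have h (q : C -> R) : measurable_fun [set: M2] (fun p => q (f (ofxy p))) ->
    measurable_fun [set: M2] (fun p => q (g (ofxy p))) ->
    (\int[mu2]_(p in [set: M2]) (q (f (ofxy p)))%:E =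
     \int[mu2]_(p in [set: M2]) (q (g (ofxy p)))%:E)%E.
  move=> mf mg; apply: ae_eq_integral => //; try exact/measurable_EFinP.
  case: fg => N [mN N0 sN]; exists N; split => //.
  by apply: (subset_trans _ sN) => p /= np hp; apply: np => _; rewrite hp.
by rewrite /= (h _ fr gr) (h _ fi gi).
Qed.

(** * Gaussian integrals and integration by parts *)

(** Up to a nonzero factor this is the centred normal density of variance 1/(2c). *)
Lemma gauss1 (c : R) : 0 < c -> mu1.-integrable setT (fun x : M1 => (expR (- c * x ^+ 2))%:E).
Proof.
move=> c0.
pose s := Num.sqrt ((2 * c)^-1).
have c2 : 0 < (2 * c)^-1 by rewrite invr_gt0 mulr_gt0.
have s0 : s != 0 by rewrite gt_eqF// sqrtr_gt0.
have s2 : s ^+ 2 = (2 * c)^-1 by rewrite sqr_sqrtr// ltW.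
have p0 : normal_peak s != 0 :> R.
  by rewrite invr_neq0// gt_eqF// sqrtr_gt0 pmulrn_lgt0// mulr_gt0 ?pi_gt0// s2.
have := integrableZl measurableT (normal_peak s)^-1 (integrable_normal_pdf 0 s).
congr (_.-integrable _ _); apply/funext => x.
rewrite /normal_pdf (negbTE s0) -EFinM mulKf// /normal_fun subr0 s2.
congr ((expR _)%:E); rewrite -mulr_natr; field.
by rewrite gt_eqF.
Qed.

Lemma nm_ofxy (p : R * R) : nm (ofxy p) ^+ 2 = p.1 ^+ 2 + p.2 ^+ 2.
Proof. by rewrite nm_sqr. Qed.

Lemma cont_nm : continuous (fun p : R * R => nm (ofxy p)).
Proof.
move=> p /=; apply: continuous_comp; last exact: sqrt_continuous.
apply: cvgD; apply: cvgM; (exact: cvg_fst || exact: cvg_snd).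
Qed.

Lemma meas_gauss (c : R) : measurable_fun [set: M2] (fun p : M2 => expR (c * nm (ofxy p) ^+ 2)).
Proof.
apply: cont_measurable2 => p; apply: continuous_comp; last exact: continuous_expR.
by apply: cvgMr; apply: cvgM; exact: cont_nm.
Qed.

Lemma rint_gauss (c : R) : 0 < c -> rint (fun z => expR (- c * nm z ^+ 2)).
Proof.
move=> c0.
have mE := meas_gauss (- c).
apply/integrable12ltyP; first exact/measurable_EFinP.
have g1 := gauss1 c0.
pose I := fine (\int[mu1]_x (expR (- c * x ^+ 2))%:E)%E.
have IE : (\int[mu1]_x (expR (- c * x ^+ 2))%:E)%E = I%:E.
  by rewrite /I fineK//; exact: (integrable_fin_num measurableT g1).
rewrite (eq_integral (fun x : M1 => (I%:E * (expR (- c * x ^+ 2))%:E)%E)); last first.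
  move=> x _; rewrite (eq_integral (fun y : M1 => ((expR (- c * x ^+ 2))%:E * (expR (- c * y ^+ 2))%:E)%E)).
    by rewrite integralZl// IE muleC.
  move=> y _; rewrite gee0_abs ?lee_fin ?expR_ge0// nm_ofxy /= mulrDr expRD.
  by rewrite EFinM.
by rewrite integralZl ?IE ?ltry.
Qed.

(** The fundamental theorem on [-(n+1), n+1], where dominated convergence handles the integrals and
    the decay of F the boundary terms. *)
Lemma integral_derive_gauss (F F' : R -> R) (c K : R) : 0 < c ->
  (forall x : R, is_derive x 1 F (F' x)) -> continuous F' ->
  (forall x, `|F x| <= K * expR (- c * x ^+ 2)) ->
  (forall x, `|F' x| <= K * expR (- c * x ^+ 2)) ->
  (\int[mu1]_(x in [set: M1]) (F' x)%:E = 0)%E.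
Proof.
move=> c0 dF cF' bF bF'.
have cF : continuous F.
  by move=> x; apply/differentiable_continuous/derivable1_diffP; have [] := dF x.
have mF' : measurable_fun [set: M1] F' by exact: continuous_measurable_fun.
pose I (n : nat) : set M1 := `[(- (n.+1%:R : R)), n.+1%:R]%classic.
pose f (n : nat) (x : M1) : \bar R := ((F' \_ (I n)) x)%:E.
have mI n : measurable (I n) by exact: measurable_itv.
have mf n : measurable_fun [set: M1] (f n).
  apply/measurable_EFinP; apply/(measurable_restrictT F' (mI n)).
  exact: (measurable_funS measurableT _ mF').
have KG : mu1.-integrable [set: M1] (fun x => (K * expR (- c * x ^+ 2))%:E).
  by have := integrableZl measurableT K (gauss1 c0).
have fF : {ae mu1, forall x, [set: M1] x -> f n x @[n --> \oo] --> (F' x)%:E}%E.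
  apply/aeW => x _; apply/cvg_EFin; first exact: nearW.
  apply: cvg_near_cst; exists (Num.truncn `|x|) => // n /= hn.
  rewrite /f /= patchE ifT// inE /I /= in_itv /= -ler_norml.
  by rewrite (le_trans (ltW (truncnS_gt `|x|)))// ler_nat ltnS.
have fG : {ae mu1, forall x n, [set: M1] x -> (`|f n x| <= (K * expR (- c * x ^+ 2))%:E)%E}.
  apply/aeW => x n _ /=; rewrite lee_fin patchE; case: ifP => _ //.
  by rewrite normr0; exact: le_trans (bF' x).
have mF'E : measurable_fun [set: M1] (fun x => (F' x)%:E) by exact/measurable_EFinP.
have [_ _ cv] := @dominated_convergence _ _ _ mu1 _ measurableT f
  _ _ mf mF'E fF KG fG.
have fE n : (\int[mu1]_(x in [set: M1]) f n x = (F n.+1%:R - F (- n.+1%:R))%:E)%E.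
  transitivity (\int[mu1]_(x in I n) (F' x)%:E)%E.
    by rewrite [RHS]integral_mkcond; apply: eq_integral => x _;
      rewrite /f !patchE; case: ifP.
  have lt : (- n.+1%:R : R) < n.+1%:R by rewrite gtrN.
  rewrite (@continuous_FTC2 _ F' F)//.
  - exact: continuous_subspaceT.
  - split => [x _||]; first by have [] := dF x.
    + apply: cvg_at_right_filter; exact: cF.
    + apply: cvg_at_left_filter; exact: cF.
  - by move=> x _; rewrite derive1E; have [_ ->] := dF x.
have F0 : (\int[mu1]_(x in [set: M1]) f n x @[n --> \oo] --> 0)%E.
  under eq_fun do rewrite fE.
  apply/cvg_EFin; first exact: nearW.
  have K0 : 0 <= K.
    have := le_trans (normr_ge0 _) (bF 0).
    by rewrite pmulr_lge0 ?expR_gt0.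
  (* From e^(-c x^2) <= 1/(1 + c x^2) and x^2 = (n+1)^2 >= n+1. *)
  have key (x : R) (n : nat) : `|x| = n.+1%:R -> `|F x| <= K / c * harmonic n.
    move=> xn; apply: (le_trans (bF x)); rewrite -mulrA ler_wpM2l//.
    rewrite mulNr expRN /= -invfM lef_pV2 ?posrE ?expR_gt0 ?mulr_gt0//.
    apply: (@le_trans _ _ (1 + c * x ^+ 2)); last exact: expR_ge1Dx.
    have : (n.+1%:R : R) <= x ^+ 2.
      by rewrite -real_normK ?num_real// xn expr2 ler_peMr// ler1n.
    by nra.
  apply/norm_cvg0P; apply: (@squeeze_cvgr _ _ _ _ (cst 0) (fun n => K / c * harmonic n + K / c * harmonic n)).
  - apply/nearW => n /=; rewrite normr_ge0 /=.
    apply: (le_trans (ler_normB _ _)); apply: lerD; apply: key;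
      by rewrite ?normrN gtr0_norm.
  - exact: cvg_cst.
  - rewrite [X in _ --> X](_ : 0 = K / c * 0 + K / c * 0); last by rewrite !mulr0 addr0.
    by apply: cvgD; apply: cvgMr; exact: cvg_harmonic.
exact: cvg_unique cv F0.
Unshelve. all: end_near.
Qed.

Lemma bnd_cint c f : c < 0 -> ccont f -> bnd c f -> cint f.
Proof.
move=> c0 cf [K HK]; apply: (cint_dom (ccont_meas cf) _ HK).
by apply: rintZ; rewrite -[c]opprK; apply: rint_gauss; rewrite oppr_gt0.
Qed.

Lemma bnd_sep c f : bnd c f -> exists2 K : R, 0 <= K & forall x y : R,
  nm (f (ofxy (x, y))) <= K * expR (c * y ^+ 2) * expR (c * x ^+ 2).
Proof.
move=> /bndK[K K0 HK]; exists K => // x y.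
by rewrite -mulrA -expRD addrC -mulrDr -(nm_ofxy (x, y)).
Qed.

Lemma cont_pairl (y : R) : continuous (fun s : R => (s, y)).
Proof. by move=> x; apply: (@cvg_pair _ _ _ _ (nbhs x) (nbhs y)); [exact: cvg_id|exact: cvg_cst]. Qed.

Lemma cont_pairr (x : R) : continuous (fun s : R => (x, s)).
Proof. by move=> y; apply: (@cvg_pair _ _ _ _ (nbhs x) (nbhs y)); [exact: cvg_cst|exact: cvg_id]. Qed.

(** Fubini with the x-integral inside: for each y it is the integral of a derivative over the
    line. *)
Lemma cintegral_dx c g gx : 0 < c -> dd 1 g gx -> ccont gx ->
  bnd (- c) g -> bnd (- c) gx -> cintegral gx = 0.
Proof.
move=> c0 dg cgx bg bgx.
have [ir ii] : cint gx by apply: (@bnd_cint (- c)) => //; rewrite oppr_lt0.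
have [K K0 HK] := bnd_sep bg; have [L L0 HL] := bnd_sep bgx.
have [cr ci] := (ccont_rc gx).1 cgx.
have h (q : C -> R) : (forall z, `|q z| <= nm z) -> rint (q \o gx) ->
    continuous (fun p : R * R => q (gx (ofxy p))) ->
    (forall z (t : R), is_derive t 1 (fun s : R => q (g (z + s%:C * 1))) (q (gx (z + t%:C * 1)))) ->
    rI (q \o gx) = 0.
  move=> qn iq cq dq; rewrite /rI /Rintegral -(integral21_prod_meas1 iq).
  rewrite (eq_integral (cst 0%E)) ?integral0// => y _.
  have E s : (0 +i* y) + s%:C * 1 = ofxy (s, y) by rewrite /ofxy; simpc.
  apply: (@integral_derive_gauss (fun s : R => q (g (ofxy (s, y)))) _ c
     ((K + L) * expR (- c * y ^+ 2))) => //.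
  - by move=> x; have := dq (0 +i* y) x; under eq_fun do rewrite E; rewrite E.
  - move=> x.
    apply: (@continuous_comp R (R * R)%type R (fun s => (s, y)) (fun p => q (gx (ofxy p)))); last exact: cq.
    exact: cont_pairl.
  - move=> x; apply: (le_trans (qn _)); apply: (le_trans (HK _ _)).
    by rewrite !ler_wpM2r ?expR_ge0// lerDl.
  - move=> x; apply: (le_trans (qn _)); apply: (le_trans (HL _ _)).
    by rewrite !ler_wpM2r ?expR_ge0// lerDr.
rewrite cintegralE; apply: complexP => /=; apply: h => //; try by [exact: nm_Re|exact: nm_Im].
  by move=> z t; have [] := dd_line z t dg.
by move=> z t; have [] := dd_line z t dg.
Qed.

Lemma cintegral_dy c g gy : 0 < c -> dd 'i g gy -> ccont gy ->
  bnd (- c) g -> bnd (- c) gy -> cintegral gy = 0.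
Proof.
move=> c0 dg cgx bg bgx.
have [ir ii] : cint gy by apply: (@bnd_cint (- c)) => //; rewrite oppr_lt0.
have [K K0 HK] := bnd_sep bg; have [L L0 HL] := bnd_sep bgx.
have [cr ci] := (ccont_rc gy).1 cgx.
have h (q : C -> R) : (forall z, `|q z| <= nm z) -> rint (q \o gy) ->
    continuous (fun p : R * R => q (gy (ofxy p))) ->
    (forall z (t : R), is_derive t 1 (fun s : R => q (g (z + s%:C * 'i))) (q (gy (z + t%:C * 'i)))) ->
    rI (q \o gy) = 0.
  move=> qn iq cq dq; rewrite /rI /Rintegral -(integral12_prod_meas1 iq).
  rewrite (eq_integral (cst 0%E)) ?integral0// => x _.
  have E s : (x +i* 0) + s%:C * 'i = ofxy (x, s) by rewrite /ofxy; simpc.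
  apply: (@integral_derive_gauss (fun s : R => q (g (ofxy (x, s)))) _ c
     ((K + L) * expR (- c * x ^+ 2))) => //.
  - by move=> y; have := dq (x +i* 0) y; under eq_fun do rewrite E; rewrite E.
  - move=> y.
    apply: (@continuous_comp R (R * R)%type R (fun s => (x, s)) (fun p => q (gy (ofxy p)))); last exact: cq.
    exact: cont_pairr.
  - move=> y; apply: (le_trans (qn _)); apply: (le_trans (HK _ _)).
    by rewrite mulrAC !ler_wpM2r ?expR_ge0// lerDl.
  - move=> y; apply: (le_trans (qn _)); apply: (le_trans (HL _ _)).
    by rewrite mulrAC !ler_wpM2r ?expR_ge0// lerDr.
rewrite cintegralE; apply: complexP => /=; apply: h => //; try by [exact: nm_Re|exact: nm_Im].
  by move=> z t; have [] := dd_line z t dg.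
by move=> z t; have [] := dd_line z t dg.
Qed.

(** The horizontal and vertical derivatives a + b and i (a - b) both integrate to 0, which
    determines the two integrals. *)
Lemma cintegral_W c g a b : c < 0 -> W g a b -> ccont a -> ccont b ->
  bnd c g -> bnd c a -> bnd c b -> cintegral a = 0 /\ cintegral b = 0.
Proof.
move=> c0 [hx hy] ca cb bg ba bb.
have c0' : 0 < - c by rewrite oppr_gt0.
have ia := bnd_cint c0 ca ba; have ib := bnd_cint c0 cb bb.
have Nb : bnd c (fun z => (-1) * b z).
  by rewrite -[c]add0r; apply: bndM bb; exact: bnd_cst.
have sE : (fun z => a z - b z) = (fun z => a z + (-1) * b z).
  by apply/funext => z; rewrite mulN1r.
have h1 : cintegral a + cintegral b = 0.
  rewrite -cintegralD//; apply: (cintegral_dx c0' hx); rewrite ?opprK//.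
    exact: ccontD.
  exact: bndD.
have h2 : 'i * (cintegral a - cintegral b) = 0.
  rewrite -(mulN1r (cintegral b)) -cintegralZ// -cintegralD//; last exact: cintZ.
  rewrite -cintegralZ; last by apply: cintD => //; exact: cintZ.
  have := hy; rewrite (_ : (fun z => 'i * (a z - b z)) = fun z => 'i * (a z + (-1) * b z)).
    move=> hy'; apply: (cintegral_dy c0' hy'); rewrite ?opprK//.
      by apply: ccontZ; apply: ccontD => //; exact: ccontZ.
    rewrite -[c]add0r; apply: bndM; first exact: bnd_cst.
    exact: bndD.
  by apply/funext => z; rewrite mulN1r.
have h3 : cintegral a - cintegral b = 0.
  by apply/eqP; move/eqP: h2; rewrite mulf_eq0 (negbTE neq_i0).
exact: add_sub_eq0 h1 h3.
Qed.

Lemma cintegral_dz_dzbar a f : a < 0 -> ord a f ->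
  cintegral (dz f) = 0 /\ cintegral (dzbar f) = 0.
Proof.
(* [ord a] bounds only with exponents above [a]; a/2 is one that is still negative. *)
move=> a0 hf; have ha : a / 2 < 0 by rewrite pmulr_llt0.
have ha' : a < a / 2 by rewrite ltr_pdivlMr// gtr_nMr// ltr1n.
exact: cintegral_W ha (ordW hf) (ord_cont (ord_dz hf)) (ord_cont (ord_dzbar hf))
  (ord_bnd hf ha') (ord_bnd (ord_dz hf) ha') (ord_bnd (ord_dzbar hf) ha').
Qed.

Lemma ord_cint a f : a < 0 -> ord a f -> cint f.
Proof.
move=> a0 hf; have ha : a / 2 < 0 by rewrite pmulr_llt0.
have ha' : a < a / 2 by rewrite ltr_pdivlMr// gtr_nMr// ltr1n.
exact: bnd_cint ha (ord_cont hf) (ord_bnd hf ha').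
Qed.

Lemma cder_cintegral (p dp : R -> C -> C) (B : C -> R) (u v t : R) :
  u < t < v -> (forall s, u < s < v -> cint (p s)) ->
  (forall s z, u < s < v -> cder (fun s => p s z) s (dp s z)) ->
  (forall s z, u < s < v -> nm (dp s z) <= B z) -> rint B ->
  cder (fun s => cintegral (p s)) t (cintegral (dp t)).
Proof.
move=> tuv ip dpp bB iB.
have B0 z : 0 <= B z by apply: le_trans (bB t z tuv); exact: nm_ge0.
have h (q : C -> R) : (forall z, `|q z| <= nm z) ->
    (forall s, u < s < v -> rint (q \o p s)) ->
    (forall s z, u < s < v -> is_derive s 1 (fun s => q (p s z)) (q (dp s z))) ->
    is_derive t 1 (fun s => rI (q \o p s)) (rI (q \o dp t)).
  move=> qn iq dq.
  have tI : `]u, v[%classic t by rewrite /= in_itv.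
  pose f (s : R) (y : M2) := q (p s (ofxy y)).
  have f1 s : `]u, v[%classic s -> mu2.-integrable [set: M2] (EFin \o f s).
    by rewrite /= in_itv /= => /iq.
  have f2 s y : `]u, v[%classic s -> [set: M2] y -> derivable (f ^~ y) s 1.
    by rewrite /= in_itv /= => hs _; have [] := dq s (ofxy y) hs.
  have pE s y : u < s < v -> partial1of2 f s y = q (dp s (ofxy y)).
    by move=> hs; rewrite partial1of2E; have [_ <-] := dq s (ofxy y) hs.
  have f3 s y : `]u, v[%classic s -> [set: M2] y -> `|partial1of2 f s y| <= B (ofxy y).
    rewrite /= in_itv /= => hs _; rewrite pE//; apply: le_trans (bB _ _ hs); exact: qn.
  have D := derivable_under_integral measurableT tI f1 f2 (fun y => B0 (ofxy y)) iB f3.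
  have V := differentiation_under_integral measurableT tI f1 f2 (fun y => B0 (ofxy y)) iB f3.
  apply: DeriveDef; first exact: D.
  rewrite -derive1E [LHS]V; apply: eq_Rintegral => y _; exact: pE.
split; rewrite cintegralE /=.
  apply: h; [exact: nm_Re|by move=> s /ip[]|by move=> s z /dpp -/(_ z)[]].
apply: h; [exact: nm_Im|by move=> s /ip[]|by move=> s z /dpp -/(_ z)[]].
Qed.
End RBF.

(** * Functions with vanishing Fourier integrals *)

Section Uniqueness.
Variable R : realType.
Local Notation mu1 := (@lebesgue_measure R).
Local Notation mu2 := (mu1 \x mu1)%E.
Local Notation M2 := (measurableTypeR R * measurableTypeR R)%type.

(** Kept to real [v], with cosine and sine integrals apart, so that everything up to the vanishing
    of [v] is real integration. *)
Definition vanishing_trig (v : M2 -> R) := mu2.-integrable [set: M2] (EFin \o v) /\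
  forall a b : R, \int[mu2]_p (v p * cos (a * p.1 + b * p.2)) = 0 /\
    \int[mu2]_p (v p * sin (a * p.1 + b * p.2)) = 0.

(* The multipliers form an algebra closed under bounded pointwise limits, hence contain the
   indicators of all measurable sets. *)
Definition multiplier (m : M2 -> R) := [/\ measurable_fun [set: M2] m,
  exists K : R, forall p, `|m p| <= K &
  forall v, vanishing_trig v -> vanishing_trig (fun p => m p * v p)].

Lemma integrable_bounded_mul (m v : M2 -> R) (K : R) : measurable_fun [set: M2] m ->
  (forall p, `|m p| <= K) -> mu2.-integrable [set: M2] (EFin \o v) ->
  mu2.-integrable [set: M2] (EFin \o (fun p => m p * v p)).
Proof.
move=> mm mK iv.
have iK := integrableZl measurableT K (integrable_norm iv).
apply: (le_integrable _ _ _ iK) => //.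
  apply/measurable_EFinP; apply: measurable_funM => //.
  by apply/measurable_EFinP; exact: (measurable_int mu2 iv).
move=> p _ /=; rewrite lee_fin normrM; apply: le_trans (ler_norm _).
by rewrite ler_wpM2r.
Qed.

Lemma measurable_trig (f : R -> R) (a b : R) : continuous f ->
  measurable_fun [set: M2] (fun p => f (a * p.1 + b * p.2)).
Proof.
move=> cf; apply: (@cont_measurable2 R (fun p => f (a * p.1 + b * p.2))) => p.
apply: continuous_comp; last exact: cf.
by apply: cvgD; apply: cvgMr; [exact: cvg_fst|exact: cvg_snd].
Qed.

Lemma bounded_sin (x : R) : `|sin x| <= 1.
Proof. by rewrite ler_norml sin_geN1 sin_le1. Qed.

Lemma bounded_cos (x : R) : `|cos x| <= 1.
Proof. by rewrite ler_norml cos_geN1 cos_le1. Qed.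

Lemma integrable_mul_cos (v : M2 -> R) (a b : R) : mu2.-integrable [set: M2] (EFin \o v) ->
  mu2.-integrable [set: M2] (EFin \o (fun p => v p * cos (a * p.1 + b * p.2))).
Proof.
move=> iv; under [in X in _.-integrable _ X]eq_fun do rewrite /= mulrC.
apply: (integrable_bounded_mul _ (fun p => bounded_cos _)) => //.
by apply: measurable_trig; exact: continuous_cos.
Qed.

Lemma integrable_mul_sin (v : M2 -> R) (a b : R) : mu2.-integrable [set: M2] (EFin \o v) ->
  mu2.-integrable [set: M2] (EFin \o (fun p => v p * sin (a * p.1 + b * p.2))).
Proof.
move=> iv; under [in X in _.-integrable _ X]eq_fun do rewrite /= mulrC.
apply: (integrable_bounded_mul _ (fun p => bounded_sin _)) => //.
by apply: measurable_trig; exact: continuous_sin.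
Qed.

Lemma vanishingD v w : vanishing_trig v -> vanishing_trig w ->
  vanishing_trig (fun p => v p + w p).
Proof.
move=> [iv hv] [iw hw]; split; first by have := integrableD measurableT iv iw.
move=> a b; have [v1 v2] := hv a b; have [w1 w2] := hw a b; split.
  under eq_Rintegral do rewrite mulrDl.
  by rewrite RintegralD ?v1 ?w1 ?addr0//; exact: integrable_mul_cos.
under eq_Rintegral do rewrite mulrDl.
by rewrite RintegralD ?v2 ?w2 ?addr0//; exact: integrable_mul_sin.
Qed.

Lemma vanishingZ c v : vanishing_trig v -> vanishing_trig (fun p => c * v p).
Proof.
move=> [iv hv]; split; first by have := integrableZl measurableT c iv.
move=> a b; have [v1 v2] := hv a b; split.
  under eq_Rintegral do rewrite -mulrA.
  by rewrite RintegralZl ?v1 ?mulr0//; exact: integrable_mul_cos.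
under eq_Rintegral do rewrite -mulrA.
by rewrite RintegralZl ?v2 ?mulr0//; exact: integrable_mul_sin.
Qed.

Lemma multiplier_cst c : multiplier (fun=> c).
Proof.
split; [exact: measurable_cst|by exists `|c| => p|by move=> v; exact: vanishingZ].
Qed.

Lemma multiplierD m n : multiplier m -> multiplier n -> multiplier (fun p => m p + n p).
Proof.
move=> [mm [K hK] hm] [mn [L hL] hn]; split; first exact: measurable_funD.
  by exists (K + L) => p; rewrite (le_trans (ler_normD _ _))// lerD.
move=> v hv; under eq_fun do rewrite mulrDl.
by apply: vanishingD; [exact: hm|exact: hn].
Qed.

Lemma multiplierM m n : multiplier m -> multiplier n -> multiplier (fun p => m p * n p).
Proof.
move=> [mm [K hK] hm] [mn [L hL] hn]; split; first exact: measurable_funM.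
  by exists (K * L) => p; rewrite normrM ler_pM.
move=> v hv; under eq_fun do rewrite -mulrA.
by apply/hm/hn.
Qed.

Lemma Rintegral_lim (m : nat -> M2 -> R) (l v : M2 -> R) (K : R) :
  (forall n, measurable_fun [set: M2] (m n)) -> (forall n p, `|m n p| <= K) ->
  (forall p, m n p @[n --> \oo] --> l p) -> mu2.-integrable [set: M2] (EFin \o v) ->
  (forall n, \int[mu2]_p (m n p * v p) = 0) -> \int[mu2]_p (l p * v p) = 0.
Proof.
move=> mm mK ml iv m0.
have mv : measurable_fun [set: M2] v by apply/measurable_EFinP; exact: (measurable_int mu2 iv).
have ml' : measurable_fun [set: M2] l.
  by apply: (measurable_fun_cvg (h := m)) => // p _; exact: ml.
have iK := integrableZl measurableT K (integrable_norm iv).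
have f1 n : measurable_fun [set: M2] (fun p => (m n p * v p)%:E).
  by apply/measurable_EFinP; exact: measurable_funM.
have f2 : measurable_fun [set: M2] (fun p => (l p * v p)%:E).
  by apply/measurable_EFinP; exact: measurable_funM.
have f3 : {ae mu2, forall p, [set: M2] p -> (m n p * v p)%:E @[n --> \oo] --> (l p * v p)%:E}.
  apply/aeW => p _; apply/cvg_EFin; first exact: nearW.
  by apply: cvgMl; exact: ml.
have f4 : {ae mu2, forall p n, [set: M2] p -> (`|(m n p * v p)%:E| <= (K * `|v p|)%:E)%E}.
  by apply/aeW => p n _; rewrite lee_fin normrM ler_wpM2r.
have [_ _ cv] := @dominated_convergence _ _ _ mu2 _ measurableT
  (fun n p => (m n p * v p)%:E) _ _ f1 f2 f3 iK f4.
have E n : (\int[mu2]_p (m n p * v p)%:E = 0)%E.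
  rewrite -[LHS]fineK; first by rewrite -[fine _]/(\int[mu2]_p (m n p * v p)) m0.
  apply: integrable_fin_num => //; exact: integrable_bounded_mul (mm n) (mK n) iv.
rewrite /Rintegral; move: cv; rewrite (_ : (fun n => _) = cst 0%E).
  by move=> /(cvg_unique _ (cvg_cst _)) <-.
by apply/funext => n /=; exact: E.
Qed.

Lemma multiplier_lim (m : nat -> M2 -> R) (l : M2 -> R) (K : R) :
  (forall n, multiplier (m n)) -> (forall n p, `|m n p| <= K) ->
  (forall p, m n p @[n --> \oo] --> l p) -> multiplier l.
Proof.
move=> hm mK ml.
have mm n : measurable_fun [set: M2] (m n) by case: (hm n).
have ml' : measurable_fun [set: M2] l.
  by apply: (measurable_fun_cvg (h := m)) => // p _; exact: ml.
have lK p : `|l p| <= K.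
  apply: (@closed_cvg _ _ \oo _ (fun x => m x p) [set x : R | `|x| <= K]) (ml p).
    rewrite (_ : [set _ | _] = `[-K, K]%classic); first exact: itv_closed.
    by apply/seteqP; split => x /=; rewrite in_itv /= ler_norml.
  by apply: nearW => n /=.
split => //; first by exists K.
move=> v hv; have [iv _] := hv; split; first exact: integrable_bounded_mul ml' lK iv.
move=> a b; split.
  under eq_Rintegral do rewrite -mulrA.
  apply: (Rintegral_lim mm mK ml); first exact: integrable_mul_cos.
  move=> n; have [_ _ /(_ v hv)[_ /(_ a b)[+ _]]] := hm n.
  by under eq_Rintegral do rewrite -mulrA.
under eq_Rintegral do rewrite -mulrA.
apply: (Rintegral_lim mm mK ml); first exact: integrable_mul_sin.
move=> n; have [_ _ /(_ v hv)[_ /(_ a b)[_ +]]] := hm n.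
by under eq_Rintegral do rewrite -mulrA.
Qed.

Lemma sin_cosD (x y : R) : sin x * cos y = 2^-1 * sin (x + y) + 2^-1 * sin (x - y).
Proof. by rewrite sinB sinD; field. Qed.

Lemma sin_sinD (x y : R) : sin x * sin y = 2^-1 * cos (x - y) + - 2^-1 * cos (x + y).
Proof. by rewrite cosB cosD; field. Qed.

Lemma cos_sinD (x y : R) : cos x * sin y = 2^-1 * sin (x + y) + - 2^-1 * sin (x - y).
Proof. by rewrite sinB sinD; field. Qed.

Lemma cos_cosD (x y : R) : cos x * cos y = 2^-1 * cos (x + y) + 2^-1 * cos (x - y).
Proof. by rewrite cosB cosD; field. Qed.

(** By the product formulas, such a factor moves the frequency (a, b) to (a + c, b + d) and (a - c,
    b - d), where the integrals vanish too. *)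
Lemma multiplier_trig (c d : R) : multiplier (fun p => sin (c * p.1 + d * p.2)) /\
  multiplier (fun p => cos (c * p.1 + d * p.2)).
Proof.
have E1 (a b : R) (p : M2) : c * p.1 + d * p.2 + (a * p.1 + b * p.2) =
  (c + a) * p.1 + (d + b) * p.2 by ring.
have E2 (a b : R) (p : M2) : c * p.1 + d * p.2 - (a * p.1 + b * p.2) =
  (c - a) * p.1 + (d - b) * p.2 by ring.
have key (v f g : M2 -> R) (s t : R) : \int[mu2]_p (v p * f p) = 0 ->
    \int[mu2]_p (v p * g p) = 0 ->
    mu2.-integrable [set: M2] (EFin \o (fun p => v p * f p)) ->
    mu2.-integrable [set: M2] (EFin \o (fun p => v p * g p)) ->
    \int[mu2]_p (v p * (s * f p + t * g p)) = 0.
  move=> f0 g0 fi gi; under eq_Rintegral do rewrite mulrDr 2!(mulrCA (v _)).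
  rewrite RintegralD//; last 2 first.
    by have := integrableZl measurableT s fi.
  by have := integrableZl measurableT t gi.
  by rewrite !RintegralZl// f0 g0 !mulr0 addr0.
split; split.
- by apply: measurable_trig; exact: continuous_sin.
- by exists 1 => p; exact: bounded_sin.
- move=> v [iv hv]; split.
    apply: (integrable_bounded_mul _ (fun p => bounded_sin _)) => //.
    by apply: measurable_trig; exact: continuous_sin.
  move=> a b; split.
    under eq_Rintegral do rewrite mulrAC mulrC sin_cosD E1 E2.
    apply: key; try exact: integrable_mul_sin; exact: (hv _ _).2.
  under eq_Rintegral do rewrite mulrAC mulrC sin_sinD E1 E2.
  apply: key; try exact: integrable_mul_cos; exact: (hv _ _).1.
- by apply: measurable_trig; exact: continuous_cos.
- by exists 1 => p; exact: bounded_cos.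
- move=> v [iv hv]; split.
    apply: (integrable_bounded_mul _ (fun p => bounded_cos _)) => //.
    by apply: measurable_trig; exact: continuous_cos.
  move=> a b; split.
    under eq_Rintegral do rewrite mulrAC mulrC cos_cosD E1 E2.
    apply: key; try exact: integrable_mul_cos; exact: (hv _ _).1.
  under eq_Rintegral do rewrite mulrAC mulrC cos_sinD E1 E2.
  apply: key; try exact: integrable_mul_sin; exact: (hv _ _).2.
Qed.

(* The iterates of [cubic] converge on [-1, 1] to the sign function. *)
Definition cubic (s : R) : R := (3 * s - s ^+ 3) / 2.

Lemma cubic_iter_bound (s : R) n : `|s| <= 1 -> `|iter n cubic s| <= 1.
Proof.
move=> s1; elim: n => //= n; set t := iter n cubic s; rewrite !ler_norml /cubic.
move=> /andP[h1 h2]; have := sqr_ge0 (1 - t); have := sqr_ge0 (1 + t).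
by move=> h3 h4; apply/andP; split; nra.
Qed.

(** With t the current iterate, [cubic] t - t = t (1 - t^2)/2 is nonnegative on [0, 1], and 1 -
    [cubic] t = (1 - t)(1 - t/2 - t^2/2) is at most (1 - s/2)(1 - t) as long as t >= s: the
    convergence to 1 is geometric. *)
Lemma cubic_iter_pos (s : R) n : 0 < s -> s <= 1 ->
  s <= iter n cubic s <= 1 /\ 1 - iter n cubic s <= (1 - s / 2) ^+ n.
Proof.
move=> s0 s1; elim: n => [|n [/andP[]]] /=; first by split; [rewrite lexx|lra].
set t := iter n cubic s => h1 h2 h3; rewrite /cubic [_ ^+ n.+1]exprS; split.
  have h4 : 0 <= t * ((1 - t) * (1 + t)).
    by rewrite !mulr_ge0 ?subr_ge0//; lra.
  have h5 : 0 <= (1 - t) ^+ 2 * (2 + t) by rewrite mulr_ge0 ?sqr_ge0//; lra.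
  by apply/andP; split; nra.
have h4 : 1 - (3 * t - t ^+ 3) / 2 <= (1 - s / 2) * (1 - t).
  have : 0 <= (1 - t) * (t - s) by rewrite mulr_ge0 ?subr_ge0.
  have : 0 <= (1 - t) * t ^+ 2 by rewrite mulr_ge0 ?subr_ge0 ?sqr_ge0.
  nra.
apply: (le_trans h4); apply: ler_wpM2l => //; lra.
Qed.

Lemma cubic_odd (s : R) n : iter n cubic (- s) = - iter n cubic s.
Proof. by elim: n => //= n ->; rewrite /cubic; field. Qed.

Lemma cubic_iter_cvg (s : R) : `|s| <= 1 -> iter n cubic s @[n --> \oo] --> Num.sg s.
Proof.
have pos (t : R) : 0 < t -> t <= 1 -> iter n cubic t @[n --> \oo] --> (1 : R).
  move=> t0 t1; have h : (1 - (1 - t / 2) ^+ n) @[n --> \oo] --> (1 : R).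
    rewrite -[X in _ --> X]subr0; apply: cvgB; first exact: cvg_cst.
    by apply: cvg_expr; rewrite ltr_norml; lra.
  apply: (squeeze_cvgr _ h (cvg_cst (1 : R))).
  by apply: nearW => n; have [/andP[_ ->]] := cubic_iter_pos n t0 t1; rewrite andbT; lra.
rewrite ler_norml => /andP[h1 h2]; have [s0|s0|s0] := ltgtP s 0.
- rewrite ltr0_sg// -[s]opprK.
  under eq_fun do rewrite cubic_odd.
  by apply: cvgN; apply: pos; lra.
- by rewrite gtr0_sg//; exact: pos.
- rewrite s0 sgr0 (_ : (fun n => _) = cst 0); first exact: cvg_cst.
  by apply/funext; elim => //= n ->; rewrite /cubic; field.
Qed.

Lemma multiplier_ext m n : m =1 n -> multiplier m -> multiplier n.
Proof. by move=> /funext ->. Qed.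

Lemma multiplier_sg m : multiplier m -> (forall p, `|m p| <= 1) ->
  multiplier (fun p => Num.sg (m p)).
Proof.
move=> hm m1; apply: (@multiplier_lim (fun n p => iter n cubic (m p)) _ 1).
- elim => [|n IH] //=; set f := (fun p => iter n cubic (m p)) in IH *.
  have f2 := multiplierM IH (multiplierM IH IH).
  apply: (multiplier_ext _ (multiplierD (multiplierM (multiplier_cst (3 / 2)) IH)
    (multiplierM (multiplier_cst (- 2^-1)) f2))) => p.
  by rewrite /cubic /f; field.
- by move=> n p; exact: cubic_iter_bound.
- by move=> p; exact: cubic_iter_cvg.
Qed.

(** The sine has the sign of its argument once |x|/(n+1) < pi. *)
Lemma sg_sin_div (x : R) : \forall n \near \oo, Num.sg (sin (x / n.+1%:R)) = Num.sg x.
Proof.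
have pos (y : R) : 0 < y -> \forall n \near \oo, Num.sg (sin (y / n.+1%:R)) = 1.
  move=> y0; exists (Num.truncn y) => // n /= hn.
  have n0 : (0 : R) < n.+1%:R by [].
  rewrite gtr0_sg// sin_gt0_pi// divr_gt0//=.
  rewrite ltr_pdivrMr//; apply: (lt_le_trans (truncnS_gt y)).
  apply: (@le_trans _ _ (2 * n.+1%:R)); last by rewrite ler_wpM2r// pi_ge2.
  have : (((Num.truncn y).+1%:R : R) <= n.+1%:R) by rewrite ler_nat ltnS.
  lra.
have [x0|x0|->] := ltgtP x 0.
- have /pos : 0 < - x by rewrite oppr_gt0.
  apply: filterS => n; rewrite mulNr sinN sgrN => /eqP.
  by rewrite eqr_oppLR => /eqP ->; rewrite ltr0_sg.
- by rewrite gtr0_sg//; exact: pos.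
- by apply: nearW => n; rewrite mul0r sin0 sgr0.
Qed.

(** A bounded pointwise limit of signs of sines. Inside the sine, the constant [e] is split off by
    the addition formula, which leaves a combination of trigonometric multipliers. *)
Lemma multiplier_sg_lin (c d e : R) :
  multiplier (fun p => Num.sg (c * p.1 + d * p.2 + e)).
Proof.
apply: (@multiplier_lim (fun n p => Num.sg (sin ((c * p.1 + d * p.2 + e) / n.+1%:R))) _ 1).
- move=> n; apply: multiplier_sg; last by move=> p; exact: bounded_sin.
  have [hs hc] := multiplier_trig (c / n.+1%:R) (d / n.+1%:R).
  apply: (multiplier_ext _ (multiplierD
    (multiplierM (multiplier_cst (cos (e / n.+1%:R))) hs)
    (multiplierM (multiplier_cst (sin (e / n.+1%:R))) hc))) => p.
  rewrite [in RHS]mulrDl.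
  have -> : (c * p.1 + d * p.2) / n.+1%:R = c / n.+1%:R * p.1 + d / n.+1%:R * p.2.
    by rewrite mulrDl; congr (_ + _); rewrite mulrAC.
  by rewrite [in RHS]sinD; ring.
- by move=> n p; rewrite normr_sg; case: eqP.
- by move=> p; apply: cvg_near_cst; exact: sg_sin_div.
Qed.

(** * Indicators of measurable sets *)

Definition mset (A : set M2) := multiplier (\1_A).

Lemma msetC A : mset A -> mset (~` A).
Proof.
move=> hA; apply: (multiplier_ext _ (multiplierD (multiplier_cst 1)
  (multiplierM (multiplier_cst (-1)) hA))) => p.
by rewrite !indicE in_setC; case: (p \in A) => /=; ring.
Qed.

Lemma msetI A B : mset A -> mset B -> mset (A `&` B).
Proof.
move=> hA hB; apply: (multiplier_ext _ (multiplierM hA hB)) => p.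
by rewrite !indicE in_setI; case: (p \in A); case: (p \in B) => /=; ring.
Qed.

Lemma mset0 : mset set0.
Proof. by apply: (multiplier_ext _ (multiplier_cst 0)) => p; rewrite indicE in_set0. Qed.

Lemma mset_bigcup (F : nat -> set M2) : (forall n, mset (F n)) -> mset (\bigcup_n F n).
Proof.
move=> hF.
have hB n : mset (\bigcup_(i < n) F i).
  elim: n => [|n IH]; first by rewrite bigcup_mkord big_ord0; exact: mset0.
  rewrite bigcup_mkord big_ord_recr /= -bigcup_mkord -[X in mset X]setCK setCU.
  by apply/msetC/msetI; exact: msetC.
apply: (@multiplier_lim (fun n => \1_(\bigcup_(i < n) F i)) _ 1) => //.
  by move=> n p; rewrite indicE; case: (_ \in _); rewrite ?normr1 ?normr0.
move=> p; apply: cvg_near_cst; have [[k _ Fk]|nF] := pselect ((\bigcup_n F n) p).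
  exists k.+1 => // n /= kn; rewrite !indicE !mem_set//.
    by exists k.
  by exists k.
apply: nearW => n; rewrite !indicE !memNset// => -[k _ Fk]; apply: nF.
by exists k.
Qed.

(** Stated for a map [f] on sets to cover both preimages under a linear form and, with the identity,
    the sets of the plane themselves. *)
Lemma mset_sigma (T : Type) (f : set T -> set M2) (D : set T) :
  f set0 = set0 -> (forall A, f (D `\` A) = f D `\` f A) ->
  (forall F : nat -> set T, f (\bigcup_n F n) = \bigcup_n f (F n)) -> mset (f D) ->
  sigma_algebra D [set A | mset (f A)].
Proof.
move=> f0 fD fU hD; split => /=; first by rewrite f0; exact: mset0.
  by move=> A hA; rewrite fD setDE; apply: msetI => //; exact: msetC.
by move=> F hF; rewrite fU; exact: mset_bigcup.
Qed.

Lemma msetT : mset setT.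
Proof. by rewrite -setC0; exact: msetC mset0. Qed.

(** The indicator of t > 0 is (sg t + (sg t)^2)/2, which also takes the right value at t = 0. *)
Lemma mset_ray (c d e : R) : mset [set p | 0 < c * p.1 + d * p.2 + e].
Proof.
have h := multiplier_sg_lin c d e.
apply: (multiplier_ext _ (multiplierM (multiplier_cst 2^-1) (multiplierD h (multiplierM h h)))) => p.
rewrite indicE; set t := _ + e.
have [t0|t0|t0] := ltgtP t 0.
- by rewrite memNset /= ?ltr0_sg//; [ring|rewrite -/t; move/ltW: t0; rewrite leNgt => /negP].
- by rewrite mem_set//= gtr0_sg//; field.
- by rewrite memNset /= -/t t0 ?sgr0 ?ltxx//; ring.
Qed.

(** Meant for the two coordinate projections, (c, d) = (1, 0) and (0, 1), whose preimages intersect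
    in the measurable rectangles. *)
Lemma mset_linear (c d : R) (A : set R) : measurable (A : set (measurableTypeR R)) ->
  mset ((fun p => c * p.1 + d * p.2) @^-1` A).
Proof.
rewrite (RGenOInfty.measurableE R).
move: A; apply: (@smallest_sub _ (sigma_algebra setT) (@RGenOInfty.G R)
  [set A | mset ((fun p => c * p.1 + d * p.2) @^-1` A)]).
  apply: mset_sigma.
  - by rewrite preimage_set0.
  - by [].
  - by move=> F; rewrite preimage_bigcup.
  - by rewrite preimage_setT; exact: msetT.
move=> _ [a ->] /=; have := mset_ray c d (- a); congr mset.
apply/seteqP; split => p /=; rewrite in_itv /= andbT; lra.
Qed.

Lemma mset_measurable (E : set M2) : measurable E -> mset E.
Proof.
rewrite measurable_prod_measurableType.
move: E; apply: (@smallest_sub _ (sigma_algebra setT) _ [set A | mset A]).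
  by apply: (mset_sigma (f := id)) => //; exact: msetT.
move=> _ [A mA [B mB] <-] /=.
have := msetI (mset_linear 1 0 mA) (mset_linear 0 1 mB); congr mset.
by apply/seteqP; split => -[x y] /=; rewrite !mul1r !mul0r addr0 add0r.
Qed.

(** Multiplying by the indicator of E and testing at frequency (0, 0) shows that v has integral 0
    over every measurable E. *)
Lemma vanishing_trig_ae0 v : vanishing_trig v -> {ae mu2, forall p, v p = 0}.
Proof.
move=> hv; have [iv _] := hv.
have : ae_eq mu2 [set: M2] (EFin \o v) (cst 0%E).
  apply: integral_ae_eq => // E _ mE.
  rewrite integral0 integral_mkcond.
  have [_ _ /(_ v hv)[ic /(_ 0 0)[+ _]]] := mset_measurable mE.
  rewrite /Rintegral => h.
  rewrite -[LHS]fineK.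
    rewrite -[RHS]/(0%:E) -h; congr (fine _)%:E; apply: eq_integral => p _.
    by rewrite !mul0r addr0 cos0 mulr1 restrict_EFin /= patchE indicE; case: ifP; rewrite ?mul1r ?mul0r.
  apply: integrable_fin_num => //.
  move: ic; congr (_.-integrable _ _); apply/funext => p.
  by rewrite restrict_EFin /= patchE indicE; case: ifP; rewrite ?mul1r ?mul0r.
move=> [N [mN N0 sN]]; exists N; split => //.
by apply: (subset_trans _ sN) => p /= np hp; apply: np; case: (hp I).
Qed.

End Uniqueness.

(** * Smoothness of entire functions *)

Section Cauchy.
Variable R : realType.
Local Notation C := R[i].
Local Notation nm := (@ComplexField.Normc.normc R).
Local Notation Re := (@complex.Re R).
Local Notation Im := (@complex.Im R).
Local Notation mu1 := (@lebesgue_measure R).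
Local Notation mu2 := (mu1 \x mu1)%E.
Local Notation M1 := (measurableTypeR R).
Local Notation M2 := (measurableTypeR R * measurableTypeR R)%type.
Implicit Types (f g h : C -> C) (z w : C) (v : C).

(** * Primitives on lines *)

Lemma is_derive0_cst (F : R -> R) (a b x y : R) :
  (forall s : R, a < s < b -> is_derive s 1 F 0) -> a < x < b -> a < y < b -> F x = F y.
Proof.
move=> dF; wlog xy : x y / x < y.
  move=> H hx hy; have [xy|xy|->//] := ltgtP x y; first exact: H.
  by apply/esym; exact: H.
move=> /andP[ax xb] /andP[ay yb].
have cF s : a < s < b -> {for s, continuous F}.
  by move=> hs; apply/differentiable_continuous/derivable1_diffP; have [] := dF s hs.
have [||c _] := @MVT _ F (fun=> 0) x y xy.
- by move=> s; rewrite in_itv /= => /andP[h1 h2]; apply: dF; lra.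
- apply: continuous_in_subspaceT => s; rewrite inE /= in_itv /= => /andP[h1 h2].
  by apply: cF; lra.
- by rewrite mul0r => /eqP; rewrite subr_eq0 => /eqP.
Qed.

(** An integral from the base point [a] is a primitive to the right of [a] only; the normalisation
    at 0 makes different base points comparable. *)
Lemma primitive_halfline (p : R -> R) (a : R) : continuous p -> a < 0 ->
  exists2 F : R -> R, F 0 = 0 & forall x : R, a < x -> is_derive x 1 F (p x).
Proof.
move=> cp a0.
pose F (x : R) : R := \int[mu1]_(t in `[a, x]) p t.
exists (fun x => F x - F 0); first by rewrite subrr.
move=> x ax.
have ip : mu1.-integrable `[a, x + 1] (EFin \o p).
  apply: continuous_compact_integrable; first exact: segment_compact.
  exact: continuous_subspaceT.
have x1 : x < x + 1 by rewrite ltrDl.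
have [|dF eF] := continuous_FTC1 x1 ip _ (cp x); first by rewrite lte_fin.
have h : is_derive x 1 F (p x).
  by apply: DeriveDef; [exact: dF|rewrite -derive1E; exact: eF].
by apply: (is_derive_eq (is_deriveB h (is_derive_cst _ _ _))); rewrite subr0.
Qed.

(** The normalised primitives on the half-lines from -(n+1) agree on overlaps, so the value at x can
    be read off any of them with n + 1 > |x|. *)
Lemma primitive_real (p : R -> R) : continuous p ->
  exists F : R -> R, forall x : R, is_derive x 1 F (p x).
Proof.
move=> cp.
have ex (n : nat) : exists F : R -> R, F 0 = 0 /\
    forall x : R, - n.+1%:R < x -> is_derive x 1 F (p x).
  by have [|F F0 dF] := @primitive_halfline p (- n.+1%:R) cp; [rewrite oppr_lt0|exists F].
have [F HF] := choice ex.
have FE (n m : nat) (x : R) : (n <= m)%N -> - n.+1%:R < x -> F n x = F m x.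
  move=> nm' hx; have [Fn dFn] := HF n; have [Fm dFm] := HF m.
  have n0 : (0 : R) < n.+1%:R by [].
  have nm1 : (n.+1%:R : R) <= m.+1%:R by rewrite ler_nat.
  apply/eqP; rewrite -subr_eq0; apply/eqP.
  transitivity (F n 0 - F m 0); last by rewrite Fn Fm subrr.
  apply: (@is_derive0_cst (fun x => F n x - F m x) (- n.+1%:R) (`|x| + 1)).
  - move=> s /andP[s1 s2]; have h1 := dFn s s1.
    have h2 : is_derive s 1 (F m) (p s) by apply: dFm; lra.
    by apply: (is_derive_eq (is_deriveB h1 h2)); rewrite subrr.
  - by rewrite hx /=; have := ler_norm x; lra.
  - by have := normr_ge0 x; lra.
exists (fun x => F (Num.truncn `|x|) x) => x0.
pose m := (Num.truncn `|x0|).+1.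
have hx0 := truncnS_gt `|x0|.
have [Fm dFm] := HF m.
apply: (@near_eq_is_derive _ _ _ (F m)); last first.
  have hm : (m%:R <= m.+1%:R :> R) by rewrite ler_nat.
  by apply: dFm; have := ler_norm (- x0); rewrite normrN; move: hm hx0; rewrite -/m; lra.
exists 1 => //= x; rewrite /= => hx.
have tm : (Num.truncn `|x| <= m)%N.
  rewrite -ltnS truncn_lt_nat//.
  have : `|x| <= `|x0| + `|x0 - x| by rewrite -{1}(subKr x0 x) ler_normB.
  by rewrite /m -[_.+2]addn1 natrD; lra.
apply/esym/FE => //.
by have := truncnS_gt `|x|; have := ler_norm (- x); rewrite normrN; lra.
Qed.

Lemma primitive_line f z v : ccont f -> exists P : R -> C, forall t, cder P t (f (z + t%:C * v)).
Proof.
move=> cf.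
have cl : ccont (fun w => f (z + (Re w)%:C * v)).
  move=> w e e0; have [d d0 Hd] := cf (z + (Re w)%:C * v) e e0.
  have v1 : 0 < nm v + 1 by rewrite ltr_wpDl// nm_ge0.
  exists (d / (nm v + 1)) => [|w' hw]; first by rewrite divr_gt0.
  apply: Hd; rewrite opprD addrACA subrr add0r -mulrBl -rmorphB nmM nm_real /=.
  apply: (@le_lt_trans _ _ (nm (w' - w) * (nm v + 1))); last by rewrite -ltr_pdivlMr.
  rewrite ler_pM ?nm_ge0//; last by rewrite lerDl.
  by rewrite -cReN -cReD nm_Re.
have [cr ci] := (ccont_rc _).1 cl.
have [|P1 h1] := @primitive_real (fun t => Re (f (z + t%:C * v))).
  move=> t; apply: (@continuous_comp R (R * R)%type R (fun s => (s, 0))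
    (fun p => Re (f (z + (Re (ofxy p))%:C * v)))); last exact: cr.
  exact: cont_pairl.
have [|P2 h2] := @primitive_real (fun t => Im (f (z + t%:C * v))).
  move=> t; apply: (@continuous_comp R (R * R)%type R (fun s => (s, 0))
    (fun p => Im (f (z + (Re (ofxy p))%:C * v)))); last exact: ci.
  exact: cont_pairl.
by exists (fun t => P1 t +i* P2 t) => t; split; rewrite /=.
Qed.

Lemma cder_MVT (p dp : R -> C) (a b K : R) : a <= b -> (forall t, cder p t (dp t)) ->
  (forall t, a <= t <= b -> nm (dp t) <= K) -> nm (p b - p a) <= 2 * K * (b - a).
Proof.
move=> ab dpE hK.
have h (q : C -> R) : (forall z, `|q z| <= nm z) ->
    (forall t : R, is_derive t 1 (fun t => q (p t)) (q (dp t))) ->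
    `|q (p b) - q (p a)| <= K * (b - a).
  move=> qn dq; move: ab; rewrite le_eqVlt => /predU1P[->|ab']; first by rewrite !subrr normr0 mulr0.
  have [|c] := @MVT _ (fun t => q (p t)) (fun t => q (dp t)) _ _ ab' (fun x _ => dq x).
  - apply: continuous_subspaceT => x; apply/differentiable_continuous/derivable1_diffP.
    by have [] := dq x.
  - rewrite in_itv /= => /andP[/ltW h1 /ltW h2] ->.
    have ba : 0 <= b - a by rewrite subr_ge0 ltW.
    rewrite normrM (ger0_norm ba) ler_wpM2r//.
    by rewrite (le_trans (qn _))// hK// h1.
apply: (le_trans (nm_ReIm _)); rewrite !ReImE -mulrA mulr_natl mulr2n; apply: lerD.
  by apply: h; [exact: nm_Re|move=> t; case: (dpE t)].
by apply: h; [exact: nm_Im|move=> t; case: (dpE t)].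
Qed.

(** * Goursat's theorem on rectangles *)

Section Goursat.
Variables (h h' : C -> C) (X Y : R -> R -> C).
Hypothesis hh' : cdiff h h'.
Hypothesis dX : forall y t, cder (X y) t (h (t +i* y)).
Hypothesis dY : forall x t, cder (Y x) t (h (x +i* t)).

(** The integral of h along the boundary of the rectangle [a, b] x [c, d], coded [((a, b), (c, d))]:
    bottom minus top, plus i times right minus left. Expressed by primitives on lines, it is
    additive under subdivision by plain algebra. *)
Let S (q : R * R * (R * R)) : C :=
  (X q.2.1 q.1.2 - X q.2.1 q.1.1) - (X q.2.2 q.1.2 - X q.2.2 q.1.1)
  + 'i * (Y q.1.2 q.2.2 - Y q.1.2 q.2.1) - 'i * (Y q.1.1 q.2.2 - Y q.1.1 q.2.1).

Let sz (q : R * R * (R * R)) : R := (q.1.2 - q.1.1) + (q.2.2 - q.2.1).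

(** Near z the deviation of h from its first-order expansion is at most (e/4) times the
    semiperimeter [sz]. Four edges of total length 2 [sz], with the factor 2 of [cder_MVT], give e
    [sz]^2. *)
Lemma goursat_local (z : C) (e : R) : 0 < e -> exists2 d : R, 0 < d &
  forall q, q.1.1 <= Re z <= q.1.2 -> q.2.1 <= Im z <= q.2.2 -> sz q < d ->
    nm (S q) <= e * sz q ^+ 2.
Proof.
move=> e0; have e4 : 0 < e / 4 by rewrite divr_gt0.
have [d d0 Hd] := hh' z e4; exists d => //.
move=> [[a b] [c d']] /=; set q := (_, _) => /andP[az zb] /andP[cz zd] hs.
have hsE : sz q = (b - a) + (d' - c) by [].
have ab : a <= b by lra.
have cd : c <= d' by lra.
(* A global primitive of the first-order expansion of h at z; its increments cancel around the
   rectangle, so it can be subtracted on each edge. *)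
pose Q (y : C) := y * h z + (y - z) ^+ 2 * (h' z / 2%:R).
pose r (y : C) := h y - (h z + (y - z) * h' z).
have two : (2%:R : C) != 0 by rewrite pnatr_eq0.
have rb x y : a <= x <= b -> c <= y <= d' -> nm (r (x +i* y)) <= e / 4 * sz q.
  move=> /andP[x1 x2] /andP[y1 y2].
  have hk : nm ((x +i* y) - z) <= sz q.
    apply: (le_trans (nm_ReIm _)); rewrite !ReImE /= hsE.
    by apply: lerD; rewrite ler_norml; lra.
  have := Hd ((x +i* y) - z); rewrite subrKC => /(_ (le_lt_trans hk hs)).
  rewrite /r opprD addrA => /le_trans; apply.
  by rewrite ler_wpM2l// ltW.
have dQ (p : R -> C) t l : cder p t l -> cder (fun s => Q (p s)) t (l * (h z + (p t - z) * h' z)).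
  move=> dp; have dpz := cderD dp (cder_cst (- z) t).
  have := cderD (cderM dp (cder_cst (h z) t))
    (cderM (cderM dpz dpz) (cder_cst (h' z / 2%:R) t)).
  by move/cder_eq; apply; field.
have dx (y t : R) : cder (fun s => s +i* y) t 1.
  have := cder_affine (0 +i* y) 1 t; apply: cder_ext => s; by simpc.
have dy (x t : R) : cder (fun s => x +i* s) t 'i.
  have := cder_affine (x +i* 0) 'i t; apply: cder_ext => s; by simpc.
have N (p q' : R -> C) (t : R) (l m : C) : cder p t l -> cder q' t m -> cder (fun s => p s - q' s) t (l - m).
  move=> h1 h2; have := cderD h1 (cderM (cder_cst (-1) t) h2).
  move=> h3; apply: cder_ext (cder_eq h3 _) => [s|]; first by rewrite mulN1r.
  by ring.
have bx y : c <= y <= d' -> nm ((X y b - Q (b +i* y)) - (X y a - Q (a +i* y))) <= 2 * (e / 4 * sz q) * (b - a).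
  move=> hy; apply: (@cder_MVT (fun t => X y t - Q (t +i* y)) (fun t => r (t +i* y))) => // t.
    by have := N _ _ _ _ _ (dX y t) (dQ _ _ _ (dx y t)); rewrite mul1r.
  by move=> ht; exact: rb.
have by' x : a <= x <= b -> nm (('i * Y x d' - Q (x +i* d')) - ('i * Y x c - Q (x +i* c))) <= 2 * (e / 4 * sz q) * (d' - c).
  move=> hx; apply: (@cder_MVT (fun t => 'i * Y x t - Q (x +i* t)) (fun t => 'i * r (x +i* t))) => // t.
    have h3 := N _ _ _ _ _ (cderM (cder_cst 'i t) (dY x t)) (dQ _ _ _ (dy x t)).
    by apply: cder_eq h3 _; rewrite mul0r add0r -mulrBr.
  by move=> ht; rewrite nmM nm_i mul1r; exact: rb.
have -> : S q = ((X c b - Q (b +i* c)) - (X c a - Q (a +i* c)))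
  - ((X d' b - Q (b +i* d')) - (X d' a - Q (a +i* d')))
  + (('i * Y b d' - Q (b +i* d')) - ('i * Y b c - Q (b +i* c)))
  - (('i * Y a d' - Q (a +i* d')) - ('i * Y a c - Q (a +i* c))).
  by rewrite /S /=; ring.
have cc : c <= c <= d' by rewrite lexx.
have dd : c <= d' <= d' by rewrite lexx andbT.
have aa : a <= a <= b by rewrite lexx.
have bb : a <= b <= b by rewrite lexx andbT.
have := bx c cc; have := bx d' dd; have := by' a aa; have := by' b bb.
set u1 := _ - _ - _; set u2 := _ - _ - _; set u3 := _ - _ - _; set u4 := _ - _ - _.
move=> H1 H2 H3 H4.
apply: (le_trans (nmB _ _)); apply: (le_trans (lerD (nmD _ _) (lexx _))).
apply: (le_trans (lerD (lerD (nmB _ _) (lexx _)) (lexx _))).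
rewrite hsE in H1 H2 H3 H4 *; nra.
Qed.

Let quarter (q q' : R * R * (R * R)) :=
  (q'.1 = (q.1.1, (q.1.1 + q.1.2) / 2) \/ q'.1 = ((q.1.1 + q.1.2) / 2, q.1.2)) /\
  (q'.2 = (q.2.1, (q.2.1 + q.2.2) / 2) \/ q'.2 = ((q.2.1 + q.2.2) / 2, q.2.2)).

Lemma goursat_rect (a b c d : R) : a <= b -> c <= d -> S ((a, b), (c, d)) = 0.
Proof.
move=> ab cd.
suff H e : 0 < e -> nm (S ((a, b), (c, d))) <= e * sz ((a, b), (c, d)) ^+ 2.
  apply: nm_eq0; apply/eqP; rewrite eq_le nm_ge0 andbT.
  apply/ler_addgt0Pl => e e0; rewrite addr0.
  have s1 : 0 < sz ((a, b), (c, d)) ^+ 2 + 1 by rewrite ltr_wpDl// sqr_ge0.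
  have /H/le_trans : 0 < e / (sz ((a, b), (c, d)) ^+ 2 + 1) by rewrite divr_gt0.
  apply; rewrite mulrAC ler_pdivrMr// ler_wpM2l ?(ltW e0)//; lra.
move=> e0; rewrite leNgt; apply/negP => bad0.
(* The threshold scales with the square of the size, so a bad rectangle has a bad quarter; nested
   bad quarters shrink to a point that contradicts [goursat_local]. *)
pose bad q := e * sz q ^+ 2 < nm (S q).
(* Badness is a premise inside the existential, so that choice yields a total map that can be
   iterated. *)
have step q : exists q', bad q -> bad q' /\ quarter q q'.
  have [bq|nb] := pselect (bad q); last by exists q.
  case: q bq => -[a1 b1] [c1 d1] bq.
  pose m1 := (a1 + b1) / 2; pose m2 := (c1 + d1) / 2.
  have [h1|n1] := pselect (bad ((a1, m1), (c1, m2))).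
    by exists ((a1, m1), (c1, m2)) => _; split => //; split; [left|left].
  have [h2|n2] := pselect (bad ((m1, b1), (c1, m2))).
    by exists ((m1, b1), (c1, m2)) => _; split => //; split; [right|left].
  have [h3|n3] := pselect (bad ((a1, m1), (m2, d1))).
    by exists ((a1, m1), (m2, d1)) => _; split => //; split; [left|right].
  have [h4|n4] := pselect (bad ((m1, b1), (m2, d1))).
    by exists ((m1, b1), (m2, d1)) => _; split => //; split; [right|right].
  exfalso; move: bq; rewrite /bad.
  have -> : S ((a1, b1), (c1, d1)) = S ((a1, m1), (c1, m2)) + S ((m1, b1), (c1, m2))
     + (S ((a1, m1), (m2, d1)) + S ((m1, b1), (m2, d1))) by rewrite /S /=; ring.
  move: n1 n2 n3 n4; rewrite /bad => /negP; rewrite -leNgt => n1 /negP; rewrite -leNgt => n2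
    /negP; rewrite -leNgt => n3 /negP; rewrite -leNgt => n4.
  apply/negP; rewrite -leNgt.
  apply: (le_trans (nmD _ _)); apply: (le_trans (lerD (nmD _ _) (nmD _ _))).
  apply: (le_trans (lerD (lerD n1 n2) (lerD n3 n4))).
  by rewrite /sz /= /m1 /m2 le_eqVlt; apply/orP; left; apply/eqP; field.
have [nx Hnx] := choice step.
pose q n := iter n nx ((a, b), (c, d)).
have qbad n : bad (q n) by elim: n => //= n /Hnx[].
have qq n : quarter (q n) (q n.+1) by have [] := Hnx _ (qbad n).
have qord n : (q n).1.1 <= (q n).1.2 /\ (q n).2.1 <= (q n).2.2.
  elim: n => [//|n [h1 h2]]; have [[->|->] [->|->]] := qq n => /=; split; lra.
have qmon n : [/\ (q n).1.1 <= (q n.+1).1.1, (q n.+1).1.2 <= (q n).1.2,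
    (q n).2.1 <= (q n.+1).2.1 & (q n.+1).2.2 <= (q n).2.2].
  have [h1 h2] := qord n; have [[->|->] [->|->]] := qq n => /=; split; lra.
have qsz n : sz (q n) = sz ((a, b), (c, d)) / 2 ^+ n.
  elim: n => [|n IH]; first by rewrite expr0 divr1.
  transitivity (sz (q n) / 2); last by rewrite IH exprSr invfM mulrA.
  by rewrite /sz; have [[->|->] [->|->]] := qq n => /=; field.
have lim (l u : nat -> R) : (forall n, l n <= l n.+1) -> (forall n, u n.+1 <= u n) ->
    (forall n, l n <= u n) -> exists p, forall n, l n <= p <= u n.
  move=> hl hu hlu.
  have ml : {homo l : n m / (n <= m)%N >-> n <= m} by apply: homo_leq => //; exact: le_trans.
  have mu : {homo u : n m / (n <= m)%N >-> m <= n}.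
    by apply: (homo_leq (r := fun x y => y <= x)) => // x y z h1 h2; exact: le_trans h2 h1.
  have lu n m : l n <= u m.
    apply: (le_trans (ml n (maxn n m) (leq_maxl _ _))).
    by apply: (le_trans (hlu _)); apply: mu; exact: leq_maxr.
  exists (sup (range l)) => n; apply/andP; split.
    apply: ub_le_sup; last by exists n.
    by exists (u 0%N) => _ [m _ <-].
  by apply: ge_sup; [exists (l 0%N); exists 0%N|move=> _ [m _ <-]].
have [p1 Hp1] := lim (fun n => (q n).1.1) (fun n => (q n).1.2)
  (fun n => let: And4 h _ _ _ := qmon n in h) (fun n => let: And4 _ h _ _ := qmon n in h)
  (fun n => (qord n).1).
have [p2 Hp2] := lim (fun n => (q n).2.1) (fun n => (q n).2.2)
  (fun n => let: And4 _ _ h _ := qmon n in h) (fun n => let: And4 _ _ _ h := qmon n in h)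
  (fun n => (qord n).2).
have [dl dl0 Hd] := goursat_local (p1 +i* p2) e0.
have [n hn] : exists n, sz (q n) < dl.
  have s0 : 0 <= sz ((a, b), (c, d)) by rewrite /sz /=; lra.
  exists (Num.truncn (sz ((a, b), (c, d)) / dl)).+1; rewrite qsz.
  set n := Num.truncn _.
  rewrite ltr_pdivrMr ?exprn_gt0// mulrC -ltr_pdivrMr//.
  apply: (lt_le_trans (truncnS_gt _)); rewrite -natrX ler_nat.
  by apply: ltnW; exact: ltn_expl.
have := Hd (q n) (Hp1 n) (Hp2 n) hn; rewrite leNgt => /negP; apply.
exact: qbad.
Qed.

(** Reversing an interval changes the sign of S; this allows a target point in any quadrant. *)
Lemma goursat (a b c d : R) : S ((a, b), (c, d)) = 0.
Proof.
have [ab|ab] := lerP a b; have [cd|cd] := lerP c d.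
- exact: goursat_rect.
- have := goursat_rect ab (ltW cd) => H.
  transitivity (- S ((a, b), (d, c))); last by rewrite H oppr0.
  by rewrite /S /=; ring.
- have := goursat_rect (ltW ab) cd => H.
  transitivity (- S ((b, a), (c, d))); last by rewrite H oppr0.
  by rewrite /S /=; ring.
- have := goursat_rect (ltW ab) (ltW cd) => H.
  transitivity (S ((b, a), (d, c))); last by rewrite H.
  by rewrite /S /=; ring.
Qed.
End Goursat.

Lemma cder_unshift (p : R -> C) (t : R) (l : C) : cder p t l ->
  cder (fun s => p (t + s)) 0 l.
Proof.
have shift (F : R -> R) d : is_derive t 1 F d -> is_derive (0 : R) 1 (fun s => F (t + s)) d.
  move=> hF; have d1 : is_derive (0 : R) 1 (fun s : R => t + s) 1.
    apply: (is_derive_eq (is_deriveD (is_derive_cst _ _ _) (is_derive_id _ _))).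
    by rewrite add0r.
  have h0 : is_derive (t + 0) 1 F d by rewrite addr0.
  exact: is_derive_eq (is_derive1_comp h0 d1) (mulr1 _).
by move=> [hr hi]; split; [exact: (shift _ _ hr)|exact: (shift _ _ hi)].
Qed.

(** [H] integrates from 0 first horizontally, then vertically. By Goursat the other order gives the
    same value, and each order exhibits one of the two partial derivatives. *)
Lemma entire_primitive h h' : cdiff h h' -> exists2 H, cdiff H h & ccont H.
Proof.
move=> hh'; have ch := cdiff_ccont hh'.
have exX y : exists P : R -> C, forall t, cder P t (h (t +i* y)).
  have [P HP] := primitive_line (0 +i* y) 1 ch; exists P => t.
  by have := HP t; congr cder; congr h; simpc.
have exY x : exists P : R -> C, forall t, cder P t (h (x +i* t)).
  have [P HP] := primitive_line (x +i* 0) 'i ch; exists P => t.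
  by have := HP t; congr cder; congr h; simpc.
have [X dX] := choice exX; have [Y dY] := choice exY.
pose H (z : C) := X 0 (Re z) - X 0 0 + 'i * (Y (Re z) (Im z) - Y (Re z) 0).
have HE z : H z = X (Im z) (Re z) - X (Im z) 0 + 'i * (Y 0 (Im z) - Y 0 0).
  have := goursat hh' dX dY 0 (Re z) 0 (Im z) => /= /eqP.
  rewrite subr_eq0 => /eqP E; rewrite /H -E; ring.
have wH : W H h (fun=> 0).
  split=> z; apply: cder_shift.
    apply: (@cder_ext _ (fun s => X (Im z) (Re z + s) - X (Im z) 0 + 'i * (Y 0 (Im z) - Y 0 0))).
      by move=> s; rewrite HE add0r; case: z => x y; simpc.
    have h0 : cder (fun s => X (Im z) (Re z + s)) 0 (h z).
      by apply: cder_unshift; have := dX (Im z) (Re z); case: (z).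
    have := cderD (cderD h0 (cder_cst (- X (Im z) 0) 0)) (cder_cst ('i * (Y 0 (Im z) - Y 0 0)) 0).
    by move/cder_eq; apply; rewrite !addr0.
  apply: (@cder_ext _ (fun s => X 0 (Re z) - X 0 0 + 'i * (Y (Re z) (Im z + s) - Y (Re z) 0))).
    by move=> s; rewrite /H add0r; case: z => x y; simpc.
  have h0 : cder (fun s => Y (Re z) (Im z + s)) 0 (h z).
    by apply: cder_unshift; have := dY (Re z) (Im z); case: (z).
  have h1 := cderD h0 (cder_cst (- Y (Re z) 0) 0).
  have := cderD (cder_cst (X 0 (Re z) - X 0 0) 0) (cderM (cder_cst 'i 0) h1).
  by move/cder_eq; apply; rewrite mul0r !add0r addr0 subr0.
have cH := W_cdiff wH ch; exists H => //; exact: cdiff_ccont cH.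
Qed.

(** * Flat functions and radial bumps *)

(** The usual flat function e^(-1/x), extended by 0; with the factors x^(-j) the family is closed
    under differentiation. *)
Definition flat_exp (j : nat) (x : R) : R :=
  if 0 < x then x^-1 ^+ j * expR (- x^-1) else 0.

Lemma flat_exp_ge0 j x : 0 <= flat_exp j x.
Proof.
rewrite /flat_exp; case: ifP => // x0.
by rewrite mulr_ge0 ?expR_ge0// exprn_ge0// invr_ge0 ltW.
Qed.

(** With y = 1/x this is y^(j+2) <= (j+2)! e^y. The quadratic bound gives the zero derivative at
    0. *)
Lemma flat_exp_sq j x : flat_exp j x <= (j.+2)`!%:R * x ^+ 2.
Proof.
rewrite /flat_exp; case: ifP => x0; last by rewrite mulr_ge0// sqr_ge0.
have y0 : 0 < x^-1 by rewrite invr_gt0.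
have := expR_ge1Dxn j.+1 (ltW y0); set y := x^-1 => h.
have f0 : (0 : R) < (j.+2)`!%:R by rewrite ltr0n fact_gt0.
have h1 : y ^+ j.+2 <= (j.+2)`!%:R * expR y.
  by rewrite mulrC -ler_pdivrMr//; apply: le_trans h; rewrite lerDr.
have -> : x = y^-1 by rewrite /y invrK.
rewrite expRN ler_pdivrMr ?expR_gt0// [y^-1 ^+ 2]exprVn mulrAC ler_pdivlMr ?exprn_gt0//.
by rewrite -exprD addn2.
Qed.

Definition flat_exp' (j : nat) (x : R) : R := flat_exp j.+2 x - j%:R * flat_exp j.+1 x.

Lemma is_derive_flat_exp j (x : R) : is_derive x 1 (flat_exp j) (flat_exp' j x).
Proof.
have [x0|x0|->] := ltgtP x 0.
- have -> : flat_exp' j x = 0.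
    by rewrite /flat_exp' /flat_exp [0 < x]ltNge (ltW x0)/= mulr0 subr0.
  apply: (@near_eq_is_derive _ _ _ (cst (0 : R))).
  exists (- x) => [|y /=]; first by rewrite /= oppr_gt0.
  rewrite ltr_norml => /andP[h1 h2]; rewrite /flat_exp ifF//.
  by apply/negbTE; rewrite -leNgt; lra.
- apply: (@near_eq_is_derive _ _ _ (fun y : R => y^-1 ^+ j * expR (- y^-1))).
    exists x => // y /=; rewrite ltr_norml => /andP[h1 h2]; rewrite /flat_exp ifT//; lra.
  have xn : x != 0 by rewrite gt_eqF.
  have dV : is_derive x 1 (fun y : R => y^-1) (- x^-1 ^+ 2).
    by apply: (is_derive_eq (is_deriveV xn (is_derive_id x 1))); rewrite /GRing.scale /= mulr1 exprVn.
  have dE : is_derive x 1 (fun y : R => expR (- y^-1)) (expR (- x^-1) * x^-1 ^+ 2).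
    have dN : is_derive x 1 (fun y : R => - y^-1) (x^-1 ^+ 2).
      by apply: (is_derive_eq (is_deriveN dV)); rewrite opprK.
    exact: (@is_derive1_comp _ expR).
  have dX : is_derive x 1 (fun y : R => y^-1 ^+ j) (- j%:R * x^-1 ^+ j.+1).
    elim: j => [|j IH]; first by rewrite oppr0 mul0r; exact: is_derive_cst.
    rewrite (_ : (fun y : R => _) = (fun y : R => y^-1) * (fun y : R => y^-1 ^+ j)).
      apply: (is_derive_eq (is_deriveM dV IH)).
      by rewrite /GRing.scale /= -[in RHS]natr1 !exprS; ring.
    by apply/funext => y; rewrite exprS.
  apply: (is_derive_eq (is_deriveM dX dE)).
  by rewrite /flat_exp' /flat_exp x0 /GRing.scale /= !exprS; ring.
- have E0 : flat_exp j 0 = 0 by rewrite /flat_exp ltxx.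
  rewrite /flat_exp' /flat_exp ltxx mulr0 subr0 -/(flat_exp j).
  apply: (@is_derive_at0 R (flat_exp j) 0) => e e0; exists (e / (j.+2)`!%:R).
    by rewrite divr_gt0// ltr0n fact_gt0.
  move=> t ht; rewrite E0 subr0 mulr0 subr0 ger0_norm ?flat_exp_ge0//.
  apply: (le_trans (flat_exp_sq j t)).
  rewrite -real_normK ?num_real// expr2 mulrA ler_wpM2r//.
  rewrite mulrC -ler_pdivlMr ?ltW//; by rewrite ltr0n fact_gt0.
Qed.

(** Radial and supported in e |z|^2 <= 1: [e = 1] serves for averaging, small [e] for cutting
    off. *)
Definition cbump (e : R) (j : nat) : C -> C := fun z => (flat_exp j (1 - e * nm z ^+ 2))%:C.

Lemma conj_nm z : z * z^* = (nm z ^+ 2)%:C.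
Proof. by rewrite nm_sqr; case: z => x y; simpc; congr (_ +i* _); ring. Qed.

Lemma W_bump e j : W (cbump e j)
  (fun z => (cbump e j.+2 z + (- j%:R) * cbump e j.+1 z) * (- e%:C * z^*))
  (fun z => (cbump e j.+2 z + (- j%:R) * cbump e j.+1 z) * (- e%:C * z)).
Proof.
pose f z := 1 + (- e%:C) * (z * z^*).
have fE z : f z = (1 - e * nm z ^+ 2)%:C.
  by rewrite /f conj_nm; apply: complexP; rewrite !ReImE /=; ring.
have wf : W f (fun z => - e%:C * z^*) (fun z => - e%:C * z).
  have h := WD (W_cst 1) (WZ (- e%:C) (WM (W_id R) (W_conj R))).
  by apply: (W_eq h) => z /=; ring.
have fr z : Im (f z) = 0 by rewrite fE.
have dE z : (flat_exp' j (Re (f z)))%:C = cbump e j.+2 z + (- j%:R) * cbump e j.+1 z.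
  rewrite fE /flat_exp' /cbump -(rmorph_nat (real_complex R)).
  by apply: complexP; rewrite !ReImE /=; ring.
have := W_real (is_derive_flat_exp j) fr wf.
rewrite (_ : (fun z => (flat_exp j (Re (f z)))%:C) = cbump e j); last first.
  by apply/funext => z; rewrite fE.
by move/W_eq; apply => z; rewrite dE.
Qed.

Lemma GW_W k f a b : W f a b -> GW (fun=> True) k a -> GW (fun=> True) k b ->
  ccont f -> GW (fun=> True) k.+1 f.
Proof. by move=> w ha hb cf; apply: (GW_S cf I w). Qed.

Lemma GWT_D k f g : GW (fun=> True) k f -> GW (fun=> True) k g ->
  GW (fun=> True) k (fun z => f z + g z).
Proof. exact: GWD. Qed.

Lemma GWT_M k f g : GW (fun=> True) k f -> GW (fun=> True) k g ->
  GW (fun=> True) k (fun z => f z * g z).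
Proof. exact: GWM. Qed.

Lemma bump_cont e j : ccont (cbump e j).
Proof.
have cr : continuous (fun x : R => flat_exp j x).
  move=> x; apply/differentiable_continuous/derivable1_diffP.
  by have [] := is_derive_flat_exp j x.
have := ccont_real cr (ccontD (ccont_cst 1) (ccontZ (- e%:C) (ccontM (@ccont_id R) (@ccont_conj R)))).
congr ccont; apply/funext => z; rewrite /cbump conj_nm.
by rewrite cReD cReM !(cReN, cImN) /= oppr0 !mul0r subr0 mulNr.
Qed.

Lemma smooth_bump e j : smoothW (cbump e j).
Proof.
move=> k; elim: k j => [|k IH] j; first by split => //; exact: bump_cont.
have sC c : GW (fun=> True) k (fun=> c) by exact: GW_cst.
apply: (GW_W (W_bump e j)); last exact: bump_cont.
  apply: GWT_M; first by apply: GWT_D => //; exact: GWT_M.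
  by apply: GWT_M => //; exact: (ord_smooth (@ord_conj R)).
apply: GWT_M; first by apply: GWT_D => //; exact: GWT_M.
by apply: GWT_M => //; exact: (ord_smooth (@ord_id R)).
Qed.

(** The exact radius is 1/sqrt e; 1/e + 1 is an upper bound free of square roots. *)
Lemma supp_bump e j : 0 < e -> suppP ((e^-1) + 1) (cbump e j).
Proof.
move=> e0 z hz; rewrite /cbump /flat_exp ifF//; apply/negbTE; rewrite -leNgt subr_le0.
have e1 : 0 < e^-1 by rewrite invr_gt0.
have : e * (e^-1 + 1) ^+ 2 <= e * nm z ^+ 2.
  by rewrite ler_wpM2l ?ltW// ltr_sqr ?nnegrE ?nm_ge0; lra.
have -> : e * (e^-1 + 1) ^+ 2 = e^-1 + 2 + e.
  by field; rewrite gt_eqF.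
lra.
Qed.

(** * Mean values of holomorphic functions *)

Lemma cdiff_affine f f' (a b : C) : cdiff f f' ->
  cdiff (fun z => f (a + b * z)) (fun z => b * f' (a + b * z)).
Proof.
move=> hf z e e0.
have b1 : 0 < nm b + 1 by rewrite ltr_wpDl// nm_ge0.
have [d d0 H] := hf (a + b * z) (e / (nm b + 1)) (divr_gt0 e0 b1).
exists (d / (nm b + 1)) => [|k hk]; first by rewrite divr_gt0.
have bk : nm (b * k) <= nm k * (nm b + 1) by rewrite nmM mulrC ler_wpM2l ?nm_ge0// lerDl.
have := H (b * k).
rewrite (_ : a + b * z + b * k = a + b * (z + k)); last by ring.
rewrite (_ : b * k * _ = k * (b * f' (a + b * z))); last by ring.
move=> H1.
apply: (le_trans (H1 _)); last by rewrite mulrAC ler_pdivrMr// -mulrA ler_wpM2l// ltW.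
by apply: (le_lt_trans bk); rewrite -ltr_pdivlMr.
Qed.

(* Rescaling the holomorphic factor towards w moves the integral by the integral of
   dzbar (g1 K), because (z - w) kap = dzbar K. *)
Lemma kernel_mean_value (w : C) (g g1 g2 kap K Kz : C -> C) (c A dl : R) : c < 0 -> 0 < dl ->
  cdiff g g1 -> cdiff g1 g2 -> ccont g2 -> ccont kap -> cint kap ->
  W K Kz (fun z => (z - w) * kap z) -> ccont K -> ccont Kz ->
  (forall p q, p = g \/ p = g1 \/ p = g2 ->
     q = kap \/ q = K \/ q = Kz \/ q = (fun z => (z - w) * kap z) ->
     forall (s : R) z, - dl < s < 1 + dl ->
     nm (p (w + s%:C * (z - w))) * nm (q z) <= A * expR (c * nm z ^+ 2)) ->
  cintegral (fun z => g z * kap z) = g w * cintegral kap.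
Proof.
move=> c0 dl0 dg dg1 cg2 ck ik wK cK cKz hb.
have cg := cdiff_ccont dg; have cg1 := cdiff_ccont dg1.
have caff p (s : R) : ccont p -> ccont (fun z => p (w + s%:C * (z - w))).
  move=> cp z e e0; have [d d0 Hd] := cp (w + s%:C * (z - w)) e e0.
  have s1 : 0 < `|s| + 1 by rewrite ltr_wpDl.
  exists (d / (`|s| + 1)) => [|y hy]; first by rewrite divr_gt0.
  apply: Hd; rewrite (_ : _ - _ = s%:C * (y - z)); last by ring.
  rewrite nmM nm_real; apply: (@le_lt_trans _ _ ((`|s| + 1) * nm (y - z))).
    by rewrite ler_wpM2r ?nm_ge0// lerDl.
  by rewrite mulrC -ltr_pdivlMr.
have cw : ccont (fun z => (z - w) * kap z).
  by apply: ccontM => //; exact: ccontD (@ccont_id R) (ccont_cst _).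
have bndpq p q s : p = g \/ p = g1 \/ p = g2 ->
     q = kap \/ q = K \/ q = Kz \/ q = (fun z => (z - w) * kap z) -> - dl < s < 1 + dl ->
     bnd c (fun z => p (w + s%:C * (z - w)) * q z).
  by move=> hp hq hs; exists A => z; rewrite nmM; exact: hb.
pose P (s : R) z := g (w + s%:C * (z - w)) * kap z.
pose dP (s : R) z := g1 (w + s%:C * (z - w)) * ((z - w) * kap z).
have iP s : - dl < s < 1 + dl -> cint (P s).
  move=> hs; apply: (bnd_cint c0); first by apply: ccontM => //; exact: caff.
  by apply: bndpq => //; left.
have dPE s z : - dl < s < 1 + dl -> cder (fun s => P s z) s (dP s z).
  move=> _; have h1 := dd_line w s (cdiff_dd (z - w) dg).
  have := cderM h1 (cder_cst (kap z) s).
  by move/cder_eq; apply; rewrite mulr0 addr0 /dP; ring.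
have bdP s z : - dl < s < 1 + dl -> nm (dP s z) <= A * expR (c * nm z ^+ 2).
  move=> hs; rewrite /dP nmM.
  exact: (hb g1 (fun z => (z - w) * kap z) (or_intror (or_introl erefl))
    (or_intror (or_intror (or_intror erefl)))).
have iB : rint (fun z => A * expR (c * nm z ^+ 2)).
  by apply: rintZ; rewrite -[c]opprK; apply: rint_gauss; rewrite oppr_gt0.
have dI s : - dl < s < 1 + dl -> cder (fun s => cintegral (P s)) s 0.
  move=> hs; apply: cder_eq (cder_cintegral hs iP dPE bdP iB) _.
  have dg1a := cdiff_affine (w - s%:C * w) s%:C dg1.
  have affE z : w - s%:C * w + s%:C * z = w + s%:C * (z - w) by ring.
  have wp := WM (cdiff_W dg1a) wK.
  have wp' : W (fun z => g1 (w + s%:C * (z - w)) * K z)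
      (fun z => s%:C * g2 (w + s%:C * (z - w)) * K z + g1 (w + s%:C * (z - w)) * Kz z)
      (dP s).
    rewrite (_ : (fun z => g1 _ * K z) = fun z => g1 (w - s%:C * w + s%:C * z) * K z).
      by apply: W_eq wp _ _ => z; rewrite affE// mul0r add0r.
    by apply/funext => z; rewrite affE.
  have [|||||_ //] := @cintegral_W _ _ _ _ _ c0 wp'.
  - by apply: ccontD; apply: ccontM => //; [apply: ccontZ; exact: caff|exact: caff].
  - by apply: ccontM => //; exact: caff.
  - by apply: bndpq => //; [right; left|right; left].
  - apply: bndD; last by apply: bndpq => //; [right; left|right; right; left].
    have := bndM (bnd_cst s%:C (lexx 0)) (bndpq g2 K s (or_intror (or_intror erefl)) (or_intror (or_introl erefl)) hs).
    by rewrite add0r; congr bnd; apply/funext => z; rewrite mulrA.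
  - by apply: bndpq => //; [right; left|right; right; right].
have E : cintegral (P 1) = cintegral (P 0).
  have i0 : - dl < (0 : R) < 1 + dl by apply/andP; split; lra.
  have i1 : - dl < (1 : R) < 1 + dl by apply/andP; split; lra.
  apply: complexP.
    by apply: (@is_derive0_cst (fun s => Re (cintegral (P s))) (- dl) (1 + dl)) => // s /dI[].
  by apply: (@is_derive0_cst (fun s => Im (cintegral (P s))) (- dl) (1 + dl)) => // s /dI[].
rewrite -cintegralZ//; move: E; congr (cintegral _ = cintegral _).
  by apply/funext => z; rewrite /P mul1r subrKC.
by apply/funext => z; rewrite /P rmorph0 mul0r addr0.
Qed.

(** * Convolution with compactly supported functions *)

Lemma cder_neg (p : R -> C) (t : R) (l : C) : cder p (- t) l ->
  cder (fun s => p (- s)) t (- l).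
Proof.
have rev (F : R -> R) d : is_derive (- t) 1 F d -> is_derive t 1 (fun s : R => F (- s)) (- d).
  move=> hF; have d1 : is_derive t 1 (fun s : R => - s) (- 1).
    exact: is_deriveN (is_derive_id _ _).
  apply: (is_derive_eq (is_derive1_comp hF d1)); by rewrite mulrN1.
move=> [hr hi]; split; first by rewrite cReN; exact: (rev _ _ hr).
by rewrite cImN; exact: (rev _ _ hi).
Qed.

Lemma W_reflect f a b w : W f a b ->
  W (fun z => f (w - z)) (fun z => - a (w - z)) (fun z => - b (w - z)).
Proof.
have key v f' : dd v f f' -> dd v (fun z => f (w - z)) (fun z => - f' (w - z)).
  move=> hd z; have h := dd_line (w - z) (- 0) hd.
  have := cder_neg h; rewrite oppr0 rmorph0 mul0r addr0.
  by apply: cder_ext => s; congr f; rewrite rmorphN /=; ring.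
move=> [hx hy]; split=> z.
  by apply: cder_eq (key _ _ hx z) _; ring.
by apply: cder_eq (key _ _ hy z) _; ring.
Qed.

Lemma ccont_reflect f w : ccont f -> ccont (fun z => f (w - z)).
Proof.
move=> cf z e e0; have [d d0 Hd] := cf (w - z) e e0; exists d => // y hy.
apply: Hd; have -> : w - y - (w - z) = z - y by ring.
by rewrite nm_sub.
Qed.

Lemma supp_reflect M f w : suppP M f -> suppP (nm w + M) (fun z => f (w - z)).
Proof.
by move=> hs z hz; apply: hs; have := nm_le_dist z w; rewrite nm_sub; lra.
Qed.

(** For |w| <= N the product lives in |z| <= |N| + |M|. A Gaussian majorant uniform in w is what
    integrability and differentiation under the integral both require. *)
Lemma conv_bound M g f (N : R) : ccont g -> ccont f -> suppP M f ->
  exists2 K : R, 0 <= K & forall w z, nm w <= N -> nm (g z * f (w - z)) <= K * expR (- 1 * nm z ^+ 2).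
Proof.
move=> cg cf sf; pose T := `|N| + `|M|.
have [Kg Kg0 Hg] := ccont_bounded cg T.
have [Kf Kf0 Hf] := ccont_bounded cf M.
exists (Kg * Kf * expR (T ^+ 2)); first by rewrite !mulr_ge0 ?expR_ge0.
move=> w z wN.
have [zM|zM] := lerP (nm (w - z)) M; last first.
  by rewrite sf// mulr0 nm0 !mulr_ge0 ?expR_ge0.
have zT : nm z <= T.
  have := nm_le_dist z w; rewrite nm_sub /T.
  by have := ler_norm N; have := ler_norm M; lra.
rewrite -mulrA -expRD -[leLHS]mulr1 nmM ler_pM ?mulr_ge0 ?nm_ge0//.
  by rewrite ler_pM ?nm_ge0//; [exact: Hg|exact: Hf].
rewrite -[leLHS]expR0 ler_expR mulN1r subr_ge0 ler_sqr ?nnegrE ?nm_ge0//.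
exact: le_trans (nm_ge0 z) zT.
Qed.

Definition conv g f : C -> C := fun w => cintegral (fun z => g z * f (w - z)).

Lemma conv_cint M g f w : ccont g -> ccont f -> suppP M f -> cint (fun z => g z * f (w - z)).
Proof.
move=> cg cf sf; have [K K0 HK] := conv_bound (nm w) cg cf sf.
apply: (@bnd_cint R (- 1)); first by lra.
  by apply: ccontM => //; exact: ccont_reflect.
by exists K => z; exact: HK.
Qed.

Lemma rint_gauss1 (K : R) : rint (fun z : C => K * expR (- 1 * nm z ^+ 2)).
Proof. by apply: rintZ; exact: rint_gauss. Qed.

(** All derivatives fall on the compactly supported [f], so [g] need only be continuous. *)
Lemma dd_conv M v g f f' : ccont g -> ccont f -> ccont f' -> suppP M f ->
  dd v f f' -> dd v (conv g f) (conv g f').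
Proof.
move=> cg cf cf' sf df w; have sf' := dd_supp df sf.
have [K K0 HK] := conv_bound (nm w + nm v) cg cf' sf'.
have h1 : - 1 < (0 : R) < 1 by apply/andP; split; lra.
pose P (t : R) z := g z * f (w + t%:C * v - z).
pose dP (t : R) z := g z * f' (w + t%:C * v - z).
have E : conv g f' w = cintegral (dP 0).
  by congr cintegral; apply/funext => z; rewrite /dP rmorph0 mul0r addr0.
rewrite E; apply: (@cder_cintegral R P dP _ (-1) 1 0 h1 _ _ _ (rint_gauss1 K)).
- by move=> s _; exact: conv_cint cg cf sf.
- move=> s z _; have h2 := dd_line (w - z) s df.
  have := cderM (cder_cst (g z) s) h2; rewrite mul0r add0r /dP.
  have e t : w - z + t%:C * v = w + t%:C * v - z by ring.
  by rewrite e; apply: cder_ext => t; rewrite e.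
- move=> s z /andP[s1 s2]; apply: HK; apply: (le_trans (nmD _ _)); rewrite lerD2l.
  by rewrite nmM nm_real ler_piMl ?nm_ge0// ler_norml; lra.
Qed.

Lemma convD M g f1 f2 : ccont g -> ccont f1 -> ccont f2 -> suppP M f1 -> suppP M f2 ->
  conv g (fun z => f1 z + f2 z) = fun w => conv g f1 w + conv g f2 w.
Proof.
move=> cg c1 c2 s1 s2; apply/funext => w; rewrite /conv.
rewrite -cintegralD; [|exact: conv_cint s1|exact: conv_cint s2].
by congr cintegral; apply/funext => z; rewrite mulrDr.
Qed.

Lemma convZ M c g f : ccont g -> ccont f -> suppP M f ->
  conv g (fun z => c * f z) = fun w => c * conv g f w.
Proof.
move=> cg cf sf; apply/funext => w; rewrite /conv.
rewrite -cintegralZ; last exact: conv_cint sf.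
by congr cintegral; apply/funext => z; ring.
Qed.

Lemma W_conv M g f a b : ccont g -> ccont f -> ccont a -> ccont b -> suppP M f ->
  W f a b -> W (conv g f) (conv g a) (conv g b).
Proof.
move=> cg cf ca cb sf wf; have [sa sb] := W_supp wf sf; have [hx hy] := wf.
have cNb : ccont (fun z => -1 * b z) by exact: ccontZ.
have sNb : suppP M (fun z => -1 * b z) by move=> z hz; rewrite sb// mulr0.
have E : (fun z => 'i * (a z - b z)) = (fun z => 'i * (a z + -1 * b z)).
  by apply/funext => z; rewrite mulN1r.
have cx : ccont (fun z => a z + b z) by exact: ccontD.
have cy : ccont (fun z => 'i * (a z - b z)).
  by rewrite E; apply: ccontZ; exact: ccontD.
split.
  by have := dd_conv cg cf cx sf hx; rewrite (convD cg ca cb sa sb).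
have := dd_conv cg cf cy sf hy; rewrite E.
rewrite (convZ (M := M)) //; last 2 first.
  by apply: ccontD.
  by apply: suppD.
rewrite (convD cg ca cNb sa sNb) (convZ (-1) cg cb sb).
by under eq_fun do rewrite mulN1r.
Qed.

Lemma conv_smooth M g f : ccont g -> smoothW f -> suppP M f -> smoothW (conv g f).
Proof.
move=> cg sm sf k.
have main f' : smoothW f' -> suppP M f' -> W (conv g f') (conv g (dz f')) (conv g (dzbar f')) /\ ccont (conv g f').
  move=> sm' sf'; have w1 := GWW (sm' 1%N); have [sa sb] := W_supp w1 sf'.
  have [_ _ [_ [h1 _ _] [h2 _ _]]] := sm' 1%N.
  have wc := W_conv cg (GW_cont (sm' 0%N)) h1 h2 sf' w1.
  split => //; apply: (W_ccont wc) => N.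
  have [K K0 HK] := conv_bound N cg h1 sa.
  have [L L0 HL] := conv_bound N cg h2 sb.
  exists (Num.max (2 * rI (fun z : C => K * expR (- 1 * nm z ^+ 2)))
    (2 * rI (fun z : C => L * expR (- 1 * nm z ^+ 2)))) => z zN; rewrite !le_max; split.
    apply/orP; left; apply: (cintegral_bound _ (rint_gauss1 K)).
      exact: conv_cint cg h1 sa.
    by move=> y; exact: HK.
  apply/orP; right; apply: (cintegral_bound _ (rint_gauss1 L)).
    exact: conv_cint cg h2 sb.
  by move=> y; exact: HL.
elim: k f sm sf => [|k IH] f sm sf; have [wc cc] := main f sm sf; first by split.
have [sa sb] := W_supp (GWW (sm 1%N)) sf.
apply: (GW_W wc) => //; apply: IH => // j; by have [_ _ []] := sm j.+1.
Qed.

(** * Smoothness by averaging *)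

(** The square [0, 1/2]^2 lies in the disc |z|^2 <= 1/2 and has area 1/4, so the integral is at
    least m/4. *)
Lemma rI_gt0 (q : C -> R) (m : R) : rint q -> (forall z, 0 <= q z) -> 0 < m ->
  (forall z, nm z ^+ 2 <= 2^-1 -> m <= q z) -> 0 < rI q.
Proof.
move=> iq q0 m0 hm.
pose I : set R := `[0, 2^-1]%classic.
pose B : set M2 := I `*` I.
have mI : measurable (I : set M1) by exact: measurable_itv.
have mB : measurable B by exact: measurableX.
have muI : mu1 I = (2^-1 : R)%:E.
  by rewrite /I lebesgue_measure_itv /= lte_fin invr_gt0 ltr0n/= sube0.
have muB : mu2 B = ((2^-1 * 2^-1 : R)%:E).
  transitivity (mu1 I * mu1 I)%E; first exact: product_measure1E.
  by rewrite muI -EFinM.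
have mq : measurable_fun [set: M2] (fun p => (q (ofxy p))%:E) by exact: (measurable_int mu2 iq).
rewrite -lte_fin; apply: (@lt_le_trans _ _ ((m * (2^-1 * 2^-1))%:E)).
  by rewrite lte_fin !mulr_gt0.
rewrite /rI /Rintegral fineK; last exact: (integrable_fin_num measurableT iq).
apply: (@le_trans _ _ (\int[mu2]_(p in B) (q (ofxy p))%:E)%E); last first.
  by apply: ge0_subset_integral => // p _; rewrite lee_fin.
rewrite EFinM -muB -integral_cst//; apply: ge0_le_integral => //.
- by move=> p _; rewrite lee_fin ltW.
- exact: measurable_funTS.
- move=> [x y] []; rewrite /= /I /= !in_itv /= => /andP[x0 x1] /andP[y0 y1].
  rewrite lee_fin hm// nm_sqr /=.
  have : x * x <= 2^-1 * 2^-1 by rewrite ler_pM.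
  have : y * y <= 2^-1 * 2^-1 by rewrite ler_pM.
  have -> : (2^-1 * 2^-1 : R) = 4^-1 by field.
  by rewrite !expr2; lra.
Qed.

Lemma bump_pos : 0 < Re (cintegral (cbump 1 2)).
Proof.
have ib : cint (cbump 1 2).
  have := conv_cint 0 (ccont_cst 1) (@bump_cont 1 2) (@supp_bump 1 2 ltr01).
  congr cint; apply/funext => z; rewrite mul1r sub0r /cbump nmN //.
have [ir _] := ib.
(* On the disc, x = 1 - |z|^2 lies in [1/2, 1], so x^(-2) >= 1 and e^(-1/x) >= e^(-2). *)
apply: (@rI_gt0 _ (expR (- 2)) ir) => [z||z hz].
- exact: flat_exp_ge0.
- exact: expR_gt0.
rewrite /= /flat_exp; set x := 1 - 1 * _.
have n0 := sqr_ge0 (nm z).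
have x1 : 2^-1 <= x by rewrite /x; lra.
have x2 : x <= 1 by rewrite /x; lra.
have x0 : 0 < x by lra.
rewrite x0; have xi1 : 1 <= x^-1 by rewrite invf_ge1.
have xi2 : x^-1 <= 2 by rewrite -[leRHS]invrK lef_pV2// posrE.
rewrite -[leLHS]mul1r ler_pM//.
  by rewrite -(expr1n _ 2) ler_sqr ?nnegrE// ltW// invr_gt0.
by rewrite ler_expR lerN2.
Qed.

(** Translation invariance of the integral of the bump: as a function of w it has zero Wirtinger
    derivatives, since derivatives of a compactly supported function integrate to 0. *)
Lemma conv1_cst w : conv (fun=> 1) (cbump 1 2) w = conv (fun=> 1) (cbump 1 2) 0.
Proof.
set f := cbump 1 2; set V := conv (fun=> 1) f.
have sf : suppP (1^-1 + 1) f by exact: supp_bump.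
have sm := @smooth_bump 1 2; have w1 := GWW (sm 1%N); rewrite -/f in w1.
have [sa sb] := W_supp w1 sf; have [_ _ [_ [ca _ _] [cb _ _]]] := sm 1%N.
have cf : ccont f by exact: bump_cont.
have cg := @ccont_cst R 1.
have wc := W_conv cg cf ca cb sf w1.
have z0 y : conv (fun=> 1) (dz f) y = 0 /\ conv (fun=> 1) (dzbar f) y = 0.
  have cN p : ccont p -> ccont (fun z => - p (y - z)).
    move=> /(ccont_reflect y)/(ccontZ (-1)).
    by congr ccont; apply/funext => z; rewrite mulN1r.
  have sN p : suppP (1^-1 + 1) p -> suppP (nm y + (1^-1 + 1)) (fun z => - p (y - z)).
    by move=> sp z hz; rewrite (supp_reflect sp hz) oppr0.
  have n1 : (-1 : R) < 0 by lra.
  have [] := cintegral_W n1 (W_reflect y w1) (cN _ ca) (cN _ cb)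
    (supp_bnd _ (supp_reflect sf) (ccont_reflect y cf))
    (supp_bnd _ (sN _ sa) (cN _ ca)) (supp_bnd _ (sN _ sb) (cN _ cb)).
  have E p : suppP (1^-1 + 1) p -> ccont p -> cintegral (fun z => - p (y - z)) = - conv (fun=> 1) p y.
    move=> sp cp; rewrite /conv -mulN1r -cintegralZ; last exact: conv_cint cg cp sp.
    by congr cintegral; apply/funext => z; rewrite mul1r mulN1r.
  by rewrite !E// => /eqP; rewrite oppr_eq0 => /eqP -> /eqP; rewrite oppr_eq0 => /eqP ->.
have := @W_MVT R V _ _ 0 w 0 wc; rewrite add0r mulr0 mul0r => H.
apply/eqP; rewrite -subr_eq0; apply/eqP; apply: nm_eq0; apply/eqP.
rewrite eq_le nm_ge0 andbT; apply: H => y _.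
by have [-> ->] := z0 y; rewrite nm0.
Qed.

(** By the mean value property for the radial bump, convolution with it multiplies [g] by the
    nonzero constant [c0]; and a convolution with a smooth bump is smooth. *)
Lemma C2_holomorphic_smooth g g1 g2 : cdiff g g1 -> cdiff g1 g2 -> ccont g2 -> smoothW g.
Proof.
move=> dg dg1 cg2; have cg := cdiff_ccont dg; have cg1 := cdiff_ccont dg1.
pose V := conv g (cbump 1 2).
pose c0 := conv (fun=> 1) (cbump 1 2) 0.
have c0n : c0 != 0.
  have E : cintegral (cbump 1 2) = c0.
    by rewrite /c0 /conv; congr cintegral; apply/funext => z; rewrite mul1r sub0r /cbump nmN.
  by apply/eqP => h; have := bump_pos; rewrite E h ltxx.
have s2 j : suppP 2 (cbump 1 j : C -> C).
  by have := @supp_bump 1 j ltr01; rewrite invr1.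
have key w : V w = g w * c0.
  (* The index 2 and the sign come from differentiating [cbump 1 0 (w - z)], whose zbar-derivative
     is (z - w) [kap]. *)
  pose kap z := -1 * cbump 1 2 (w - z).
  pose K z := cbump 1 0 (w - z).
  pose M := nm w + 2.
  have cb j : ccont (fun z => cbump 1 j (w - z)) by apply: ccont_reflect; exact: bump_cont.
  have ck : ccont kap by exact: ccontZ.
  have wK0 := W_reflect w (W_bump 1 0).
  pose Kz z := - ((cbump 1 2 (w - z) + - 0%:R * cbump 1 1 (w - z)) * (- (1 : R)%:C * (w - z)^*)).
  have wK : W K Kz (fun z => (z - w) * kap z).
    apply: (W_eq wK0) => [//|z]; rewrite /kap rmorph1; ring.
  have cKz : ccont Kz.
    have cc : ccont (fun z => (w - z)^*) by apply: (ccont_reflect w (@ccont_conj R)).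
    have := ccontM (cb 2%N) cc; congr ccont; apply/funext => z.
    by rewrite /Kz rmorph1; ring.
  have sK j : suppP M (fun z => cbump 1 j (w - z)) by exact: supp_reflect.
  have sk : suppP M kap by move=> z hz; rewrite /kap sK// mulr0.
  have sKz : suppP M Kz.
    by move=> z hz; rewrite /Kz !(sK _ _ hz) mulr0 addr0 mul0r oppr0.
  have sw : suppP M (fun z => (z - w) * kap z) by move=> z hz; rewrite sk// mulr0.
  have cw : ccont (fun z => (z - w) * kap z).
    by apply: ccontM => //; exact: ccontD (@ccont_id R) (ccont_cst _).
  have [A HA] : exists A, forall p q, p = g \/ p = g1 \/ p = g2 ->
     q = kap \/ q = K \/ q = Kz \/ q = (fun z => (z - w) * kap z) ->
     forall (s : R) z, - 1 < s < 1 + 1 ->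
     nm (p (w + s%:C * (z - w))) * nm (q z) <= A * expR (- 1 * nm z ^+ 2).
    have pb p : ccont p -> exists2 A : R, 0 <= A & forall (s : R) z, - 1 < s < 1 + 1 -> nm z <= M ->
        nm (p (w + s%:C * (z - w))) <= A.
      move=> cp; have [A A0 HA] := ccont_bounded cp (nm w + 2 * (M + nm w)).
      exists A => // s z /andP[s1 s3] zM; apply: HA; apply: (le_trans (nmD _ _)).
      rewrite lerD2l nmM nm_real ler_pM ?nm_ge0//; first by rewrite ler_norml; lra.
      by apply: (le_trans (nmB _ _)); rewrite lerD2r.
    have qb q : ccont q -> suppP M q -> exists2 A : R, 0 <= A & forall z, nm (q z) <= A * expR (- 1 * nm z ^+ 2).
      by move=> cq sq; apply: bndK; exact: supp_bnd sq cq.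
    have [A1 A10 H1] := pb _ cg; have [A2 A20 H2] := pb _ cg1; have [A3 A30 H3] := pb _ cg2.
    have [B1 B10 J1] := qb _ ck sk; have [B2 B20 J2] := qb _ (cb 0%N) (sK 0%N).
    have [B3 B30 J3] := qb _ cKz sKz; have [B4 B40 J4] := qb _ cw sw.
    exists ((A1 + A2 + A3) * (B1 + B2 + B3 + B4)) => p q hp hq s z hs.
    have e0 := expR_gt0 (- 1 * nm z ^+ 2).
    have qz : nm (q z) <= (B1 + B2 + B3 + B4) * expR (- 1 * nm z ^+ 2).
      by case: hq => [->|[->|[->|->]]];
        [apply: (le_trans (J1 z))|apply: (le_trans (J2 z))|apply: (le_trans (J3 z))|apply: (le_trans (J4 z))];
        rewrite ler_pM2r//; lra.
    have q0 : M < nm z -> q z = 0.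
      by case: hq => [->|[->|[->|->]]]; [exact: sk|exact: (sK 0%N)|exact: sKz|exact: sw].
    have [zM|zM] := lerP (nm z) M; last first.
      rewrite q0// nm0 mulr0 mulr_ge0 ?expR_ge0//.
      by rewrite mulr_ge0//; lra.
    rewrite -mulrA ler_pM ?nm_ge0//.
    by case: hp => [->|[->|->]]; [apply: (le_trans (H1 s z hs zM))|
       apply: (le_trans (H2 s z hs zM))|apply: (le_trans (H3 s z hs zM))]; lra.
  have n1 : (-1 : R) < 0 by lra.
  have ik : cint kap.
    by apply: (bnd_cint n1 ck); exact: supp_bnd sk ck.
  have := kernel_mean_value n1 ltr01 dg dg1 cg2 ck ik wK (cb 0%N) cKz HA.
  have -> : (fun z => g z * kap z) = (fun z => -1 * (g z * cbump 1 2 (w - z))).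
    by apply/funext => z; rewrite /kap; ring.
  have cbb : ccont (cbump 1 2 : C -> C) by exact: bump_cont.
  rewrite cintegralZ; last exact: conv_cint cg cbb (s2 2%N).
  have -> : cintegral kap = -1 * c0.
    rewrite /c0 -(conv1_cst w) /conv -cintegralZ; last exact: conv_cint (ccont_cst 1) cbb (s2 2%N).
    by congr cintegral; apply/funext => z; rewrite mul1r.
  by rewrite !mulN1r mulrN => /oppr_inj.
have -> : g = fun w => c0^-1 * V w.
  by apply/funext => w; rewrite key mulrC mulfK.
have sV := conv_smooth cg (@smooth_bump 1 2) (s2 2%N).
by move=> k; apply: GWT_M; [exact: GW_cst|exact: sV].
Qed.

(** * Symmetry of mixed derivatives *)

Lemma cderB p q (t : R) (l m : C) : cder p t l -> cder q t m ->
  cder (fun s => p s - q s) t (l - m).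
Proof.
move=> h1 h2; have h3 := cderD h1 (cderM (cder_cst (-1) t) h2).
apply: cder_ext (cder_eq h3 _) => [r|]; first by rewrite mulN1r.
by rewrite mul0r add0r mulN1r.
Qed.

(** Two applications of [cder_MVT], first along [v2] to [f1], then along [v1] to the increment of
    [f]; each brings a factor 2, hence 4 e. *)
Lemma second_difference (v1 v2 : C) f f1 f12 z (e : R) : nm v1 <= 1 -> nm v2 <= 1 ->
  dd v1 f f1 -> dd v2 f1 f12 -> ccont f12 -> 0 < e ->
  exists2 d : R, 0 < d & forall t : R, 0 < t < d ->
    nm (f (z + t%:C * v1 + t%:C * v2) - f (z + t%:C * v1) - f (z + t%:C * v2) + f z
        - (t ^+ 2)%:C * f12 z) <= 4 * e * t ^+ 2.
Proof.
move=> n1 n2 d1 d2 c12 e0; have [d d0 Hd] := c12 z e e0.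
exists (d / 2) => [|t /andP[t0 td]]; first by rewrite divr_gt0.
have small s r : 0 <= s <= t -> 0 <= r <= t -> nm (f12 (z + s%:C * v1 + r%:C * v2) - f12 z) <= e.
  move=> /andP[s1 s2] /andP[r1 r2]; apply/ltW/Hd.
  rewrite -(addrA z) (addrC z) addrK; apply: (le_lt_trans (nmD _ _)).
  rewrite !nmM !nm_real !ger0_norm//.
  have : s * nm v1 <= s by rewrite ler_piMr.
  have : r * nm v2 <= r by rewrite ler_piMr.
  lra.
have inner s : 0 <= s <= t ->
    nm (f1 (z + s%:C * v1 + t%:C * v2) - f1 (z + s%:C * v1) - t%:C * f12 z) <= 2 * e * t.
  move=> hs.
  have := @cder_MVT (fun r => f1 (z + s%:C * v1 + r%:C * v2) - r%:C * f12 z)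
    (fun r => f12 (z + s%:C * v1 + r%:C * v2) - f12 z) 0 t e (ltW t0).
  rewrite rmorph0 !mul0r !addr0 !subr0 => H.
  rewrite addrAC; apply: H => [r|r hr]; last exact: small.
  apply: cderB; first exact: dd_line.
  by apply: cder_eq (cderM (cder_id r) (cder_cst (f12 z) r)) _; rewrite mul1r mulr0 addr0.
have := @cder_MVT (fun s => (f (z + t%:C * v2 + s%:C * v1) - f (z + s%:C * v1)) - s%:C * (t%:C * f12 z))
  (fun s => (f1 (z + t%:C * v2 + s%:C * v1) - f1 (z + s%:C * v1)) - t%:C * f12 z)
  0 t (2 * e * t) (ltW t0).
rewrite rmorph0 !mul0r !addr0 !subr0 => H.
rewrite (_ : f (z + t%:C * v1 + t%:C * v2) - f (z + t%:C * v1) - f (z + t%:C * v2) + f z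
    - (t ^+ 2)%:C * f12 z = f (z + t%:C * v2 + t%:C * v1) - f (z + t%:C * v1) -
     t%:C * (t%:C * f12 z) - (f (z + t%:C * v2) - f z)); last first.
  by rewrite (addrAC z) rmorphXn /=; ring.
rewrite (_ : 4 * e * t ^+ 2 = 2 * (2 * e * t) * t); last by ring.
apply: H => [s|s hs].
  apply: cderB; first by apply: cderB; exact: dd_line.
  apply: cder_eq (cderM (cder_id s) (cder_cst (t%:C * f12 z) s)) _.
  by rewrite mul1r mulr0 addr0.
by rewrite (addrAC z); exact: inner.
Qed.

(** The second difference is symmetric in the two directions and approximates t^2 times either mixed
    derivative; each error 4 (e/8) t^2 is half of e t^2. *)
Lemma mixed_derivatives (v1 v2 : C) f f1 f2 f12 f21 : nm v1 <= 1 -> nm v2 <= 1 ->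
  dd v1 f f1 -> dd v2 f1 f12 -> ccont f12 -> dd v2 f f2 -> dd v1 f2 f21 -> ccont f21 ->
  f12 =1 f21.
Proof.
move=> n1 n2 d1 d12 c12 d2 d21 c21 z.
apply/eqP; rewrite -subr_eq0; apply/eqP/nm_eq0/eqP; rewrite eq_le nm_ge0 andbT.
apply/ler_addgt0Pl => e e0; rewrite addr0.
have e8 : 0 < e / 8 by rewrite divr_gt0.
have [da da0 Ha] := second_difference z n1 n2 d1 d12 c12 e8.
have [db db0 Hb] := second_difference z n2 n1 d2 d21 c21 e8.
pose t := Num.min da db / 2.
have m0 : 0 < Num.min da db by rewrite lt_min da0.
have t0 : 0 < t by rewrite divr_gt0.
have tm : t < Num.min da db by rewrite ltr_pdivrMr// ltr_pMr// ltr1n.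
move: tm; rewrite lt_min => /andP[ta tb].
have := Ha t; rewrite t0 ta => /(_ isT) h1.
have := Hb t; rewrite t0 tb => /(_ isT) h2.
have t2 : 0 < t ^+ 2 by rewrite exprn_gt0.
rewrite -(ler_pM2l t2) -[X in X * nm _ <= _](ger0_norm (ltW t2)) -nm_real -nmM.
move: h1 h2; set A := _ - _ * f12 z; set B := _ - _ * f21 z => h1 h2.
rewrite (_ : _ * (f12 z - f21 z) = B - A); last first.
  by rewrite /A /B (addrAC z (t%:C * v2)); ring.
apply: (le_trans (nmB _ _)); apply: (le_trans (lerD h2 h1)).
by rewrite le_eqVlt; apply/orP; left; apply/eqP; field.
Qed.

(** The two mixed real derivatives differ by 2i times the commutator of d_z and d_zbar. *)
Lemma dzbar_dz f : GW (fun=> True) 2 f -> dzbar (dz f) = dz (dzbar f).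
Proof.
move=> [_ _ [w [_ _ [wa [caa _ _] [cab _ _]]] [_ _ [wb [cba _ _] [cbb _ _]]]]].
have [fx fy] := w; have [ax ay] := wa; have [bx by'] := wb.
have addd v p q p' q' : dd v p p' -> dd v q q' -> dd v (fun z => p z + q z) (fun z => p' z + q' z).
  by move=> h1 h2 z; exact: cderD.
have scal v (c : C) p p' : dd v p p' -> dd v (fun z => c * p z) (fun z => c * p' z).
  by move=> h1 z; apply: cder_eq (cderM (cder_cst c 0) (h1 z)) _; rewrite mul0r add0r.
set aa := dz (dz f) in wa ax ay caa; set ab := dzbar (dz f) in wa ax ay cab *.
set ba := dz (dzbar f) in wb bx by' cba *; set bb := dzbar (dzbar f) in wb bx by' cbb.
have fxy := addd _ _ _ _ _ ay by'.
have fyx : dd 1 (fun z => 'i * (dz f z + -1 * dzbar f z))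
    (fun z => 'i * (aa z + ab z + -1 * (ba z + bb z))).
  exact: (scal _ _ _ _ (addd _ _ _ _ _ ax (scal _ (-1) _ _ bx))).
have fy' : dd 'i f (fun z => 'i * (dz f z + -1 * dzbar f z)).
  by move=> z; apply: cder_eq (fy z) _; rewrite mulN1r.
have n1 : nm (1 : C) <= 1 by rewrite ComplexField.Normc.normc1.
have ni : nm ('i : C) <= 1 by rewrite nm_i.
have cNab (c : C) p q : ccont p -> ccont q -> ccont (fun z => 'i * (p z + c * q z)).
  by move=> cp cq; apply/ccontZ/ccontD => //; exact: ccontZ.
have c1 : ccont (fun z => 'i * (aa z - ab z) + 'i * (ba z - bb z)).
  have := ccontD (cNab (-1) _ _ caa cab) (cNab (-1) _ _ cba cbb).
  by congr ccont; apply/funext => z; rewrite !mulN1r.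
have c2 : ccont (fun z => 'i * (aa z + ab z + -1 * (ba z + bb z))).
  by apply: cNab; exact: ccontD.
have := mixed_derivatives n1 ni fx fxy c1 fy' fyx c2 => E.
apply/funext => z; have := E z => /= Ez.
have i2 : 2%:R * 'i != 0 :> C.
  by rewrite mulf_eq0 pnatr_eq0 neq_i0.
apply: (mulfI i2); apply/eqP; rewrite -subr_eq0.
have /eqP := Ez; rewrite eq_sym -subr_eq0 => /eqP <-; apply/eqP; ring.
Qed.

(** A repeated primitive of [h] has the continuous derivatives that the averaging argument asks for,
    so it is smooth; smoothness then descends by differentiation to [h]. The derivative is again
    entire because d_z and d_zbar commute. *)
Lemma entire_smooth h : entire h -> exists h', [/\ cdiff h h', entire h' & smoothW h].
Proof.
move=> /entireP[h' dh].
have [H1 d1 c1] := entire_primitive dh.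
have [H2 d2 c2] := entire_primitive d1.
have [H3 d3 c3] := entire_primitive d2.
have ch := cdiff_ccont dh.
have s3 := C2_holomorphic_smooth d3 d2 c1.
have sd f f' : cdiff f f' -> smoothW f -> smoothW f'.
  by move=> df sf k; have [_ _ [_ + _]] := sf k.+1; rewrite (Wdz (cdiff_W df)).
have s2 := sd _ _ d3 s3; have s1 := sd _ _ d2 s2; have s0 := sd _ _ d1 s1.
exists h'; split => //; have s' := sd _ _ dh s0.
have [_ _ [wh' [ch' _ _] [ch'' _ _]]] := s' 1%N.
apply/entireP; exists (dz h'); apply: W_cdiff => //.
rewrite (_ : (fun=> 0) = dzbar h') //.
rewrite -(Wdz (cdiff_W dh)) dzbar_dz; last exact: s0.
by rewrite (Wdzbar (cdiff_W dh)) (Wdz (W_cst 0)).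
Qed.
End Cauchy.

(** * The Landau levels *)

Section LandauLevels.
Variable R : realType.
Local Notation C := R[i].
Local Notation nm := (@ComplexField.Normc.normc R).
Local Notation Re := (@complex.Re R).
Local Notation Im := (@complex.Im R).
Implicit Types (f g h u : C -> C) (z w t : C).

(** * The exponential weights *)

Lemma cexpD z w : cexp (z + w) = cexp z * cexp w.
Proof. by rewrite !cexpE cReD cImD expRD cosD sinD; simpc; congr (_ +i* _); ring. Qed.

Lemma cexp0 : cexp (0 : C) = 1.
Proof. by rewrite cexpE /= expR0 cos0 sin0 mulr1 mulr0. Qed.

Lemma nm_cexp z : nm (cexp z) = expR (Re z).
Proof.
rewrite /cexp nmM nm_real ger0_norm ?expR_ge0//= cos2Dsin2 sqrtr1 mulr1 //.
Qed.

Lemma normC_sq z : `|z| ^+ 2 = z * z^*.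
Proof. by rewrite normC_nm conj_nm rmorphXn. Qed.

Lemma Re_divn z n : Re (z / n%:R) = Re z / n%:R.
Proof.
have -> : (n%:R : C)^-1 = (n%:R^-1 : R)%:C by rewrite fmorphV rmorph_nat.
by rewrite cReM /= mulr0 subr0.
Qed.

Definition gauss z : C := cexp (- (z * z^* / 2%:R)).
(** [lam] carries f to u; its inverse [laminv] is the exponential prefactor in [true_polyRBF]. *)
Definition lam z : C := cexp (z ^+ 2 / 4%:R - z * z^* / 2%:R).
Definition laminv z : C := cexp (z * z^* / 2%:R - z ^+ 2 / 4%:R).

Lemma lamK z : laminv z * lam z = 1.
Proof. by rewrite /lam /laminv -cexpD (_ : _ + _ = 0) ?cexp0//; ring. Qed.

Lemma nm_gauss z : nm (gauss z) = expR (- 2^-1 * nm z ^+ 2).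
Proof. by rewrite nm_cexp cReN Re_divn conj_nm /=; congr expR; field. Qed.

(** Since Re(z^2)/2 - |z|^2/2 = -y^2: the weighted norm of f is the radially weighted norm of f
    [lam]. *)
Lemma nm_lam_sq z : nm (lam z) ^+ 2 * expR (2^-1 * nm z ^+ 2) = expR (- Im z ^+ 2).
Proof.
rewrite nm_cexp -expRM_natl -expRD cReD cReN !Re_divn conj_nm /= nm_sqr.
by congr expR; rewrite expr2 cReM; field.
Qed.

Lemma W_half : W (fun z => z / 2%:R : C) (fun=> 2%:R^-1) (fun=> 0).
Proof.
have := WZ (2%:R^-1) (W_id R); under eq_fun do rewrite mulrC.
by move/W_eq; apply => z; rewrite ?mulr1 ?mulr0.
Qed.

Lemma W_conj_half : W (fun z => z^* / 2%:R : C) (fun=> 0) (fun=> 2%:R^-1).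
Proof.
have := WZ (2%:R^-1) (W_conj R); under eq_fun do rewrite mulrC.
by move/W_eq; apply => z; rewrite ?mulr1 ?mulr0.
Qed.

Lemma W_gauss : W gauss (fun z => - (z^* / 2%:R) * gauss z) (fun z => - (z / 2%:R) * gauss z).
Proof.
have h := WZ (-1) (WM (W_id R) W_conj_half).
have e : (fun z => -1 * (z * (z^* / 2%:R))) = (fun z : C => - (z * z^* / 2%:R)).
  by apply/funext => z; rewrite mulN1r mulrA.
rewrite e in h; apply: (W_eq (W_exp h)) => z /=; rewrite -/(gauss z); ring.
Qed.

Lemma W_lam : W lam (fun z => (z / 2%:R - z^* / 2%:R) * lam z) (fun z => - (z / 2%:R) * lam z).
Proof.
have h := WD (WZ (4%:R^-1) (WM (W_id R) (W_id R))) (WZ (-1) (WM (W_id R) W_conj_half)).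
have e : (fun z => 4%:R^-1 * (z * z) + -1 * (z * (z^* / 2%:R))) =
    (fun z : C => z ^+ 2 / 4%:R - z * z^* / 2%:R).
  by apply/funext => z; rewrite expr2; ring.
rewrite e in h; apply: (W_eq (W_exp h)) => z /=; rewrite -/(lam z); by field.
Qed.

Lemma W_laminv : W laminv (fun z => (z^* / 2%:R - z / 2%:R) * laminv z)
  (fun z => (z / 2%:R) * laminv z).
Proof.
have h := WD (WZ (- 4%:R^-1) (WM (W_id R) (W_id R))) (WM (W_id R) W_conj_half).
have e : (fun z => - 4%:R^-1 * (z * z) + (z * (z^* / 2%:R))) =
    (fun z : C => z * z^* / 2%:R - z ^+ 2 / 4%:R).
  by apply/funext => z; rewrite expr2; ring.
rewrite e in h; apply: (W_eq (W_exp h)) => z /=; rewrite -/(laminv z); by field.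
Qed.

Lemma smoothW_eigen f p q : ccont f -> W f (fun z => p z * f z) (fun z => q z * f z) ->
  smoothW p -> smoothW q -> smoothW f.
Proof.
move=> cf wf sp sq; elim => [|k IH]; first by split.
by apply: (GW_W wf) => //; apply: GWT_M.
Qed.

Lemma smoothW_cst c : smoothW (fun=> c : C).
Proof. by move=> k; exact: GW_cst. Qed.

Lemma smoothWD f g : smoothW f -> smoothW g -> smoothW (fun z => f z + g z).
Proof. by move=> hf hg k; apply: GWT_D. Qed.

Lemma smoothWZ c f : smoothW f -> smoothW (fun z => c * f z).
Proof. exact: smoothWM (smoothW_cst c). Qed.

Lemma smoothW_half : smoothW (fun z => z / 2%:R : C).
Proof. by apply: smoothWM (smoothW_cst _); exact: ord_smooth (@ord_id R). Qed.

Lemma smoothW_conj_half : smoothW (fun z => z^* / 2%:R : C).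
Proof. by apply: smoothWM (smoothW_cst _); exact: ord_smooth (@ord_conj R). Qed.

Lemma smoothW_cont f : smoothW f -> ccont f.
Proof. by move=> /(_ 0%N) /GW_cont. Qed.

Lemma smoothW_dz f : smoothW f -> smoothW (dz f).
Proof. by move=> hf k; have [_ _ []] := hf k.+1. Qed.

Lemma smoothW_dzbar f : smoothW f -> smoothW (dzbar f).
Proof. by move=> hf k; have [_ _ []] := hf k.+1. Qed.

Lemma smoothW_W f : smoothW f -> W f (dz f) (dzbar f).
Proof. by move=> /(_ 1%N) /GWW. Qed.

Lemma gauss_cont : ccont gauss.
Proof.
apply: ccont_exp; have := ccontZ (-1) (ccontM (@ccont_id R) (ccontM (@ccont_conj R) (ccont_cst 2%:R^-1))).
by congr ccont; apply/funext => z; ring.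
Qed.

Lemma lam_cont : ccont lam.
Proof.
apply: ccont_exp.
have := ccontD (ccontM (ccontX 2 (@ccont_id R)) (ccont_cst 4%:R^-1))
  (ccontZ (-1) (ccontM (@ccont_id R) (ccontM (@ccont_conj R) (ccont_cst 2%:R^-1)))).
by congr ccont; apply/funext => z; ring.
Qed.

Lemma laminv_cont : ccont laminv.
Proof.
apply: ccont_exp.
have := ccontD (ccontZ (-1) (ccontM (ccontX 2 (@ccont_id R)) (ccont_cst 4%:R^-1)))
  (ccontM (@ccont_id R) (ccontM (@ccont_conj R) (ccont_cst 2%:R^-1))).
by congr ccont; apply/funext => z; ring.
Qed.

Lemma smooth_gauss : smoothW gauss.
Proof.
apply: (smoothW_eigen gauss_cont W_gauss).
  by have := smoothWZ (-1) smoothW_conj_half; under eq_fun do rewrite mulN1r.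
by have := smoothWZ (-1) smoothW_half; under eq_fun do rewrite mulN1r.
Qed.

Lemma smooth_lam : smoothW lam.
Proof.
apply: (smoothW_eigen lam_cont W_lam).
  have := smoothWD smoothW_half (smoothWZ (-1) smoothW_conj_half).
  by congr smoothW; apply/funext => z; rewrite mulN1r.
by have := smoothWZ (-1) smoothW_half; under eq_fun do rewrite mulN1r.
Qed.

Lemma smooth_laminv : smoothW laminv.
Proof.
apply: (smoothW_eigen laminv_cont W_laminv) smoothW_half.
have := smoothWD smoothW_conj_half (smoothWZ (-1) smoothW_half).
by congr smoothW; apply/funext => z; rewrite mulN1r.
Qed.

(** * Integrability against the radial weight *)

Definition L2gauss u := cmeasurable u /\
  rint (fun z => nm (u z) ^+ 2 * expR (2^-1 * nm z ^+ 2)).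

Lemma meas_nm u : cmeasurable u -> measurable_fun [set: measurableTypeR R * measurableTypeR R]
  (fun p => nm (u (ofxy p))).
Proof.
move=> [ur ui].
have -> : (fun p => nm (u (ofxy p))) = (fun p : measurableTypeR R * measurableTypeR R =>
    Num.sqrt (Re (u (ofxy p)) ^+ 2 + Im (u (ofxy p)) ^+ 2)).
  by apply/funext => p; case: (u _).
have ms := continuous_measurable_fun (@sqrt_continuous R).
apply: (measurableT_comp ms).
by apply: measurable_funD; apply: measurable_funX.
Qed.

Lemma L2w_L2gauss f : L2w f -> L2gauss (fun z => f z * lam z).
Proof.
move=> [mf If]; have mu' : cmeasurable (fun z => f z * lam z).
  by apply: cmeasM => //; apply: ccont_meas; exact: lam_cont.
split => //; apply/integrableP; split.
  apply/measurable_EFinP/measurable_funM.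
    by have := measurable_funX 2 (meas_nm mu').
  exact: meas_gauss.
apply: le_lt_trans If; rewrite le_eqVlt; apply/orP; left; apply/eqP.
apply: eq_integral => p _ /=; rewrite ger0_norm; last by rewrite mulr_ge0 ?sqr_ge0 ?expR_ge0.
rewrite nmM exprMn -mulrA nm_lam_sq.
by have [_ ->] := weightE (ofxy p).
Qed.

(** Split the integrand as x y with x = |u| e^(|z|^2/4), square integrable, and y = e^((a -
    1/4)|z|^2), a decaying Gaussian; then x y <= x^2 + y^2. *)
Lemma L2gauss_rint u (a : R) : L2gauss u -> a < 4^-1 ->
  rint (fun z => nm (u z) * expR (a * nm z ^+ 2)).
Proof.
move=> [mu' iu] a4.
have c0 : 0 < 2^-1 - 2 * a by lra.
apply: (rint_le _ (rintD iu (rint_gauss c0))).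
  by apply: measurable_funM; [exact: meas_nm|exact: meas_gauss].
move=> z; set r := nm z ^+ 2; rewrite ger0_norm ?mulr_ge0 ?nm_ge0 ?expR_ge0//.
set x := nm (u z) * expR (4^-1 * r); set y := expR ((a - 4^-1) * r).
have -> : nm (u z) * expR (a * r) = x * y.
  by rewrite /x /y -mulrA -expRD; congr (_ * expR _); ring.
have -> : nm (u z) ^+ 2 * expR (2^-1 * r) = x ^+ 2.
  by rewrite /x exprMn -expRM_natl; congr (_ * expR _); field.
have -> : expR (- (2^-1 - 2 * a) * r) = y ^+ 2.
  by rewrite /y -expRM_natl; congr expR; field.
have x0 : 0 <= x by rewrite mulr_ge0 ?nm_ge0 ?expR_ge0.
have y0 : 0 <= y by exact: expR_ge0.
have := sqr_ge0 (x - y); nra.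
Qed.

Lemma L2gauss_cint u g (a : R) : L2gauss u -> a < 4^-1 -> ccont g -> bnd a g ->
  cint (fun z => u z * g z).
Proof.
move=> hu a4 cg [K HK]; have [mu' _] := hu.
apply: (cint_dom (cmeasM mu' (ccont_meas cg)) (rintZ K (L2gauss_rint hu a4))).
by move=> z; rewrite nmM mulrCA ler_wpM2l ?nm_ge0.
Qed.

(** Local integrability of f, read off from u tested against [laminv] g. *)
Lemma L2w_supp_cint f M g : L2w f -> ccont g -> suppP M g -> cint (fun z => f z * g z).
Proof.
move=> hf cg sg; have hu := L2w_L2gauss hf.
have cl : ccont (fun z => laminv z * g z) by apply: ccontM => //; exact: laminv_cont.
have sl : suppP M (fun z => laminv z * g z) by move=> z hz; rewrite sg// mulr0.
have q0 : (0 : R) < 4^-1 by rewrite invr_gt0.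
have := L2gauss_cint hu q0 cl (supp_bnd 0 sl cl); congr cint; apply/funext => z.
by rewrite -mulrA (mulrA (lam z)) (mulrC (lam z)) lamK mul1r.
Qed.

(** * The equation for u *)

Definition Lop (n : nat) g : C -> C := fun z =>
  dzbar (dz g) z - z / 2%:R * dz g z + n%:R / 2%:R * g z.

(** All three terms of [Box] carry an outermost d_zbar on the test function phi, and for phi = [lam]
    g what stands under it is d_z phi - (z/2) phi + (zbar/2) phi = [lam] d_z g. Every test function
    has this form, with g = [laminv] phi. *)
Lemma dist_eq_Box f n : L2w f ->
  dist_eq (Box (dist_of f)) (dist_mul (fun=> (n.+1%:R - 1) / 2%:R) (dist_of f)) <->
  (forall g M, smoothW g -> suppP M g -> cintegral (fun z => f z * lam z * Lop n g z) = 0).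
Proof.
move=> hf.
have key g M : smoothW g -> suppP M g ->
    Box (dist_of f) (fun z => lam z * g z) -
    dist_mul (fun=> (n.+1%:R - 1) / 2%:R) (dist_of f) (fun z => lam z * g z) =
    - cintegral (fun z => f z * lam z * Lop n g z).
  move=> sg hs; set phi := fun z => lam z * g z.
  have sphi : smoothW phi by apply: smoothWM => //; exact: smooth_lam.
  have hphi : suppP M phi by move=> z hz; rewrite /phi hs// mulr0.
  have wphi := smoothW_W sphi.
  have [s1 s2] := W_supp wphi hphi.
  have wh := WM W_half wphi; have wc := WM W_conj_half wphi.
  have wg := smoothW_W sg; have wl := WM W_lam wg.
  have dphi z : dz phi z = (z / 2%:R - z^* / 2%:R) * lam z * g z + lam z * dz g z.
    by rewrite (Wdz wl).
  have w1 := smoothW_W (smoothW_dz sphi); have [_ s3] := W_supp w1 s1.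
  have i1 : cint (fun z => f z * dzbar (dz phi) z).
    apply: (L2w_supp_cint hf _ s3); apply: smoothW_cont; exact/smoothW_dzbar/smoothW_dz.
  have hh : suppP M (fun z => z / 2%:R * phi z) by move=> z hz; rewrite hphi// mulr0.
  have hc : suppP M (fun z => z^* / 2%:R * phi z) by move=> z hz; rewrite hphi// mulr0.
  have sh := smoothWM smoothW_half sphi; have sc := smoothWM smoothW_conj_half sphi.
  have [_ s4] := W_supp (smoothW_W sh) hh; have [_ s5] := W_supp (smoothW_W sc) hc.
  have i2 : cint (fun z => f z * dzbar (fun z => z / 2%:R * phi z) z).
    by apply: (L2w_supp_cint hf _ s4); apply: smoothW_cont; exact: smoothW_dzbar.
  have i3 : cint (fun z => f z * dzbar (fun z => z^* / 2%:R * phi z) z).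
    by apply: (L2w_supp_cint hf _ s5); apply: smoothW_cont; exact: smoothW_dzbar.
  have i4 : cint (fun z => f z * ((n.+1%:R - 1) / 2%:R * phi z)).
    apply: (@L2w_supp_cint f M _ hf); last by move=> z hz; rewrite hphi// mulr0.
    by apply: ccontZ; exact: smoothW_cont.
  rewrite /Box /dist_dz /dist_dzbar /dist_mul /dist_of !opprK.
  have gen (a b c d : C) : - a + b - c - d = - (a + (-1) * b + c + d) by ring.
  rewrite gen.
  rewrite -cintegralZ// -cintegralD//; last exact: cintZ.
  rewrite -cintegralD//; last by apply: cintD => //; exact: cintZ.
  rewrite -cintegralD//; last by do 2?apply: cintD => //; exact: cintZ.
  congr (- cintegral _); apply/funext => z.
  have wd : W (fun z => lam z * dz g z) (dz (fun z => lam z * dz g z))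
     (fun z => - (z / 2%:R) * lam z * dz g z + lam z * dzbar (dz g) z).
    apply: W_eq (WM W_lam (smoothW_W (smoothW_dz sg))) _ _ => // y.
    by rewrite (Wdz (WM W_lam (smoothW_W (smoothW_dz sg)))).
  have wsum := WD (WD w1 (WZ (-1) (smoothW_W sh))) (smoothW_W sc).
  have E : (fun z => dz phi z + -1 * (z / 2%:R * phi z) + z^* / 2%:R * phi z) =
      (fun z => lam z * dz g z).
    by apply/funext => y; rewrite dphi /phi; ring.
  rewrite E in wsum; have := congr1 (fun F => F z) (Wdzbar wsum).
  rewrite (Wdzbar wd) /= => E2.
  rewrite /Lop -[n.+1]addn1 natrD addrK.
  transitivity (f z * (dzbar (dz phi) z + -1 * dzbar (fun z => z / 2%:R * phi z) z +
    dzbar (fun z => z^* / 2%:R * phi z) z) + f z * (n%:R / 2%:R * phi z)); first by ring.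
  by rewrite -E2 /phi; ring.
split.
  move=> H g M sg hs; have := key g M sg hs.
  have /H -> : test_function (fun z => lam z * g z).
    apply/testP; split; first by apply: smoothWM => //; exact: smooth_lam.
    by exists M => z hz; rewrite hs// mulr0.
  by rewrite subrr => /eqP; rewrite eq_sym oppr_eq0 => /eqP.
move=> H phi /testP[sphi [M hs]].
have E : phi = (fun z => lam z * (laminv z * phi z)).
  by apply/funext => z; rewrite mulrA (mulrC (lam z)) lamK mul1r.
have sg : smoothW (fun z => laminv z * phi z) by apply: smoothWM => //; exact: smooth_laminv.
have hg : suppP M (fun z => laminv z * phi z) by move=> z hz; rewrite hs// mulr0.
have := key _ M sg hg; rewrite -E (H _ M sg hg) oppr0 => /eqP.
by rewrite subr_eq0 => /eqP.
Qed.

(** * True polyanalytic functions solve the equation *)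

Section TruePolyToLandau.
Variable h : C -> C.
Hypothesis eh : entire h.

Let G (j : nat) := iter j (@dz R) (fun z => h z * gauss z).

Let smooth_G j : smoothW (G j).
Proof.
have [h' [_ _ sh]] := entire_smooth eh.
elim: j => [|j IH]; first by apply: smoothWM => //; exact: smooth_gauss.
exact: smoothW_dz.
Qed.

(** For j = 0 only the Gaussian contributes; afterwards each d_z commutes with d_zbar and
    differentiates the factor z/2 once more. *)
Lemma dzbar_iter_dz j z : dzbar (G j) z = - (z / 2%:R) * G j z - j%:R / 2%:R * G j.-1 z.
Proof.
have [h' [dh _ sh]] := entire_smooth eh.
elim: j z => [|j IH] z.
  rewrite (Wdzbar (WM (cdiff_W dh) W_gauss)) !mul0r add0r subr0 /G /=; ring.
have E : dzbar (G j) = (fun z => -1 * (z / 2%:R * G j z) + - (j%:R / 2%:R) * G j.-1 z).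
  by apply/funext => y; rewrite IH; ring.
rewrite [G j.+1]/= -/(G j) dzbar_dz; last exact: smooth_G.
have w := WD (WZ (-1) (WM W_half (smoothW_W (smooth_G j)))) (WZ (- (j%:R / 2%:R)) (smoothW_W (smooth_G j.-1))).
(* At j = 0 the truncated predecessor makes [dz (G j.-1)] differ from [G j], but the coefficient is
   0. *)
have e : j%:R / 2%:R * dz (G j.-1) z = j%:R / 2%:R * G j z.
  by case: (j) => [|m] //; rewrite !mul0r.
rewrite E (Wdz w) [j.+1.-1]/=.
rewrite (_ : - (j%:R / 2%:R) * dz (G j.-1) z = - (j%:R / 2%:R * G j z)); last by rewrite mulNr e.
by rewrite -[j.+1%:R]natr1; ring.
Qed.

(** G_n L g is the sum of two derivatives, d_zbar (G_n d_z g) + (n/2) d_z (G_{n-1} g), each of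
    integral 0. *)
Lemma cintegral_iter_dz_Lop n g M : smoothW g -> suppP M g ->
  cintegral (fun z => G n z * Lop n g z) = 0.
Proof.
move=> sg hs.
have wg := smoothW_W sg; have [sd _] := W_supp wg hs.
have wd := smoothW_W (smoothW_dz sg).
have s1 : smoothW (fun z => G n z * dz g z) by apply: smoothWM => //; exact: smoothW_dz.
have s2 : smoothW (fun z => G n.-1 z * g z) by exact: smoothWM.
have h1 : suppP M (fun z => G n z * dz g z) by move=> z hz; rewrite sd// mulr0.
have h2 : suppP M (fun z => G n.-1 z * g z) by move=> z hz; rewrite hs// mulr0.
have n1 : (-1 : R) < 0 by lra.
have o1 := @supp_ord R M (-1) _ h1 s1; have o2 := @supp_ord R M (-1) _ h2 s2.
have w1 := WM (smoothW_W (smooth_G n)) wd.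
have w2 := WM (smoothW_W (smooth_G n.-1)) wg.
have E : (fun z => G n z * Lop n g z) =
    (fun z => dzbar (fun z => G n z * dz g z) z + n%:R / 2%:R * dz (fun z => G n.-1 z * g z) z).
  apply/funext => z; rewrite (Wdzbar w1) (Wdz w2) /Lop dzbar_iter_dz.
  have -> : n%:R / 2%:R * (dz (G n.-1) z * g z + G n.-1 z * dz g z) =
      n%:R / 2%:R * (G n z * g z + G n.-1 z * dz g z) :> C.
    by case: (n) => [|m] //; rewrite !mul0r.
  ring.
rewrite E cintegralD; last 2 first.
- exact: (ord_cint n1 (ord_dzbar o1)).
- by apply: cintZ; exact: (ord_cint n1 (ord_dz o2)).
rewrite (cintegralZ (n%:R / 2%:R)); last exact: (ord_cint n1 (ord_dz o2)).
by rewrite (cintegral_dz_dzbar n1 o1).2 (cintegral_dz_dzbar n1 o2).1 mulr0 addr0.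
Qed.

Lemma iter_dz_landau f n (c : C) : L2w f ->
  ae_eqC f (fun z => c * laminv z * G n z) ->
  forall g M, smoothW g -> suppP M g -> cintegral (fun z => f z * lam z * Lop n g z) = 0.
Proof.
move=> [mf _] fE g M sg hs.
have cL : ccont (Lop n g).
  have cg := smoothW_cont sg; have cd := smoothW_cont (smoothW_dz sg).
  have cdd := smoothW_cont (smoothW_dzbar (smoothW_dz sg)).
  have := ccontD (ccontD cdd (ccontZ (-1) (ccontM (smoothW_cont smoothW_half) cd))) (ccontZ (n%:R / 2%:R) cg).
  by congr ccont; apply/funext => z; rewrite /Lop mulN1r.
have cGL : ccont (fun z => G n z * Lop n g z) by apply: ccontM => //; exact/smoothW_cont/smooth_G.
have sL : suppP M (Lop n g).
  have [s1 _] := W_supp (smoothW_W sg) hs; have [_ s2] := W_supp (smoothW_W (smoothW_dz sg)) s1.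
  by move=> z hz; rewrite /Lop s2// s1// hs// !mulr0 subrr addr0.
have iGL : cint (fun z => G n z * Lop n g z).
  apply: (@bnd_cint R (-1)) => //.
  by apply: (@supp_bnd R M) => // z hz; rewrite sL// mulr0.
transitivity (cintegral (fun z => c * (G n z * Lop n g z))).
  apply: cintegral_ae.
  - by apply: cmeasM; [apply: cmeasM => //|]; apply: ccont_meas => //; exact: lam_cont.
  - by apply: ccont_meas; exact: ccontZ.
  case: fE => N [mN N0 sN]; exists N; split => //.
  apply: (subset_trans _ sN) => p /= np hp; apply: np; rewrite hp.
  have := lamK (ofxy p) => h1.
  transitivity (c * (laminv (ofxy p) * lam (ofxy p)) * G n (ofxy p) * Lop n g (ofxy p)); first by ring.
  by rewrite h1; ring.
by rewrite cintegralZ// (cintegral_iter_dz_Lop _ sg hs) mulr0.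
Qed.
End TruePolyToLandau.

(** * Extension to test functions of subgaussian growth *)

Lemma flat_exp_le (j : nat) (x : R) : flat_exp j x <= (j.+2)`!%:R.
Proof.
have f1 : (1 : R) <= (j.+2)`!%:R by rewrite ler1n fact_gt0.
have [x1|x1] := lerP x 1; last first.
  apply: le_trans f1; rewrite /flat_exp ifT; last by lra.
  have x0 : 0 < x by lra.
  have y0 : 0 <= x^-1 by rewrite invr_ge0 ltW.
  have y1 : x^-1 <= 1 by rewrite invf_le1// ltW.
  rewrite mulr_ile1 ?expR_ge0 ?exprn_ge0 ?exprn_ile1//.
  by rewrite -[leRHS]expR0 ler_expR oppr_le0.
have [x0|x0] := ltP 0 x; last by rewrite /flat_exp ltNge x0.
by apply: (le_trans (flat_exp_sq j x)); rewrite ler_piMr// exprn_ile1// ltW.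
Qed.

Lemma nm_bump_le (e : R) j z : nm (cbump e j z) <= (j.+2)`!%:R.
Proof. by rewrite /cbump nm_real ger0_norm ?flat_exp_ge0// flat_exp_le. Qed.

(** The factor e^1 normalises the bump to 1 at the origin. As a function of t = e |z|^2 its
    derivative is -e^1 [flat_exp] 2 (1 - t), bounded by 4! = 24 times e^1. *)
Lemma bump_near1 (e : R) z : nm ((expR 1)%:C * cbump e 0 z - 1) <= expR 1 * 24 * `|e * nm z ^+ 2|.
Proof.
pose F (t : R) := expR 1 * flat_exp 0 (1 - t).
have dF (t : R) : is_derive t 1 F (expR 1 * - flat_exp 2 (1 - t)).
  have d1 : is_derive t 1 (fun t : R => 1 - t) (-1).
    by apply: (is_derive_eq (is_deriveB (is_derive_cst _ _ _) (is_derive_id _ _))); rewrite sub0r.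
  have h := @is_derive1_comp _ (flat_exp 0) (fun t : R => 1 - t) t _ _
    (is_derive_flat_exp 0 (1 - t)) d1.
  apply: (is_derive_eq (is_deriveM (is_derive_cst (expR 1) t 1) h)).
  by rewrite /flat_exp' /GRing.scale /= mul0r subr0; ring.
have F0 : F 0 = 1.
  by rewrite /F /flat_exp subr0 ltr01 expr0 mul1r invr1 -expRD subrr expR0.
have -> : (expR 1)%:C * cbump e 0 z - 1 = (F (e * nm z ^+ 2) - F 0)%:C.
  by rewrite F0 /F /cbump rmorphB rmorphM /=.
rewrite nm_real; apply: (real_MVT_bound dF) => s _.
rewrite normrM normrN !ger0_norm ?expR_ge0 ?flat_exp_ge0// ler_wpM2l ?expR_ge0//.
exact: flat_exp_le.
Qed.

(** The exponent 1/8 is a convenient one between 0 and the threshold 1/4. *)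
Lemma ord0_bnd f : ord 0 f -> bnd 8^-1 f.
Proof. by move=> hf; apply: (ord_bnd hf); rewrite invr_gt0. Qed.

Lemma ord_Lop n g : ord 0 g -> ord 0 (Lop n g).
Proof.
move=> og; have o1 := ord_dz og; have o2 := ord_dzbar o1.
have oh : ord 0 (fun z => z / 2%:R : C) by have := ordZ 2%:R^-1 (@ord_id R); under eq_fun do rewrite mulrC.
have := ordD (ordD o2 (ordZ (-1) (ordM0 oh o1))) (ordZ (n%:R / 2%:R) og).
by congr ord; apply/funext => z; rewrite /Lop mulN1r.
Qed.

(* The cut-off exp(1) (cbump e 0) tends to 1 with an error O(e |z|^2), and its derivatives are O(e (1
   + |z|^2)). *)
Lemma Lop_ord0 u n g : L2gauss u ->
  (forall f M, smoothW f -> suppP M f -> cintegral (fun z => u z * Lop n f z) = 0) ->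
  ord 0 g -> cintegral (fun z => u z * Lop n g z) = 0.
Proof.
move=> hu H og.
have q4 : (8^-1 : R) < 4^-1 by lra.
have oz := @ord_id R; have oc := @ord_conj R.
have oL := ord_Lop n og; have o1 := ord_dz og; have o2 := ord_dzbar og.
pose P0 z := z * (z^* * Lop n g z); pose P1 z := z * dz g z.
pose P2 z := z^* * dzbar g z; pose P4 z := z * (z^* * g z).
have [K0 K00 H0] := bndK (ord0_bnd (ordM0 oz (ordM0 oc oL))).
have [K1 K10 H1] := bndK (ord0_bnd (ordM0 oz o1)).
have [K2 K20 H2] := bndK (ord0_bnd (ordM0 oc o2)).
have [K3 K30 H3] := bndK (ord0_bnd og).
have [K4 K40 H4] := bndK (ord0_bnd (ordM0 oz (ordM0 oc og))).
pose e1 : R := expR 1; have e10 : 0 < e1 by exact: expR_gt0.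
pose B e j z := e1%:C * cbump e j z.
have B_le e j z : nm (B e j z) <= e1 * (j.+2)`!%:R.
  by rewrite /B nmM nm_real ger0_norm ?(ltW e10)// ler_wpM2l ?(ltW e10)// nm_bump_le.
have WB e j := WZ e1%:C (W_bump e j).
have LE e z : Lop n (fun z => B e 0 z * g z) z - Lop n g z =
    (B e 0 z - 1) * Lop n g z + (- e%:C) * (B e 2 z * P1 z + B e 2 z * P2 z + B e 2 z * g z)
    + (e ^+ 2)%:C * ((B e 4 z + -2%:R * B e 3 z) * P4 z) + (e%:C / 2%:R) * (B e 2 z * P4 z).
  have wg := ordW og; have w1 := WM (WB e 0%N) wg.
  rewrite /Lop (Wdz w1).
  have E : (fun z => e1%:C * ((cbump e 2 z + - 0%:R * cbump e 1 z) * (- e%:C * z^*)) * g z + e1%:C * cbump e 0 z * dz g z)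
      = (fun z => (- e%:C) * (B e 2 z * (z^* * g z)) + B e 0 z * dz g z).
    by apply/funext => y; rewrite /B; ring.
  rewrite E.
  have w2 := WD (WZ (- e%:C) (WM (WB e 2%N) (WM (W_conj R) wg))) (WM (WB e 0%N) (ordW o1)).
  rewrite (Wdzbar w2) /P1 /P2 /P4 /B rmorphXn /=; by field.
(* The bounds (j+2)! for j = 2, 3, 4 are 24, 120 and 720; the largest coefficient, that of [K4], is
   720 + 2 120 + 24 = 984, below 1000. The restriction e <= 1 serves e^2 <= e. *)
have main e : 0 < e -> e <= 1 -> nm (cintegral (fun z => u z * Lop n g z)) <=
    e * (2 * rI (fun z => (e1 * 1000 * (K0 + K1 + K2 + K3 + K4)) * (nm (u z) * expR (8^-1 * nm z ^+ 2)))).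
  move=> e0 el1.
  have sB : smoothW (fun z => B e 0 z * g z).
    by apply: smoothWM; [apply: smoothWZ; exact: smooth_bump|exact: ord_smooth og].
  have hB : suppP (e^-1 + 1) (fun z => B e 0 z * g z).
    by move=> z hz; rewrite /B (supp_bump _ e0 hz) mulr0 mul0r.
  have i1 : cint (fun z => u z * Lop n (fun z => B e 0 z * g z) z).
    have oo := ord_Lop n (@supp_ord R _ 0 _ hB sB).
    exact: L2gauss_cint hu q4 (ord_cont oo) (ord0_bnd oo).
  have i2 : cint (fun z => u z * Lop n g z).
    exact: L2gauss_cint hu q4 (ord_cont oL) (ord0_bnd oL).
  have E : - cintegral (fun z => u z * Lop n g z) =
      cintegral (fun z => u z * (Lop n (fun z => B e 0 z * g z) z - Lop n g z)).
    rewrite -[LHS]add0r -[X in X - _](H _ _ sB hB) -[in LHS]mulN1r -cintegralZ// -cintegralD//; last exact: cintZ.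
    by congr cintegral; apply/funext => z; ring.
  rewrite -nmN E mulrCA.
  have iu := rintZ (e1 * 1000 * (K0 + K1 + K2 + K3 + K4)) (L2gauss_rint hu q4).
  rewrite -rIZ//; apply: cintegral_bound.
  - have := cintD i1 (cintZ (-1) i2); congr cint; apply/funext => z; by ring.
  - exact: rintZ.
  move=> z; rewrite LE nmM; set X := expR _.
  have X0 : 0 < X by exact: expR_gt0.
  rewrite (_ : e * _ = nm (u z) * (e * (e1 * 1000 * (K0 + K1 + K2 + K3 + K4) * X))); last by ring.
  rewrite ler_wpM2l ?nm_ge0//.
  have h0 : nm ((B e 0 z - 1) * Lop n g z) <= e * (e1 * 24 * (K0 * X)).
    rewrite nmM; apply: (@le_trans _ _ (e1 * 24 * `|e * nm z ^+ 2| * nm (Lop n g z))).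
      by rewrite ler_wpM2r ?nm_ge0// bump_near1.
    rewrite (ger0_norm (mulr_ge0 (ltW e0) (sqr_ge0 _))).
    rewrite (_ : _ * nm (Lop n g z) = e * (e1 * 24 * (nm z ^+ 2 * nm (Lop n g z)))); last by ring.
    rewrite ler_wpM2l ?(ltW e0)// ler_wpM2l ?mulr_ge0 ?(ltW e10)//.
    apply: le_trans (H0 z); by rewrite !nmM nm_conj expr2 mulrA.
  have fs : [/\ (2.+2)`! = 24, (3.+2)`! = 120 & (4.+2)`! = 720]%N by [].
  have [f2 f3 f4] := fs.
  have b2 := B_le e 2%N z; have b3 := B_le e 3%N z; have b4 := B_le e 4%N z.
  rewrite f2 in b2; rewrite f3 in b3; rewrite f4 in b4.
  have mul (a b : C) (k1 k2 : R) : nm a <= k1 -> nm b <= k2 -> nm (a * b) <= k1 * k2.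
    by move=> ha hb; rewrite nmM ler_pM ?nm_ge0.
  have c1 := mul _ _ _ _ b2 (H1 z); have c2 := mul _ _ _ _ b2 (H2 z).
  have c3 := mul _ _ _ _ b2 (H3 z); have c5 := mul _ _ _ _ b2 (H4 z).
  have b43 : nm (B e 4 z + - 2%:R * B e 3 z) <= e1 * 960.
    apply: (le_trans (nmD _ _)); rewrite [nm (_ * B e 3 z)]nmM nmN nm_nat.
    by move: b3 b4; set x3 := nm (B e 3 z); set x4 := nm (B e 4 z); lra.
  have c4 := mul _ _ _ _ b43 (H4 z).
  have t1 : nm (- e%:C * (B e 2 z * P1 z + B e 2 z * P2 z + B e 2 z * g z)) <=
      e * (e1 * 24%:R * (K1 * X) + e1 * 24%:R * (K2 * X) + e1 * 24%:R * (K3 * X)).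
    rewrite nmM nmN nm_real ger0_norm ?(ltW e0)// ler_wpM2l ?(ltW e0)//.
    apply: (le_trans (nmD _ _)); apply: lerD => //.
    by apply: (le_trans (nmD _ _)); exact: lerD.
  have t2 : nm ((e ^+ 2)%:C * ((B e 4 z + -2%:R * B e 3 z) * P4 z)) <= e * ((e1 * 960) * (K4 * X)).
    apply: mul c4; rewrite nm_real ger0_norm ?sqr_ge0//.
    by rewrite expr2 ler_piMr// ltW.
  have t3 : nm (e%:C / 2%:R * (B e 2 z * P4 z)) <= e * (e1 * 24%:R * (K4 * X)).
    apply: mul c5; rewrite nmM nm_real (ger0_norm (ltW e0)) ComplexField.Normc.normcV nm_nat.
    by rewrite ler_piMr ?(ltW e0)// invf_le1// ler1n.
  apply: (le_trans (nmD _ _)); apply: (le_trans (lerD (nmD _ _) (lexx _))).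
  apply: (le_trans (lerD (lerD (nmD _ _) (lexx _)) (lexx _))).
  apply: (le_trans (lerD (lerD (lerD h0 t1) t2) t3)).
  rewrite -!mulrDr ler_wpM2l ?(ltW e0)//.
  have y k : 0 <= k -> 0 <= e1 * k * X by move=> k0; rewrite !mulr_ge0 ?(ltW e10) ?(ltW X0).
  have := y _ K00; have := y _ K10; have := y _ K20; have := y _ K30; have := y _ K40.
  by lra.
apply: nm_eq0; apply/eqP; rewrite eq_le nm_ge0 andbT.
apply/ler_addgt0Pl => d d0; rewrite addr0.
move: main; set T := 2 * _ => main.
have T1 : 0 < `|T| + 1 by rewrite ltr_wpDl.
have m0 : 0 < Num.min 1 (d / (`|T| + 1)) by rewrite lt_min ltr01 divr_gt0.
have mle : Num.min 1 (d / (`|T| + 1)) <= 1 by rewrite ge_min lexx.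
apply: (le_trans (main _ m0 mle)).
apply: (@le_trans _ _ (Num.min 1 (d / (`|T| + 1)) * (`|T| + 1))).
  by rewrite ler_wpM2l ?(ltW m0)//; have := ler_norm T; lra.
by rewrite -ler_pdivlMr// ge_min lexx orbT.
Qed.

(** * Exponentials of linear growth *)

(** Completing the square: B r <= c r^2 + B^2/(4c). *)
Lemma expR_affine_bnd (c A B : R) z : 0 < c ->
  expR (A + B * nm z) <= expR (A + B ^+ 2 / (4 * c)) * expR (c * nm z ^+ 2).
Proof.
move=> c0; rewrite -expRD ler_expR -addrA lerD2l.
have := sqr_ge0 (B / (2 * c) - nm z); rewrite -(pmulr_rge0 _ c0) => h.
rewrite -subr_ge0; apply: le_trans h _; rewrite le_eqVlt; apply/orP; left; apply/eqP.
by field; rewrite gt_eqF.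
Qed.

Lemma ord0_cexp p a b (A B : R) : ccont p -> W p a b -> ord 0 a -> ord 0 b ->
  (forall z, nm (p z) <= A + B * nm z) -> ord 0 (fun z => cexp (p z)).
Proof.
move=> cp wp oa ob hp; apply: (ord_eigen (ccont_exp cp) _ (W_exp wp)) => // c c0.
exists (expR (A + B ^+ 2 / (4 * c))) => z; apply: le_trans (expR_affine_bnd A B z c0).
rewrite nm_cexp ler_expR; apply: le_trans (hp z); apply: le_trans (nm_Re _); exact: ler_norm.
Qed.

Lemma exprn_le_expR k (x : R) : 0 <= x -> x ^+ k <= k`!%:R * expR x.
Proof.
move=> x0; have f0 : (0 : R) < k`!%:R by rewrite ltr0n fact_gt0.
case: k f0 => [|k] f0; first by rewrite expr0 mul1r -[leLHS]expR0 ler_expR.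
rewrite mulrC -ler_pdivrMr//; apply: le_trans (expR_ge1Dxn k x0); by rewrite lerDr.
Qed.

Lemma nm_conj_half z : nm (z^* / 2%:R) = nm z / 2.
Proof.
by rewrite nmM nm_conj ComplexField.Normc.normcV nm_nat.
Qed.

Definition expk t w z : C := cexp (z^* / 2%:R * w - t * z).

Lemma W_expk t w : W (expk t w) (fun z => - t * expk t w z) (fun z => w / 2%:R * expk t w z).
Proof.
have h := W_exp (WD (WM W_conj_half (W_cst w)) (WZ (- t) (W_id R))).
apply: (W_eq (_ : W (expk t w) _ _)) => [|z|z].
- have := h; rewrite (_ : (fun z => cexp _) = expk t w) => [h'|]; first exact: h'.
  by apply/funext => z; rewrite /expk mulNr.
- by rewrite /= /expk -(mulNr t z); ring.
- by rewrite /= /expk -(mulNr t z); ring.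
Qed.

Lemma expk_ord t w : ord 0 (expk t w).
Proof.
have := WD (WM W_conj_half (W_cst w)) (WZ (- t) (W_id R)).
rewrite (_ : (fun z => _ + _) = fun z => z^* / 2%:R * w - t * z); last first.
  by apply/funext => z; rewrite mulNr.
move=> wp; have := @ord0_cexp _ _ _ 0 (nm w / 2 + nm t) _ wp; apply.
- apply: ccontD; first exact: ccontM (smoothW_cont smoothW_conj_half) (ccont_cst w).
  by have := ccontZ (- t) (@ccont_id R); under eq_fun do rewrite mulNr.
- by have := ord_cst (0 * w + - t * 1); congr ord; apply/funext => z; ring.
- by have := ord_cst (2%:R^-1 * w); congr ord; apply/funext => z; ring.
- move=> z; rewrite add0r mulrDl; apply: (le_trans (nmB _ _)).
  by rewrite (nmM _ w) nm_conj_half (nmM t); lra.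
Qed.

Lemma gauss_ord : ord (- 2^-1) gauss.
Proof.
apply: (ord_eigen gauss_cont _ W_gauss).
- move=> c hc; apply: bnd_le (ltW hc) _; exists 1 => z; by rewrite nm_gauss mul1r.
- have := ordZ (- 2%:R^-1) (@ord_conj R); congr ord; apply/funext => z; ring.
- have := ordZ (- 2%:R^-1) (@ord_id R); congr ord; apply/funext => z; ring.
Qed.

(** * Gaussian mean values and moments *)

Lemma holomorphic_cdiff a g : ord a g -> dzbar g = (fun=> 0) ->
  cdiff g (dz g) /\ dzbar (dz g) = (fun=> 0).
Proof.
move=> og g0; have wg := ordW og; rewrite g0 in wg; split.
  exact: W_cdiff wg (ord_cont (ord_dz og)).
rewrite dzbar_dz; last exact: (ord_smooth og).
by rewrite g0 (Wdz (W_cst 0)).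
Qed.

(* The segment from w to z is taken slightly beyond its ends, with 1.05^2 * 1.02 * 0.42 < 0.48. *)
Lemma gauss_mean_value g w : ord (2 / 5) g -> dzbar g = (fun=> 0) ->
  cintegral (fun z => g z * (gauss z * expk 0 w z)) =
  g w * cintegral (fun z => gauss z * expk 0 w z).
Proof.
move=> og g0; have [d0 g1] := holomorphic_cdiff og g0.
have og1 := ord_dz og; have [d1 _] := holomorphic_cdiff og1 g1.
have og2 := ord_dz og1.
set kap := fun z => gauss z * expk 0 w z.
have okap : ord (- 2^-1) kap by rewrite -[- 2^-1]addr0; exact: ordM gauss_ord (expk_ord 0 w).
(* The factor -2 cancels the halves in d_zbar ([gauss] [expk]) = ((w - z)/2) [kap]. *)
pose K z := -2%:R * kap z; pose Kz z := z^* * kap z.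
have oK : ord (- 2^-1) K by exact: ordZ.
have oKz : ord (- 2^-1) Kz by apply: ordM0 okap; exact: ord_conj.
have oz : ord (- 2^-1) (fun z => (z - w) * kap z).
  by apply: ordM0 okap; exact: ordD (@ord_id R) (ord_cst (- w)).
have wK : W K Kz (fun z => (z - w) * kap z).
  apply: (W_eq (WZ (-2%:R) (WM W_gauss (W_expk 0 w)))) => z; rewrite /Kz /kap; by field.
have m2 : (- 2^-1 : R) < 0 by rewrite oppr_lt0 invr_gt0.
have h1 : (2 / 5 : R) < 21 / 50 by lra.
have h2 : (- 2^-1 : R) < - (49 / 100) by lra.
have [A0 A00 HA0] := bndK (ord_bnd og h1); have [A1 A10 HA1] := bndK (ord_bnd og1 h1).
have [A2 A20 HA2] := bndK (ord_bnd og2 h1).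
have [B0 B00 HB0] := bndK (ord_bnd okap h2); have [B1 B10 HB1] := bndK (ord_bnd oK h2).
have [B2 B20 HB2] := bndK (ord_bnd oKz h2); have [B3 B30 HB3] := bndK (ord_bnd oz h2).
have c1 : (- (1 / 100) : R) < 0 by lra.
have dl : (0 : R) < 1 / 20 by lra.
apply: (kernel_mean_value (A := (A0 + A1 + A2) * (B0 + B1 + B2 + B3) * expR (24 * nm w ^+ 2)) c1 dl d0 d1
  (ord_cont og2) (ord_cont okap) (ord_cint m2 okap) wK (ord_cont oK) (ord_cont oKz)).
move=> p q hp hq s z /andP[s1 s2].
set y := w + s%:C * (z - w); set Ey := expR (21 / 50 * nm y ^+ 2); set Ez := expR (- (49 / 100) * nm z ^+ 2).
have hpA : nm (p y) <= (A0 + A1 + A2) * Ey.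
  by case: hp => [->|[->|->]]; [apply: (le_trans (HA0 y))|apply: (le_trans (HA1 y))|apply: (le_trans (HA2 y))];
    rewrite ler_wpM2r ?expR_ge0//; lra.
have hqB : nm (q z) <= (B0 + B1 + B2 + B3) * Ez.
  by case: hq => [->|[->|[->|->]]];
    [apply: (le_trans (HB0 z))|apply: (le_trans (HB1 z))|apply: (le_trans (HB2 z))|apply: (le_trans (HB3 z))];
    rewrite ler_wpM2r ?expR_ge0//; lra.
apply: (le_trans (ler_pM (nm_ge0 _) (nm_ge0 _) hpA hqB)).
have AB0 : 0 <= (A0 + A1 + A2) * (B0 + B1 + B2 + B3) by apply: mulr_ge0; lra.
rewrite mulrACA -[leRHS]mulrA ler_wpM2l//.
rewrite -!expRD ler_expR.
set a := nm z; set b := nm w; have a0 : 0 <= a := nm_ge0 z; have b0 : 0 <= b := nm_ge0 w.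
have hy : nm y <= 21 / 20 * (a + b).
  rewrite (_ : y = (1 - s)%:C * w + s%:C * z); last by rewrite /y rmorphB rmorph1; ring.
  apply: (le_trans (nmD _ _)); rewrite (nmM _ w) (nmM _ z) !nm_real -/a -/b.
  have k1 : `|1 - s| <= 21 / 20 by rewrite ler_norml; lra.
  have k2 : `|s| <= 21 / 20 by rewrite ler_norml; lra.
  by have := ler_wpM2r b0 k1; have := ler_wpM2r a0 k2; lra.
have hy2 : nm y ^+ 2 <= (21 / 20 * (a + b)) ^+ 2.
  by rewrite ler_sqr ?nnegrE ?nm_ge0// mulr_ge0 ?addr_ge0//; lra.
(* This square gives (a + b)^2 <= 1.02 a^2 + 51 b^2; multiplied by 0.42 1.05^2 it is at most 0.48
   a^2 + 24 b^2, whence the exponents 24 and 0.48 - 0.49 = -1/100. *)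
have := sqr_ge0 (a - 50 * b); nra.
Qed.

Lemma cintegral_conj f : cint f -> cintegral (fun z => (f z)^*) = (cintegral f)^*.
Proof.
move=> [fr fi]; rewrite !cintegralE; apply: complexP => /=.
  by congr rI; apply/funext => z /=; case: (f z).
rewrite -mulN1r -rIZ//; congr rI; apply/funext => z /=; case: (f z) => x y /=.
by rewrite mulN1r.
Qed.

Lemma cexp_conj z : (cexp z)^* = cexp z^*.
Proof. by case: z => x y; rewrite !cexpE /= cosN sinN mulrN. Qed.

Lemma gauss_real z : gauss z = (expR (- 2^-1 * nm z ^+ 2))%:C.
Proof.
rewrite /gauss conj_nm (_ : - _ = (- 2^-1 * nm z ^+ 2)%:C).
  by rewrite cexpE /= cos0 sin0 mulr1 mulr0.
by rewrite inv2C; apply: complexP; rewrite !ReImE /=; ring.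
Qed.

Lemma expk_conj w z : (expk (- (w^* / 2%:R)) 0 z)^* = expk 0 w z.
Proof.
rewrite /expk cexp_conj inv2C; congr cexp.
by case: z => x y; case: w => a b; simpc; congr (_ +i* _); ring.
Qed.

(* After conjugation this is the mean value property at 0. *)
Lemma gauss_expk_mean w : cintegral (fun z => gauss z * expk 0 w z) = cintegral gauss.
Proof.
have n5 : (- 2^-1 : R) < 0 by rewrite oppr_lt0 invr_gt0.
have og : ord (2 / 5) (expk (- (w^* / 2%:R)) 0) by apply: ord_le (expk_ord _ _); lra.
have g0 : dzbar (expk (- (w^* / 2%:R)) 0) = (fun=> 0).
  by rewrite (Wdzbar (W_expk _ _)); apply/funext => z; rewrite !mul0r.
have e0 : (fun z => gauss z * expk 0 0 z) = gauss.
  by apply/funext => z; rewrite /expk mulr0 mul0r subr0 cexp0 mulr1.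
have gc z : (gauss z)^* = gauss z.
  by rewrite gauss_real; apply: complexP => //=; rewrite oppr0.
have := gauss_mean_value 0 og g0; rewrite e0.
rewrite [expk _ 0 0]/expk !mulr0 subr0 cexp0 mul1r => h.
have i1 : cint (fun z => gauss z * expk 0 w z).
  by apply: (ord_cint n5); rewrite -[- 2^-1]addr0; exact: ordM gauss_ord (expk_ord 0 w).
apply: (can_inj (@conjcK R)); rewrite -[LHS]cintegral_conj// -[RHS]cintegral_conj; last exact: (ord_cint n5 gauss_ord).
rewrite [RHS](_ : _ = cintegral gauss); last by congr cintegral; apply/funext => z; exact: gc.
rewrite -h; congr cintegral; apply/funext => z.
have -> : expk 0 0 z = 1 by rewrite /expk mulr0 mul0r subr0 cexp0.
have cj (a b : C) : (a * b^*%C)^* = a^* * b.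
  by case: a => x y; case: b => x' y'; simpc; congr (_ +i* _); ring.
rewrite mulr1 -(expk_conj w z); rewrite cj mulrC; congr (_ * _); exact: gc.
Qed.

Lemma cintegral_gauss_neq0 : cintegral gauss != 0.
Proof.
have n5 : (- 2^-1 : R) < 0 by rewrite oppr_lt0 invr_gt0.
have [gr gi] := ord_cint n5 gauss_ord.
have E z : Re (gauss z) = expR (- 2^-1 * nm z ^+ 2) by rewrite gauss_real.
apply/eqP => /(congr1 Re); rewrite cintegralE /= => h.
have := @rI_gt0 R _ (expR (- 2^-1)) gr; rewrite h ltxx => H.
suff : false by []; apply: H => [z||z hz].
- by rewrite [leRHS]E expR_ge0.
- exact: expR_gt0.
- by rewrite [leRHS]E ler_expR mulNr lerN2 ler_piMr ?invr_ge0//; lra.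
Qed.

Lemma iter_dz_ord a h k : ord a h -> ord (a + - 2^-1) (iter k (@dz R) (fun z => h z * gauss z)).
Proof. by move=> oh; elim: k => [|k IH]; [exact: ordM oh gauss_ord|exact: ord_dz]. Qed.

(** Each d_z is moved onto the exponential and yields a factor t. For k = 0, the holomorphic factor
    h(z) e^(-t z) is evaluated at w by the mean value property. *)
Lemma iter_dz_moment h k t w : entire h -> ord (2 / 5) h ->
  cintegral (fun z => iter k (@dz R) (fun z => h z * gauss z) z * expk t w z) =
  t ^+ k * (cexp (- (t * w)) * h w * cintegral gauss).
Proof.
move=> eh oh; have [h' [dh _ _]] := entire_smooth eh.
have n10 : (2 / 5 + (- 2^-1) : R) < 0 by lra.
have oG j : ord (2 / 5 + (- 2^-1)) (iter j (@dz R) (fun z => h z * gauss z)).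
  exact: iter_dz_ord.
have oGe j : ord (2 / 5 + (- 2^-1)) (fun z => iter j (@dz R) (fun z => h z * gauss z) z * expk t w z).
  by rewrite -[_ + _]addr0; exact: ordM (oG j) (expk_ord t w).
elim: k => [|k IH].
  rewrite expr0 mul1r -(gauss_expk_mean w).
  have og : ord (2 / 5) (fun z => expk t 0 z * h z) by exact: ordM0 (expk_ord t 0) oh.
  have g0 : dzbar (fun z => expk t 0 z * h z) = (fun=> 0).
    by rewrite (Wdzbar (WM (W_expk t 0) (cdiff_W dh))); apply/funext => z; rewrite !mul0r mulr0 addr0.
  have := gauss_mean_value w og g0.
  rewrite [expk t 0 w]/expk mulr0 add0r => <-; congr cintegral; apply/funext => z /=.
  have -> : expk t w z = expk t 0 z * expk 0 w z by rewrite /expk -cexpD; congr cexp; ring.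
  ring.
have := (cintegral_dz_dzbar n10 (oGe k)).1.
rewrite (Wdz (WM (ordW (oG k)) (W_expk t w))).
rewrite (_ : (fun z => _) = fun z => iter k.+1 (@dz R) (fun z => h z * gauss z) z * expk t w z +
    - t * (iter k (@dz R) (fun z => h z * gauss z) z * expk t w z)); last first.
  by apply/funext => z /=; ring.
rewrite cintegralD; [|exact: ord_cint (oGe k.+1)|exact/cintZ/(ord_cint n10 (oGe k))].
rewrite (cintegralZ (- t)); last exact: ord_cint (oGe k).
rewrite IH mulNr => /eqP; rewrite subr_eq0 => /eqP ->; rewrite exprS; ring.
Qed.

(** * Moments of a solution *)

Section LandauToTruePoly.
Variables (u : C -> C) (n : nat).
Hypothesis hu : L2gauss u.
Hypothesis uLop : forall g, ord 0 g -> cintegral (fun z => u z * Lop n g z) = 0.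

Section Moments.
Variables w t : C.

Let X z : C := t * (w - z).
Let p (s : R) z : C := z^* / 2%:R * w + s%:C * X z.
Let E (k : nat) (s : R) z : C := X z ^+ k * cexp (p s z).

Let WX : W X (fun=> - t) (fun=> 0).
Proof.
have := WZ t (WD (W_cst w) (WZ (-1) (W_id R))).
rewrite (_ : (fun z => _) = X); last by apply/funext => z; rewrite /X mulN1r.
by move/W_eq; apply => z; ring.
Qed.

Let cX : ccont X.
Proof.
have := ccontZ t (ccontD (ccont_cst w) (ccontZ (-1) (@ccont_id R))).
by congr ccont; apply/funext => z; rewrite /X mulN1r.
Qed.

Let oX : ord 0 X.
Proof.
have := ordZ t (ordD (ord_cst w) (ordZ (-1) (@ord_id R))).
by congr ord; apply/funext => z; rewrite /X mulN1r.
Qed.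

Let Wp s : W (p s) (fun=> - (s%:C * t)) (fun=> w / 2%:R).
Proof.
have := WD (WM W_conj_half (W_cst w)) (WZ s%:C WX).
by move/W_eq; apply => z; ring.
Qed.

Let cp s : ccont (p s).
Proof.
apply: ccontD (ccontZ _ cX); apply: ccontM (ccont_cst w).
exact: smoothW_cont smoothW_conj_half.
Qed.

Let nmX_le z : nm (X z) <= nm t * nm w + nm t * nm z.
Proof. by rewrite nmM -mulrDr ler_wpM2l ?nm_ge0// nmB. Qed.

Let nmp_le s z : `|s| <= 2 -> nm (p s z) <= 2 * (nm t * nm w) + (nm w / 2 + 2 * nm t) * nm z.
Proof.
move=> s2; apply: (le_trans (nmD _ _)); rewrite (nmM (z^* / 2%:R) w) nm_conj_half (nmM s%:C) nm_real.
have := nmX_le z; have := nm_ge0 (X z) => h0 h1.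
have : `|s| * nm (X z) <= 2 * nm (X z) by rewrite ler_wpM2r.
lra.
Qed.

Let oe s : `|s| <= 2 -> ord 0 (fun z => cexp (p s z)).
Proof.
by move=> s2; apply: (ord0_cexp (cp s) (Wp s)) => [||z]; [exact: ord_cst|exact: ord_cst|exact: nmp_le].
Qed.

Let oE k s : `|s| <= 2 -> ord 0 (E k s).
Proof. by move=> s2; apply: ordM0; [exact: ordX|exact: oe]. Qed.

(** Uniform over |s| <= 2, hence on a neighbourhood of [0, 1]: the majorant for differentiating the
    moments in s. *)
Let E_bnd k : exists K : R, forall s z, `|s| <= 2 -> nm (E k s z) <= K * expR (8^-1 * nm z ^+ 2).
Proof.
set A := 2 * (nm t * nm w) + nm t * nm w; set B := nm w / 2 + 2 * nm t + nm t.
exists (k`!%:R * expR (A + B ^+ 2 / (4 * 8^-1))) => s z s2.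
have q0 : (0 : R) < 8^-1 by rewrite invr_gt0.
rewrite -mulrA; apply: le_trans (ler_wpM2l _ (expR_affine_bnd A B z q0)) => //.
rewrite nmM nmX nm_cexp; apply: le_trans (ler_wpM2r (expR_ge0 _) (exprn_le_expR k (nm_ge0 _))) _.
rewrite -mulrA -expRD ler_wpM2l// ler_expR.
have := nmX_le z; have := nmp_le z s2; have := le_trans (ler_norm _) (nm_Re (p s z)).
rewrite /A /B; lra.
Qed.

Let WE k s : W (E k s) (fun z => - t * (k%:R * E k.-1 s z + s%:C * E k s z)) (fun z => w / 2%:R * E k s z).
Proof.
have wX : W (fun z => X z ^+ k) (fun z => k%:R * X z ^+ k.-1 * - t) (fun=> 0).
  elim: k => [|k IH]; first by apply: (W_eq (W_cst 1)) => z; rewrite ?mul0r.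
  rewrite (_ : (fun z => _) = fun z => X z * X z ^+ k); last by apply/funext => z; rewrite exprS.
  apply: (W_eq (WM WX IH)) => z /=; last by rewrite mul0r mulr0 addr0.
  have -> : X z * (k%:R * X z ^+ k.-1 * - t) = k%:R * X z ^+ k * - t.
    by case: (k) => [|j]; rewrite ?mul0r ?mulr0//= exprS; ring.
  by rewrite -natr1; ring.
by apply: (W_eq (WM wX (W_exp (Wp s)))) => z; rewrite /E; ring.
Qed.

Let Lop_E k s z : Lop n (E k s) z = (n%:R - k%:R) / 2%:R * E k s z + - (s%:C / 2%:R) * E k.+1 s z.
Proof.
have w2 := WZ (- t) (WD (WZ k%:R (WE k.-1 s)) (WZ s%:C (WE k s))).
rewrite /Lop (Wdz (WE k s)) (Wdzbar w2) /E [X z ^+ k.+1]exprS.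
have h : k%:R * (X z * X z ^+ k.-1) = k%:R * X z ^+ k.
  by case: (k) => [|j]; rewrite ?mul0r//= exprS.
set P := X z ^+ k in h *; set Q := X z ^+ k.-1 in h *; set e := cexp _.
transitivity (n%:R / 2%:R * (P * e) - (k%:R * (X z * Q)) * (e / 2%:R) - (s%:C / 2%:R) * (X z * P * e)).
  by rewrite /X; field.
by rewrite h; field.
Qed.

Let Phi k s : C := cintegral (fun z => u z * E k s z).

Let q4 : (8^-1 : R) < 4^-1. Proof. lra. Qed.

Let iE k s : `|s| <= 2 -> cint (fun z => u z * E k s z).
Proof.
by move=> s2; apply: (L2gauss_cint hu q4 (ord_cont (oE k s2))); exact/ord0_bnd/oE.
Qed.

Let Phi_rec k s : `|s| <= 2 -> (n%:R - k%:R) * Phi k s = s%:C * Phi k.+1 s.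
Proof.
move=> s2; have := uLop (oE k s2).
rewrite (_ : (fun z => _) = fun z => (n%:R - k%:R) / 2%:R * (u z * E k s z) +
    - (s%:C / 2%:R) * (u z * E k.+1 s z)); last first.
  by apply/funext => z; rewrite Lop_E; ring.
rewrite cintegralD; [|exact/cintZ/iE|exact/cintZ/iE].
rewrite (cintegralZ ((n%:R - k%:R) / 2%:R)); last exact: iE.
rewrite (cintegralZ (- (s%:C / 2%:R))); last exact: iE.
rewrite -!/(Phi _ _); set a := Phi _ _; set b := Phi _ _ => h.
have -> : (n%:R - k%:R) * a = 2%:R * ((n%:R - k%:R) / 2%:R * a + - (s%:C / 2%:R) * b) + s%:C * b.
  by field.
by rewrite h mulr0 add0r.
Qed.

Let dPhi k (s : R) : -2 < s < 2 -> cder (Phi k) s (Phi k.+1 s).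
Proof.
move=> hs; have [K HK] := E_bnd k.+1.
have s2 r : -2 < r < 2 -> `|r| <= 2 :> R by rewrite ler_norml => /andP[/ltW -> /ltW ->].
apply: (@cder_cintegral R _ (fun s z => u z * E k.+1 s z)
  (fun z => K * (nm (u z) * expR (8^-1 * nm z ^+ 2))) _ _ _ hs) => [r /s2 r2|r z /s2 r2|r z /s2 r2|].
- exact: iE.
- have dp : cder (fun s => p s z) r (X z).
    exact: cder_affine.
  have := cderM (cder_cst (u z) r) (cderM (cder_cst (X z ^+ k) r) (cder_exp dp)).
  by move/cder_eq; apply; rewrite /E exprS; ring.
- by rewrite nmM mulrCA ler_wpM2l ?nm_ge0// HK.
- exact: rintZ (L2gauss_rint hu q4).
Qed.

(** For s nonzero the recurrence at k = n gives s Phi_{n+1} = 0; at s = 0 it is taken at k = n + 1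
    instead, where the coefficient n - k is -1. *)
Let PhiS0 (s : R) : `|s| <= 2 -> Phi n.+1 s = 0.
Proof.
move=> s2; have [->|s0] := eqVneq s 0.
  have := @Phi_rec n.+1 0; rewrite normr0 => /(_ (ltW _))/[!mul0r] h.
  have /eqP : (n%:R - n.+1%:R) * Phi n.+1 0 = 0 by apply: h.
  by rewrite -natr1 opprD addrA subrr add0r mulN1r oppr_eq0 => /eqP.
have /eqP := Phi_rec n s2; rewrite subrr mul0r eq_sym mulf_eq0 => /orP[/eqP|/eqP//].
by move=> /(congr1 Re) /= h; rewrite h eqxx in s0.
Qed.

Lemma moment_formula :
  n`!%:R * cintegral (fun z => u z * cexp (z^* / 2%:R * w + t * (w - z))) =
  cintegral (fun z => u z * ((t * (w - z)) ^+ n * cexp (z^* / 2%:R * w))).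
Proof.
have E1 : Phi 0 1 = cintegral (fun z => u z * cexp (z^* / 2%:R * w + t * (w - z))).
  by congr cintegral; apply/funext => z; rewrite /E /p expr0 !mul1r.
have i1 : `|1 : R| <= 2 by rewrite normr1 ler1n.
have E0 : Phi n 0 = cintegral (fun z => u z * ((t * (w - z)) ^+ n * cexp (z^* / 2%:R * w))).
  by congr cintegral; apply/funext => z; rewrite /E /p rmorph0 mul0r addr0.
rewrite -E1 -E0.
have -> : Phi n 0 = Phi n 1.
  have d0 s : -2 < s < 2 -> cder (Phi n) s 0.
    by move=> hs; rewrite -(@PhiS0 s); [exact: dPhi|rewrite ler_norml; lra].
  have I0 : -2 < (0 : R) < 2 by lra.
  have I1 : -2 < (1 : R) < 2 by lra.
  apply: complexP.
    exact: (@is_derive0_cst R (fun s => Re (Phi n s)) _ _ _ _ (fun s hs => (d0 s hs).1) I0 I1).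
  exact: (@is_derive0_cst R (fun s => Im (Phi n s)) _ _ _ _ (fun s hs => (d0 s hs).2) I0 I1).
(* At s = 1 the recurrence multiplies by n - k at each step, which builds the falling factorial and
   ends in n!. *)
have key k : (k <= n)%N -> Phi k 1 = (n ^_ k)%:R * Phi 0 1.
  elim: k => [|k IH] kn; first by rewrite ffactn0 mul1r.
  have := Phi_rec k i1; rewrite mul1r => <-.
  by rewrite IH ?(ltnW kn)// ffactnSr natrM natrB ?(ltnW kn)//; ring.
by rewrite (key n (leqnn n)) ffactnn.
Qed.
End Moments.

(** * The entire function given by the moments *)

(** The case j = 0 is the kernel of h. The second index closes the family under differentiation in
    w: the power lowers k, the exponential raises j. *)
Let kern (k j : nat) (w z : C) : C := (w - z) ^+ k * ((z^* / 2%:R) ^+ j * cexp (z^* / 2%:R * w)).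
Let H k j w : C := cintegral (fun z => u z * kern k j w z).

(* |z||w|/2 <= (3/16)|z|^2 + |w|^2/3, with room left for the polynomial factors;
   7/32 < 1/4 makes the kernels integrable against u. *)
Let kern_bnd k j : exists2 K : R, 0 <= K & forall w z,
  nm (kern k j w z) <= K * expR (2 / 5 * nm w ^+ 2) * expR (7 / 32 * nm z ^+ 2).
Proof.
(* The polynomial factors add b + 3a/2 to the exponent, with 3a/2 <= a^2/32 + 18 and b <= b^2/15 +
   15/4. Together with 3/16 and 1/3 from the mixed term this makes 7/32 and 2/5. *)
exists (k`!%:R * j`!%:R * expR (18 + 15 / 4)) => [|w z]; first by rewrite !mulr_ge0 ?expR_ge0.
set a := nm z; set b := nm w; have a0 : 0 <= a := nm_ge0 z; have b0 : 0 <= b := nm_ge0 w.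
rewrite -mulrA -expRD -mulrA -expRD nmM nmX nmM nmX nm_conj_half nm_cexp.
have h1 : nm (w - z) ^+ k <= k`!%:R * expR (b + a).
  apply: le_trans (exprn_le_expR k (nm_ge0 _)) _.
  by rewrite ler_wpM2l// ler_expR nmB.
have h2 : (a / 2) ^+ j <= j`!%:R * expR (a / 2) by apply: exprn_le_expR; rewrite divr_ge0.
have h3 : expR (Re (z^* / 2%:R * w)) <= expR (a * b / 2).
  rewrite ler_expR; apply: le_trans (le_trans (ler_norm _) (nm_Re _)) _.
  by rewrite nmM nm_conj_half mulrAC.
have e0 x : 0 <= expR x :> R := expR_ge0 x.
apply: le_trans (ler_pM (exprn_ge0 _ (nm_ge0 _)) _ h1 (ler_pM _ (e0 _) h2 h3)) _.
- by rewrite mulr_ge0 ?exprn_ge0// divr_ge0.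
- by rewrite exprn_ge0// divr_ge0.
rewrite [leLHS](_ : _ = k`!%:R * j`!%:R * (expR (b + a) * expR (a / 2) * expR (a * b / 2))); last by ring.
rewrite ler_wpM2l ?mulr_ge0// -!expRD ler_expR.
have := sqr_ge0 (a / 32 - 3 / 4); have := sqr_ge0 (b - 15 / 2); have := sqr_ge0 (3 * a - 4 * b); nra.
Qed.

Let ckern k j w : ccont (kern k j w).
Proof.
have ch := smoothW_cont smoothW_conj_half.
apply: ccontM; first by apply/ccontX/(ccont_reflect w (@ccont_id R)).
apply: ccontM; first exact: ccontX.
by apply: ccont_exp; apply: ccontM ch (ccont_cst w).
Qed.

Let q4 : (7 / 32 : R) < 4^-1. Proof. lra. Qed.

Let ikern k j w : cint (fun z => u z * kern k j w z).
Proof.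
have [K _ HK] := kern_bnd k j.
by apply: (L2gauss_cint hu q4 (ckern k j w)); exists (K * expR (2 / 5 * nm w ^+ 2)).
Qed.

Let H_bnd k j : bnd (2 / 5) (H k j).
Proof.
have [K K0 HK] := kern_bnd k j.
exists (2 * (K * rI (fun z => nm (u z) * expR (7 / 32 * nm z ^+ 2)))) => w.
have iu := L2gauss_rint hu q4.
set I := rI _; rewrite (_ : _ * expR _ = 2 * (K * expR (2 / 5 * nm w ^+ 2) * I)); last by ring.
rewrite /I -rIZ//; apply: cintegral_bound (ikern _ _ _) (rintZ _ iu) _ => z.
by rewrite nmM mulrCA ler_wpM2l ?nm_ge0.
Qed.

Let dd_H v k j : dd v (H k j) (fun w => v * (k%:R * H k.-1 j w + H k j.+1 w)).
Proof.
move=> w; have [K1 K10 HK1] := kern_bnd k.-1 j; have [K2 K20 HK2] := kern_bnd k j.+1.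
pose M := nm w + nm v.
pose dk (w z : C) := v * (k%:R * kern k.-1 j w z + kern k j.+1 w z).
have -> : v * (k%:R * H k.-1 j w + H k j.+1 w) = cintegral (fun z => u z * dk (w + (0 : R)%:C * v) z).
  rewrite rmorph0 mul0r addr0 /H -cintegralZ// -cintegralD//; last exact: cintZ.
  rewrite -(cintegralZ v); last by apply: cintD => //; exact: cintZ.
  by congr cintegral; apply/funext => z; rewrite /dk; ring.
have h01 : -1 < (0 : R) < 1 by lra.
apply: (@cder_cintegral R (fun s z => u z * kern k j (w + s%:C * v) z) (fun s z => u z * dk (w + s%:C * v) z)
  (fun z => nm v * (k%:R * K1 + K2) * expR (2 / 5 * M ^+ 2) * (nm (u z) * expR (7 / 32 * nm z ^+ 2))) _ _ _ h01).
- by move=> s _; exact: ikern.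
- move=> s z _; set y := w + s%:C * v.
  have d1 : cder (fun s => w + s%:C * v - z) s v.
    by apply: cder_eq (cderD (cder_affine w v s) (cder_cst (- z) s)) _; rewrite addr0.
  have dX m : cder (fun s => (w + s%:C * v - z) ^+ m) s (m%:R * v * (y - z) ^+ m.-1).
    elim: m => [|m IH]; first by apply: cder_eq (cder_cst 1 s) _; rewrite !mul0r.
    apply: (@cder_ext _ (fun s => (w + s%:C * v - z) * (w + s%:C * v - z) ^+ m)).
      by move=> r; rewrite exprS.
    apply: cder_eq (cderM d1 IH) _ => /=; rewrite -/y.
    have -> : (y - z) * (m%:R * v * (y - z) ^+ m.-1) = m%:R * v * (y - z) ^+ m.
      by case: (m) => [|i]; rewrite ?mul0r ?mulr0//= exprS; ring.
    by rewrite -[m.+1%:R]natr1; ring.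
  have dE := cder_exp (cderM (cder_cst (z^* / 2%:R) s) (cder_affine w v s)).
  have := cderM (cder_cst (u z) s) (cderM (dX k) (cderM (cder_cst ((z^* / 2%:R) ^+ j) s) dE)).
  by move/cder_eq; apply; rewrite -/y /dk /kern exprS; ring.
- move=> s z /andP[s1 s2]; set y := w + s%:C * v.
  have yM : nm y ^+ 2 <= M ^+ 2.
    rewrite ler_sqr ?nnegrE ?addr_ge0 ?nm_ge0//; apply: (le_trans (nmD _ _)).
    by rewrite lerD2l nmM nm_real ler_piMl ?nm_ge0// ler_norml; lra.
  have eM : expR (2 / 5 * nm y ^+ 2) <= expR (2 / 5 * M ^+ 2) by rewrite ler_expR ler_wpM2l.
  set XM := expR (_ * M ^+ 2) in eM *; set Z := expR (7 / 32 * _).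
  have Kb (K : R) : 0 <= K -> K * expR (2 / 5 * nm y ^+ 2) * Z <= K * (XM * Z).
    by move=> K0; rewrite -mulrA ler_wpM2l// ler_wpM2r ?expR_ge0.
  have b1 := le_trans (HK1 y z) (Kb _ K10); have b2 := le_trans (HK2 y z) (Kb _ K20).
  rewrite [leRHS](_ : _ = nm (u z) * (nm v * (k%:R * (K1 * (XM * Z)) + K2 * (XM * Z)))); last by ring.
  rewrite nmM ler_wpM2l ?nm_ge0// /dk (nmM v) ler_wpM2l ?nm_ge0//.
  apply: (le_trans (nmD _ _)); apply: lerD => //.
  by rewrite (nmM k%:R) nm_nat ler_wpM2l.
- exact: rintZ (L2gauss_rint hu q4).
Qed.

Let W_H k j : W (H k j) (fun w => k%:R * H k.-1 j w + H k j.+1 w) (fun=> 0).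
Proof.
by split=> w; apply: cder_eq (dd_H _ _ _ w) _; rewrite ?subr0 ?addr0 ?mul1r.
Qed.

Let H_cont k j : ccont (H k j).
Proof.
apply: (W_ccont (W_H k j)) => M.
have /bndK[K K0 HK] : bnd (2 / 5) (fun w => k%:R * H k.-1 j w + H k j.+1 w).
  apply: bndD (H_bnd _ _); rewrite -[2 / 5]add0r; apply: bndM (H_bnd _ _); exact: bnd_cst.
exists (K * expR (2 / 5 * M ^+ 2)) => z zM.
have h : nm z ^+ 2 <= M ^+ 2 by rewrite ler_sqr ?nnegrE ?nm_ge0// (le_trans (nm_ge0 z)).
rewrite nm0 mulr_ge0 ?expR_ge0//; split=> //.
by apply: (le_trans (HK z)); rewrite ler_wpM2l// ler_expR ler_wpM2l.
Qed.

(** As d_w sends [H] to combinations of members of the same family, the single estimate [H_bnd]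
    controls every derivative with the same exponent. *)
Let H_ord k j : ord (2 / 5) (H k j).
Proof.
move=> c hc m; apply: (@GW_impl _ (bnd (2 / 5))); first by move=> f; apply: bnd_le; exact: ltW.
elim: m k j => [|m IH] k j; first by [].
apply: (GW_S (H_cont k j) (H_bnd k j) (W_H k j)).
  apply: (GWD (@bndD _ (2 / 5))) (IH _ _).
  apply: (@GWM _ (bnd 0) (bnd (2 / 5))) (IH _ _); [exact: bndD|by move=> f g hf hg; rewrite -[2 / 5]add0r; exact: bndM|].
  by apply: GW_cst => ?; exact: bnd_cst.
by apply: GW_cst => ?; apply: bnd_cst; lra.
Qed.

Let h0 := H n 0.

Lemma moment_entire : entire h0.
Proof.
apply/entireP; exists (fun w => n%:R * H n.-1 0 w + H n 1 w); apply: W_cdiff (W_H n 0) _.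
by have := ord_cont (ord_dz (H_ord n 0)); rewrite (Wdz (W_H n 0)).
Qed.

Let u_cint f : ord 0 f -> cint (fun z => u z * f z).
Proof.
have q8 : (8^-1 : R) < 4^-1 by lra.
by move=> hf; apply: (L2gauss_cint hu q8 (ord_cont hf)); exact: ord0_bnd.
Qed.

Let moment t w : n`!%:R * cintegral (fun z => u z * expk t w z) =
  t ^+ n * (cexp (- (t * w)) * h0 w).
Proof.
have E : (fun z => u z * cexp (z^* / 2%:R * w + t * (w - z))) = fun z => cexp (t * w) * (u z * expk t w z).
  by apply/funext => z; rewrite /expk [RHS]mulrCA -cexpD; congr (_ * cexp _); ring.
have F : (fun z => u z * ((t * (w - z)) ^+ n * cexp (z^* / 2%:R * w))) = fun z => t ^+ n * (u z * kern n 0 w z).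
  by apply/funext => z; rewrite /kern exprMn expr0; ring.
have : n`!%:R * cintegral (fun z => cexp (t * w) * (u z * expk t w z)) =
    cintegral (fun z => t ^+ n * (u z * kern n 0 w z)) by rewrite -E -F; exact: moment_formula.
rewrite (cintegralZ (cexp _)); last exact: (u_cint (expk_ord t w)).
rewrite (cintegralZ (t ^+ n))// -/(H n 0 w) -/(h0 w) => h.
rewrite [RHS]mulrCA -h; have k : cexp (- (t * w)) * cexp (t * w) = 1 by rewrite -cexpD addNr cexp0.
transitivity ((cexp (- (t * w)) * cexp (t * w)) * (n`!%:R * cintegral (fun z => u z * expk t w z))).
  by rewrite k mul1r.
by set I := cintegral _; ring.
Qed.

(** * Comparison by characters *)

(** The factor n! comes from [moment_formula], the Gaussian mass from [iter_dz_moment]; with this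
    constant the moments of u and [kappa] G agree. *)
Let kappa : C := (n`!%:R * cintegral gauss)^-1.
Let G := iter n (@dz R) (fun z => h0 z * gauss z).
Let v z : C := u z + - kappa * G z.

Let m10 : (2 / 5 + - 2^-1 : R) < 0. Proof. lra. Qed.

Let G_ord : ord (2 / 5 + - 2^-1) G. Proof. exact: iter_dz_ord (H_ord n 0). Qed.

Let G_cint f : ord 0 f -> cint (fun z => G z * f z).
Proof. by move=> hf; apply: (ord_cint m10); rewrite -[_ + _]addr0; exact: ordM. Qed.

Let v_cint f : ord 0 f -> cint (fun z => v z * f z).
Proof.
move=> hf; have := cintD (u_cint hf) (cintZ (- kappa) (G_cint hf)).
by congr cint; apply/funext => z; rewrite /v; ring.
Qed.

Let v_expk t w : cintegral (fun z => v z * expk t w z) = 0.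
Proof.
have oe := expk_ord t w.
rewrite (_ : (fun z => _) = fun z => u z * expk t w z + - kappa * (G z * expk t w z)); last first.
  by apply/funext => z; rewrite /v; ring.
rewrite cintegralD; [|exact: u_cint|exact/cintZ/G_cint].
rewrite (cintegralZ (- kappa)); last exact: G_cint.
rewrite (iter_dz_moment n t w moment_entire (H_ord n 0)) -/h0.
have nf : (n`!%:R : C) != 0 by rewrite pnatr_eq0 -lt0n fact_gt0.
have g0 := cintegral_gauss_neq0.
apply: (mulfI nf); rewrite mulr0 mulrDr moment /kappa.
have key (m c X : C) : m != 0 -> c != 0 -> X + m * (- (m * c)^-1 * (X * c)) = 0.
  move=> m0 c0; transitivity (X - (m * c) * (m * c)^-1 * X); first by ring.
  by rewrite divff ?mulf_neq0// mul1r subrr.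
by rewrite -(key _ _ (t ^+ n * (cexp (- (t * w)) * h0 w)) nf g0) !mulrA.
Qed.

Let osc (a b : R) z : C := cexp (0 +i* (a * Re z + b * Im z)).

(** Here w = 2 tbar, so the exponent is conj(t z) - t z = -2i Im(t z), and t is solved for from -2
    Im(t z) = a x + b y. *)
Let osc_expk a b : exists t w, osc a b = expk t w.
Proof.
exists ((- b / 2) +i* (- a / 2)), ((- b) +i* a); apply/funext => z.
rewrite /osc /expk inv2C; congr cexp; case: z => x y.
by apply: complexP; rewrite !ReImE /=; field.
Qed.

Let v_osc a b : cint (fun z => v z * osc a b z) /\ cintegral (fun z => v z * osc a b z) = 0.
Proof.
have [t [w ->]] := osc_expk a b; split; last exact: v_expk.
by apply: v_cint; exact: expk_ord.
Qed.

Let oscE a b z : osc a b z = cos (a * Re z + b * Im z) +i* sin (a * Re z + b * Im z).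
Proof. by rewrite /osc cexpE /= expR0 !mul1r. Qed.

Let oscNE a b z : osc (- a) (- b) z = cos (a * Re z + b * Im z) -i* sin (a * Re z + b * Im z).
Proof. by rewrite oscE !mulNr -opprD cosN sinN. Qed.

(** As v is complex, the real part of one Fourier integral mixes Re v and Im v; combining opposite
    frequencies isolates the cosine, and likewise the sine. *)
Let v_cos a b : cintegral (fun z => v z * (cos (a * Re z + b * Im z))%:C) = 0.
Proof.
have [i1 e1] := v_osc a b; have [i2 e2] := v_osc (- a) (- b).
rewrite (_ : (fun z => _) = fun z => 2%:R^-1 * (v z * osc a b z) + 2%:R^-1 * (v z * osc (- a) (- b) z)).
  by rewrite cintegralD; [|exact: cintZ..]; rewrite !cintegralZ// e1 e2 !mulr0 addr0.
apply/funext => z; rewrite -mulrDr -mulrDr oscE oscNE mulrCA; congr (_ * _).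
by rewrite inv2C; simpc; congr (_ +i* _); field.
Qed.

Let v_sin a b : cintegral (fun z => v z * (sin (a * Re z + b * Im z))%:C) = 0.
Proof.
have [i1 e1] := v_osc a b; have [i2 e2] := v_osc (- a) (- b).
pose c : C := 0 +i* (- 2^-1).
rewrite (_ : (fun z => _) = fun z => c * (v z * osc a b z) + - c * (v z * osc (- a) (- b) z)).
  by rewrite cintegralD; [|exact: cintZ..]; rewrite !cintegralZ// e1 e2 !mulr0 addr0.
apply/funext => z; rewrite oscE oscNE mulrCA [- c * _]mulrCA -mulrDr; congr (_ * _).
by rewrite /c; simpc; congr (_ +i* _); field.
Qed.

Let v_ae0 : ae_eqC v (fun=> 0).
Proof.
have [vr vi] : cint v by have := v_cint (ord_cst 1); congr cint; apply/funext => z; rewrite mulr1.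
have hr : vanishing_trig (fun p : R * R => Re (v (ofxy p))).
  split => // a b; split.
    have := congr1 Re (v_cos a b) => /= h; rewrite -[RHS]h; apply: eq_Rintegral => p _.
    by rewrite cReM /= mulr0 subr0.
  have := congr1 Re (v_sin a b) => /= h; rewrite -[RHS]h; apply: eq_Rintegral => p _.
  by rewrite cReM /= mulr0 subr0.
have hi : vanishing_trig (fun p : R * R => Im (v (ofxy p))).
  split => // a b; split.
    have := congr1 Im (v_cos a b) => /= h; rewrite -[RHS]h; apply: eq_Rintegral => p _.
    by rewrite cImM /= mulr0 add0r.
  have := congr1 Im (v_sin a b) => /= h; rewrite -[RHS]h; apply: eq_Rintegral => p _.
  by rewrite cImM /= mulr0 add0r.
have := vanishing_trig_ae0 hr; have := vanishing_trig_ae0 hi.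
by apply: filterS2 => p /= hi' hr'; exact: complexP.
Qed.

Lemma landau_is_iter_dz : exists2 h, entire h &
  ae_eqC u (fun z => (n`!%:R * cintegral gauss)^-1 * iter n (@dz R) (fun z => h z * gauss z) z).
Proof.
exists h0; first exact: moment_entire.
case: v_ae0 => N [mN N0 sN]; exists N; split=> //.
apply: (subset_trans _ sN) => p /= np hp; apply: np.
by move: hp; rewrite /v mulNr => /eqP; rewrite subr_eq0 => /eqP.
Qed.
End LandauToTruePoly.

(** * Equality of the two spaces *)

Lemma iter_dzZ (c : C) f k : smoothW f ->
  iter k (@dz R) (fun z => c * f z) = (fun z => c * iter k (@dz R) f z).
Proof.
move=> sf; have si j : smoothW (iter j (@dz R) f) by elim: j => [//|j IH]; exact: smoothW_dz.
by elim: k => [//|k IH]; rewrite iterS IH; exact: Wdz (WZ c (smoothW_W (si k))).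
Qed.

Lemma entireZ (c : C) h : entire h -> entire (fun z => c * h z).
Proof.
move=> /entire_smooth[H [dH /entireP[H' dH'] _]].
apply/entireP; exists (fun z => c * H z); apply: W_cdiff (ccontZ c (cdiff_ccont dH')).
by apply: (W_eq (WZ c (cdiff_W dH))) => // z; rewrite mulr0.
Qed.
End LandauLevels.

Theorem theorem5p18 (R : realType) (l : nat) (hl : (0 < l)%N) :
  landau_level R l = true_polyRBF R l.
Proof.
case: l hl => // n _.
pose cl : R[i] := (2%:R ^+ n / Num.sqrt n`!%:R)%:C.
have cl0 : cl != 0.
  have : 0 < 2%:R ^+ n / Num.sqrt n`!%:R :> R.
    by rewrite divr_gt0 ?exprn_gt0// sqrtr_gt0 ltr0n fact_gt0.
  by move=> r0; apply/eqP => /(congr1 (@complex.Re R)) /= r1; move: r0; rewrite r1 ltxx.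
have rhsE h : (fun z => cl * cexp (`|z| ^+ 2 / 2%:R - z ^+ 2 / 4%:R)
    * iter n (@dz R) (fun w => h w * cexp (- (`|w| ^+ 2 / 2%:R))) z) =
   (fun z => cl * laminv z * iter n (@dz R) (fun w => h w * gauss w) z).
  have -> : (fun w => h w * cexp (- (`|w| ^+ 2 / 2%:R))) = (fun w => h w * gauss w).
    by apply/funext => w; rewrite /gauss -normC_sq.
  by apply/funext => z; rewrite /laminv -normC_sq.
apply/seteqP; split => f [hf].
  move=> /(dist_eq_Box n hf) H; split => //.
  have hu := L2w_L2gauss hf.
  have [h eh fE] := landau_is_iter_dz hu (fun g => Lop_ord0 hu H).
  set k := (_ * _)^-1 in fE.
  (* The constant found for u is exchanged for the normalisation of [true_polyRBF] by rescaling the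
     entire function. *)
  exists (fun z => k / cl * h z); first exact: entireZ.
  rewrite -/cl rhsE; case: fE => N [mN N0 sN]; exists N; split=> //.
  apply: (subset_trans _ sN) => p /= np hp; apply: np.
  have [h' [_ _ sh]] := entire_smooth eh.
  have -> : (fun w => k / cl * h w * gauss w) = (fun w => k / cl * (h w * gauss w)).
    by apply/funext => w; exact: esym (mulrA _ _ _).
  rewrite iter_dzZ; last by apply: smoothWM => //; exact: smooth_gauss.
  have := lamK (ofxy p); move: hp; set I := iter _ _ _ _ => hp l1.
  transitivity (laminv (ofxy p) * (f (ofxy p) * lam (ofxy p))).
    by rewrite mulrCA l1 mulr1.
  have gen (a b c d : R[i]) : b != 0 -> a * (c * d) = b * a * (c / b * d) by move=> b0; field.
  by rewrite hp; exact: gen.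
move=> [h eh]; rewrite -/cl rhsE => fE; split => //.
by apply/(dist_eq_Box n hf); exact: (iter_dz_landau eh hf fE).
Qed.
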